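(* Let $k$ be a field of characteristic $2$, let $\alpha_2$ be the algebraic group over $k$ co-represented by the Hopf algebra $k[x]/x^2$ with $x$ primitive, and let $B\alpha_2$ be the stack of $\alpha_2$-torsors. Let $i : Model(B\alpha_2)\to Model(\operatorname{Spec} k)$ be the partially-defined transfer map along the canonical fppf cover $\operatorname{Spec} k\to B\alpha_2$, and let $j_1, j_2 : Model(\operatorname{Spec} k)\to Model(\operatorname{Spec} k\times_{B\alpha_2}\operatorname{Spec} k)$ be the two partially-defined transfer maps along the two projections $\operatorname{Spec} k\times_{B\alpha_2}\operatorname{Spec} k\to \operatorname{Spec} k$. Then there exist two distinct elements $a,b$ in $Model(B\alpha_2)$ such that: \begin{itemize} \item $i(a)$ and $i(b)$ are well-defined (i.e. both transfer model structures exist), \item $i(a)=i(b)$, \item $j_1(i(a))$ and $j_2(i(a))$ are well-defined (and consequently $j_1(i(a))=j_2(i(a))$). \end{itemize} Consequently, even if $Model$ is a well-defined presheaf, it is not a separated presheaf in the fppf topology, hence not a sheaf in the fppf topology.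
   Context: For an algebraic stack $Y$, $Model(Y)$ denotes the collection of cofibrantly generated closed model structures on the category of quasicoherent $\mathcal{O}_Y$-modules. Let $\tau$ be one of the Zariski, étale, or fppf topologies. For an algebraic stack $X$ in the topology $\tau$, consider the category of algebraic stacks $Y$ in the $\tau$-topology equipped with maps $Y\to X$ which are components of some covering family in $\tau$. For a map $f: Y'\to Y$ in this category, $Model(f): Model(Y)\to Model(Y')$ is the partially-defined function sending a model structure on quasicoherent $\mathcal{O}_Y$-modules to the transfer model structure, if it exists, on quasicoherent $\mathcal{O}_{Y'}$-modules, i.e. the model structure in which a map $g: M\to N$ of quasicoherent $\mathcal{O}_{Y'}$-modules is a weak equivalence (respectively, fibration) if and only if the direct image $f_*g: f_*M\to f_*N$ is a weak equivalence (respectively, fibration) in the given model structure on quasicoherent $\mathcal{O}_Y$-modules. ''$Model$ as a presheaf'' refers to this (partially-defined) assignment $Y\mapsto Model(Y)$, $f\mapsto Model(f)$. The sheaf condition for a $\tau$-cover $Y\to X$ asks that $$Model(X)\to Model(Y)\rightrightarrows Model(Y\times_X Y)$$ be an equalizer sequence; separatedness asks that $Model(X)\to Model(Y)$ be injective. The algebraic group $\alpha_2$ is given on affines by letting $\alpha_2(\operatorname{Spec} R)$ be the group of square-zero elements of $R$ under addition, for $R$ a commutative $k$-algebra. $B\alpha_2$ is the fppf algebraic (Artin) stack of $\alpha_2$-torsors, i.e. the fppf algebraic stack associated to the groupoid affine scheme $(\operatorname{Spec} k,\operatorname{Spec} k[x]/x^2)$, and $\operatorname{Spec} k\to B\alpha_2$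 is the cover naturally associated to this presentation. The map $i$ is $Model(f)$ for $f:\operatorname{Spec} k\to B\alpha_2$ this cover, and $j_1,j_2$ are $Model(p_1),Model(p_2)$ for $p_1,p_2$ the two projections $\operatorname{Spec} k\times_{B\alpha_2}\operatorname{Spec} k\to\operatorname{Spec} k$. *)

(* Defs.v *)
From HB Require Import structures.
From mathcomp Require Import all_boot all_order all_algebra.
From mathcomp Require Import boolp mpoly ring.

Set Implicit Arguments.
Unset Strict Implicit.
Unset Printing Implicit Defensive.

Import GRing.Theory.
Local Open Scope ring_scope.

(* "Set" means a type in the universe of the carriers of modules.  The
   categories below are larger, so smallness has to be imposed on the indices
   of (co)limits, on ordinals and on sets of generators. *)
Notation small := Type@{GRing.Lmodule.axioms_.u0} (only parsing).

Record category := Category {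
  obj :> Type;
  hom : obj -> obj -> Type;
  idm : forall X, hom X X;
  comp : forall X Y Z, hom Y Z -> hom X Y -> hom X Z;
  comp1m : forall X Y (f : hom X Y), comp (idm Y) f = f;
  compm1 : forall X Y (f : hom X Y), comp f (idm X) = f;
  compA : forall X Y Z W (h : hom Z W) (g : hom Y Z) (f : hom X Y),
    comp h (comp g f) = comp (comp h g) f
}.

Arguments hom {c} : rename.
Arguments idm {c} X : rename.
Notation "g ∘ f" := (comp g f) (at level 40, left associativity).

Record functor (C D : category) := Functor {
  fob :> C -> D;
  fmap : forall X Y, hom X Y -> hom (fob X) (fob Y);
  fmap_id : forall X, fmap (idm X) = idm (fob X);
  fmap_comp : forall X Y Z (g : hom Y Z) (f : hom X Y),
    fmap (g ∘ f) = fmap g ∘ fmap f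
}.

Definition is_right_adjoint (C D : category) (L : functor C D)
    (G : functor D C) : Prop :=
  exists phi : forall (c : C) (d : D), hom (L c) d -> hom c (G d),
    [/\ forall c d, bijective (@phi c d),
        forall c d d' (g : hom d d') (h : hom (L c) d),
          phi c d' (g ∘ h) = fmap G g ∘ phi c d h
      & forall c c' d (f : hom c' c) (h : hom (L c) d),
          phi c' d (h ∘ fmap L f) = phi c d h ∘ f].

(* Diagrams indexed by small directed graphs; diagrams indexed by small
   categories are among them and have the same (co)limits. *)
Record diagram (C : category) := Diagram {
  vertex : small;
  edge : vertex -> vertex -> small;
  dob :> vertex -> C;
  darr : forall v w, edge v w -> hom (dob v) (dob w)
}.

Definition is_cone (C : category) (D : diagram C) (L : C)
    (p : forall v, hom L (D v)) : Prop :=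
  forall v w (e : edge v w), darr e ∘ p v = p w.

Definition is_cocone (C : category) (D : diagram C) (L : C)
    (q : forall v, hom (D v) L) : Prop :=
  forall v w (e : edge v w), q w ∘ darr e = q v.

Definition is_limit (C : category) (D : diagram C) (L : C)
    (p : forall v, hom L (D v)) : Prop :=
  is_cone p /\
  forall (Z : C) (z : forall v, hom Z (D v)), is_cone z ->
    exists! u : hom Z L, forall v, p v ∘ u = z v.

Definition is_colimit (C : category) (D : diagram C) (L : C)
    (q : forall v, hom (D v) L) : Prop :=
  is_cocone q /\
  forall (Z : C) (z : forall v, hom (D v) Z), is_cocone z ->
    exists! u : hom L Z, forall v, u ∘ q v = z v.

Definition bicomplete (C : category) : Prop :=
  forall D : diagram C,
    (exists (L : C) (p : forall v, hom L (D v)), is_limit p) /\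
    (exists (L : C) (q : forall v, hom (D v) L), is_colimit q).

Definition morclass (C : category) := forall X Y : C, hom X Y -> Prop.

Definition lifts (C : category) (A B X Y : C) (i : hom A B) (p : hom X Y)
    : Prop :=
  forall (u : hom A X) (v : hom B Y), p ∘ u = v ∘ i ->
    exists h : hom B X, h ∘ i = u /\ p ∘ h = v.

Definition retract_of (C : category) (X Y X' Y' : C)
    (f : hom X Y) (g : hom X' Y') : Prop :=
  exists (i : hom X X') (r : hom X' X) (j : hom Y Y') (s : hom Y' Y),
    [/\ r ∘ i = idm X, s ∘ j = idm Y, g ∘ i = j ∘ f & f ∘ r = s ∘ g].

Definition retract_closed (C : category) (P : morclass C) : Prop :=
  forall (X Y X' Y' : C) (f : hom X Y) (g : hom X' Y'),
    retract_of f g -> P _ _ g -> P _ _ f.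

Record model_data (C : category) := ModelData {
  weq : morclass C;
  fib : morclass C;
  cof : morclass C
}.

Arguments weq {C} m {X Y} : rename.
Arguments fib {C} m {X Y} : rename.
Arguments cof {C} m {X Y} : rename.

Record closed_model_structure (C : category) (m : model_data C) : Prop := {
  cms_bicomplete : bicomplete C;
  cms_2of3 : forall (X Y Z : C) (f : hom X Y) (g : hom Y Z),
    [/\ weq m f -> weq m g -> weq m (g ∘ f),
        weq m f -> weq m (g ∘ f) -> weq m g
      & weq m g -> weq m (g ∘ f) -> weq m f];
  cms_retract :
    [/\ retract_closed (@weq C m), retract_closed (@fib C m)
      & retract_closed (@cof C m)];
  cms_lift : forall (A B X Y : C) (i : hom A B) (p : hom X Y),
    cof m i -> fib m p -> weq m i \/ weq m p -> lifts i p;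
  cms_factor : forall (X Y : C) (f : hom X Y),
    (exists (Z : C) (i : hom X Z) (p : hom Z Y),
       [/\ cof m i, weq m i, fib m p & p ∘ i = f]) /\
    (exists (Z : C) (i : hom X Z) (p : hom Z Y),
       [/\ cof m i, fib m p, weq m p & p ∘ i = f])
}.

(* Ordinals, as small well-orders. *)
Record wellorder := WellOrder {
  wo_sort :> small;
  wo_lt : wo_sort -> wo_sort -> Prop;
  wo_trans : forall a b c, wo_lt a b -> wo_lt b c -> wo_lt a c;
  wo_total : forall a b, [\/ wo_lt a b, a = b | wo_lt b a];
  wo_wf : well_founded wo_lt
}.

Definition wo_le (L : wellorder) (a b : L) : Prop := a = b \/ wo_lt a b.
Definition wo_zero (L : wellorder) (a : L) : Prop := forall b, wo_le a b.
Definition wo_succ (L : wellorder) (a b : L) : Prop :=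
  wo_lt a b /\ forall c, wo_lt a c -> wo_le b c.
Definition wo_limit (L : wellorder) (c : L) : Prop :=
  (exists a, wo_lt a c) /\
  forall a, wo_lt a c -> exists2 b, wo_lt a b & wo_lt b c.

(* The ordinal [L] is a limit ordinal in which every subset of cardinality
   at most that of [K] is bounded. *)
Definition filtered_ordinal (K : small) (L : wellorder) : Prop :=
  [/\ exists a : L, True,
      forall a : L, exists b, wo_lt a b
    & forall f : K -> L, exists b, forall x, wo_le (f x) b].

Record sequence (C : category) (L : wellorder) := Sequence {
  sob :> L -> C;
  smap : forall a b, wo_le a b -> hom (sob a) (sob b);
  smap_id : forall a (h : wo_le a a), smap h = idm (sob a);
  smap_comp : forall a b c (h : wo_le a b) (h' : wo_le b c) (h'' : wo_le a c),
    smap h' ∘ smap h = smap h''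
}.

Definition seq_diagram (C : category) (L : wellorder) (X : sequence C L)
    : diagram C :=
  @Diagram C L (fun a b => wo_le a b) X (@smap C L X).

Definition seq_below (C : category) (L : wellorder) (X : sequence C L) (c : L)
    : diagram C :=
  @Diagram C {a : L | wo_lt a c} (fun a b => wo_le (sval a) (sval b))
    (fun a => X (sval a)) (fun a b h => smap X h).

Definition continuous_seq (C : category) (L : wellorder) (X : sequence C L)
    : Prop :=
  forall c : L, wo_limit c ->
    @is_colimit C (seq_below X c) (X c)
      (fun a => smap X (or_intror (svalP a))).

Definition steps_in (C : category) (P : morclass C) (L : wellorder)
    (X : sequence C L) : Prop :=
  forall (a b : L) (h : wo_le a b), wo_succ a b -> P _ _ (smap X h).

Definition small_relative (C : category) (A : C) (P : morclass C) : Prop :=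
  exists K : small, forall L : wellorder, filtered_ordinal K L ->
  forall X : sequence C L, continuous_seq X -> steps_in P X ->
  forall (Z : C) (q : forall a, hom (X a) Z),
    @is_colimit C (seq_diagram X) Z q ->
    (forall f : hom A Z, exists (a : L) (g : hom A (X a)), q a ∘ g = f) /\
    (forall (a b : L) (g : hom A (X a)) (g' : hom A (X b)),
       q a ∘ g = q b ∘ g' ->
       exists (c : L) (h : wo_le a c) (h' : wo_le b c),
         smap X h ∘ g = smap X h' ∘ g').

Record mapset (C : category) := MapSet {
  mindex : small;
  msrc : mindex -> C;
  mtgt : mindex -> C;
  marr : forall i, hom (msrc i) (mtgt i)
}.

Definition injectives (C : category) (I : mapset C) : morclass C :=
  fun X Y f => forall i : mindex I, lifts (marr i) f.

Definition pushout_of (C : category) (I : mapset C) : morclass C :=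
  fun X Y f => exists (i : mindex I) (u : hom (msrc i) X) (v : hom (mtgt i) Y),
    f ∘ u = v ∘ marr i /\
    forall (Z : C) (x : hom X Z) (y : hom (mtgt i) Z), x ∘ u = y ∘ marr i ->
      exists! w : hom Y Z, w ∘ f = x /\ w ∘ v = y.

(* [q z], with z least, is the transfinite composition of the sequence X. *)
Inductive cell (C : category) (I : mapset C) : morclass C :=
  Cell (L : wellorder) (X : sequence C L) (z : L) (Z : C)
    (q : forall a, hom (X a) Z) of
    wo_zero z & continuous_seq X & steps_in (pushout_of I) X &
    @is_colimit C (seq_diagram X) Z q : @cell C I (X z) Z (q z).

Definition cofibrantly_generated (C : category) (m : model_data C) : Prop :=
  exists I J : mapset C,
    [/\ forall i : mindex I, small_relative (msrc i) (@cell C I),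
        forall j : mindex J, small_relative (msrc j) (@cell C J),
        forall (X Y : C) (f : hom X Y), fib m f <-> injectives J f
      & forall (X Y : C) (f : hom X Y),
          fib m f /\ weq m f <-> injectives I f].

Definition model_structure (C : category) :=
  {m : model_data C | closed_model_structure m /\ cofibrantly_generated m}.

Definition transferred (C D : category) (G : functor D C)
    (a : model_structure C) (b : model_structure D) : Prop :=
  forall (M N : D) (g : hom M N),
    (weq (sval b) g <-> weq (sval a) (fmap G g)) /\
    (fib (sval b) g <-> fib (sval a) (fmap G g)).

Definition semilinear (R S : comNzRingType) (phi : R -> S)
    (M : lmodType R) (N : lmodType S) (u : M -> N) : Prop :=
  forall (r : R) (m m' : M), u (r *: m + m') = phi r *: u m + u m'.

(* [u] exhibits N as the base change of M along phi. *)
Definition is_base_change (R S : comNzRingType) (phi : R -> S)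
    (M : lmodType R) (N : lmodType S) (u : M -> N) : Prop :=
  semilinear phi u /\
  forall (L : lmodType S) (g : M -> L), semilinear phi g ->
    exists! h : {linear N -> L}, h \o u =1 g.

Definition flat (R S : comNzRingType) (phi : R -> S) : Prop :=
  forall (M M' : lmodType R) (N N' : lmodType S) (u : M -> N) (u' : M' -> N')
         (i : {linear M -> M'}) (j : {linear N -> N'}),
    is_base_change phi u -> is_base_change phi u' -> j \o u =1 u' \o i ->
    injective i -> injective j.

Definition faithfully_flat (R S : comNzRingType) (phi : R -> S) : Prop :=
  flat phi /\
  forall (M : lmodType R) (N : lmodType S) (u : M -> N),
    is_base_change phi u -> (forall n : N, n = 0) -> forall m : M, m = 0.

Definition finitely_presented (R S : comNzRingType) (phi : R -> S) : Prop :=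
  exists (n : nat) (e : {rmorphism {mpoly R[n]} -> S})
         (gs : seq {mpoly R[n]}),
    [/\ forall c : R, e c%:MP = phi c,
        forall s : S, exists p, e p = s
      & forall p, e p = 0 <->
          exists q : 'I_(size gs) -> {mpoly R[n]},
            p = \sum_(i < size gs) q i * gs`_i].

Definition fppf (R S : comNzRingType) (phi : R -> S) : Prop :=
  faithfully_flat phi /\ finitely_presented phi.

(* A category over affine schemes, in which stacks are presented as categories
   fibred in groupoids.  The empty scheme is left out of the base: over it
   every stack has a single object and every module is zero.  Arrows follow
   the ring maps: [a : phom x y] lies over Spec [pring a] : Spec S -> Spec R,
   and would usually be drawn from y to x. *)
Record catAff := CatAff {
  pob :> comNzRingType -> Type;
  phom : forall R S, pob R -> pob S -> Type;
  pring : forall R S (x : pob R) (y : pob S),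
    phom x y -> {rmorphism R -> S};
  pid : forall R (x : pob R), phom x x;
  pcomp : forall R S T (x : pob R) (y : pob S) (z : pob T),
    phom y z -> phom x y -> phom x z;
  pring_id : forall R (x : pob R), pring (pid x) =1 id;
  pring_comp : forall R S T (x : pob R) (y : pob S) (z : pob T)
    (b : phom y z) (a : phom x y), pring (pcomp b a) =1 pring b \o pring a;
  pcomp1m : forall R S (x : pob R) (y : pob S) (a : phom x y),
    pcomp (pid y) a = a;
  pcompm1 : forall R S (x : pob R) (y : pob S) (a : phom x y),
    pcomp a (pid x) = a;
  pcompA : forall R S T U (x : pob R) (y : pob S) (z : pob T) (w : pob U)
    (c : phom z w) (b : phom y z) (a : phom x y),
    pcomp c (pcomp b a) = pcomp (pcomp c b) a
}.

Arguments phom {c R S} : rename.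
Arguments pid {c R} x : rename.

Definition fibered_in_groupoids (X : catAff) : Prop :=
  (forall (R S : comNzRingType) (phi : {rmorphism R -> S}) (x : X R),
     exists (y : X S) (a : phom x y), pring a =1 phi) /\
  (forall (R S T : comNzRingType) (x : X R) (y : X S) (z : X T)
     (a : phom x y) (b : phom x z) (chi : {rmorphism S -> T}),
     chi \o pring a =1 pring b ->
     exists! c : phom y z, pring c =1 chi /\ pcomp c a = b).

Record catAff_map (X Y : catAff) := CatAffMap {
  mob :> forall R, X R -> Y R;
  mhom : forall R S (x : X R) (y : X S), phom x y -> phom (mob x) (mob y);
  mring : forall R S (x : X R) (y : X S) (a : phom x y),
    pring (mhom a) =1 pring a;
  mhom_id : forall R (x : X R), mhom (pid x) = pid (mob x);
  mhom_comp : forall R S T (x : X R) (y : X S) (z : X T)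
    (b : phom y z) (a : phom x y), mhom (pcomp b a) = pcomp (mhom b) (mhom a)
}.

(* For every x : Spec R -> X, the fibre product Spec R x_X Y is an affine
   scheme Spec S (through the universal arrow [a]) and Spec S -> Spec R is an
   fppf cover. *)
Definition affine_fppf_cover (X Y : catAff) (f : catAff_map Y X) : Prop :=
  forall (R : comNzRingType) (x : X R),
  exists (S : comNzRingType) (y : Y S) (a : phom x (f S y)),
    fppf (pring a) /\
    forall (T : comNzRingType) (y' : Y T) (b : phom x (f T y')),
      exists! c : phom y y', pcomp (mhom f c) a = b.

Lemma rmorph_ext (R S : pzSemiRingType) (f g : {rmorphism R -> S}) :
  f =1 g -> f = g.
Proof.
case: f g => [f [[f1] [f2]]] [g [[g1] [g2]]] /= /funext fg; subst g.
by congr (GRing.RMorphism.Pack (GRing.RMorphism.Class _ _));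
   congr (_ _); exact: Prop_irrelevance.
Qed.

Lemma linear_ext (R : pzRingType) (M N : lmodType R) (f g : {linear M -> N}) :
  f =1 g -> f = g.
Proof.
case: f g => [f [[f1] [f2]]] [g [[g1] [g2]]] /= /funext fg; subst g.
by congr (GRing.Linear.Pack (GRing.Linear.Class _ _));
   congr (_ _); exact: Prop_irrelevance.
Qed.

Lemma sig_ext (T : Type) (P : T -> Prop) (u v : {x : T | P x}) :
  sval u = sval v -> u = v.
Proof.
by case: u v => [x px] [y py] /= xy; subst y; congr exist; exact: Prop_irrelevance.
Qed.

#[local] Obligation Tactic := idtac.

Program Definition Spec (A : comNzRingType) : catAff :=
  @CatAff (fun R => {rmorphism A -> R})
    (fun R S x y => {phi : {rmorphism R -> S} | phi \o x =1 y})
    (fun R S x y a => sval a)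
    (fun R x => exist _ (idfun : {rmorphism R -> R}) _)
    (fun R S T x y z b a =>
       exist _ (sval b \o sval a : {rmorphism R -> T}) _) _ _ _ _ _.
Next Obligation. by []. Qed.
Next Obligation.
by move=> A R S T x y z [b hb] [a ha] r /=; rewrite -hb /= -ha.
Qed.
Next Obligation. by []. Qed.
Next Obligation. by []. Qed.
Next Obligation. by move=> *; apply: sig_ext; apply: rmorph_ext. Qed.
Next Obligation. by move=> *; apply: sig_ext; apply: rmorph_ext. Qed.
Next Obligation. by move=> *; apply: sig_ext; apply: rmorph_ext. Qed.

Section FibreProduct.
Variables (X Y Z : catAff) (f : catAff_map X Z) (g : catAff_map Y Z).

(* In a category fibred in groupoids the arrows over identities, such as
   [glue], are invertible. *)
Record fibprod_ob (R : comNzRingType) := FibprodOb {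
  fst_ob : X R;
  snd_ob : Y R;
  glue : phom (f R fst_ob) (g R snd_ob);
  glue_ring : pring glue =1 id
}.

Definition fibprod_hom (R S : comNzRingType) (p : fibprod_ob R) (q : fibprod_ob S) :=
  {ab : phom (fst_ob p) (fst_ob q) * phom (snd_ob p) (snd_ob q) |
    pring ab.1 =1 pring ab.2 /\
    pcomp (glue q) (mhom f ab.1) = pcomp (mhom g ab.2) (glue p)}.

Program Definition fibprod_comp (R S T : comNzRingType) (p : fibprod_ob R)
    (q : fibprod_ob S) (r : fibprod_ob T) (b : fibprod_hom q r) (a : fibprod_hom p q)
    : fibprod_hom p r :=
  exist _ (pcomp (sval b).1 (sval a).1, pcomp (sval b).2 (sval a).2) _.
Next Obligation.
move=> R S T p q r [[b1 b2] /= [rb hb]] [[a1 a2] /= [ra ha]]; split.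
  by move=> s; rewrite !pring_comp /= ra rb.
by rewrite !mhom_comp pcompA hb -pcompA ha pcompA.
Qed.

Program Definition fibprod : catAff :=
  @CatAff fibprod_ob fibprod_hom
    (fun R S p q a => pring (sval a).1)
    (fun R p => exist _ (pid (fst_ob p), pid (snd_ob p)) _)
    fibprod_comp _ _ _ _ _.
Next Obligation.
move=> R p /=; split; first by move=> s; rewrite !pring_id.
by rewrite !mhom_id pcomp1m pcompm1.
Qed.
Next Obligation. by move=> R p s /=; rewrite pring_id. Qed.
Next Obligation. by move=> R S T p q r b a s /=; rewrite pring_comp. Qed.
Next Obligation.
by move=> R S p q [[a1 a2] ha]; apply: sig_ext; rewrite /= !pcomp1m.
Qed.
Next Obligation.
by move=> R S p q [[a1 a2] ha]; apply: sig_ext; rewrite /= !pcompm1.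
Qed.
Next Obligation. by move=> *; apply: sig_ext; rewrite /= !pcompA. Qed.

Program Definition fibprod_pr1 : catAff_map fibprod X :=
  @CatAffMap fibprod X (@fst_ob) (fun R S p q a => (sval a).1) _ _ _.
Next Obligation. by []. Qed.
Next Obligation. by []. Qed.
Next Obligation. by []. Qed.

Program Definition fibprod_pr2 : catAff_map fibprod Y :=
  @CatAffMap fibprod Y (@snd_ob) (fun R S p q a => (sval a).2) _ _ _.
Next Obligation. by move=> R S p q [[a1 a2] [ha ?]] s /=; rewrite ha. Qed.
Next Obligation. by []. Qed.
Next Obligation. by []. Qed.

End FibreProduct.

(* An R-module for each x : Spec R -> X, compatible with base change. *)
Record qcoh (X : catAff) := Qcoh {
  qsec :> forall R, X R -> lmodType R;
  qres : forall R S (x : X R) (y : X S), phom x y -> qsec x -> qsec y;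
  qres_id : forall R (x : X R), qres (pid x) =1 id;
  qres_comp : forall R S T (x : X R) (y : X S) (z : X T)
    (b : phom y z) (a : phom x y), qres (pcomp b a) =1 qres b \o qres a;
  qres_bc : forall R S (x : X R) (y : X S) (a : phom x y),
    is_base_change (pring a) (qres a)
}.

Arguments qres {X} q {R S x y} a : rename.

Definition qhom (X : catAff) (F G : qcoh X) :=
  {t : forall R (x : X R), {linear F R x -> G R x} |
    forall R S (x : X R) (y : X S) (a : phom x y),
      t S y \o qres F a =1 qres G a \o t R x}.

Lemma qhom_ext (X : catAff) (F G : qcoh X) (s t : qhom F G) :
  (forall R (x : X R), sval s R x =1 sval t R x) -> s = t.
Proof.
move=> st; apply: sig_ext; apply: functional_extensionality_dep => R.
by apply: functional_extensionality_dep => x; apply: linear_ext; exact: st.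
Qed.

Program Definition QCoh (X : catAff) : category :=
  @Category (qcoh X) (@qhom X)
    (fun F => exist _ (fun R x => (idfun : {linear F R x -> F R x})) _)
    (fun F G H t s =>
       exist _ (fun R x => (sval t R x \o sval s R x
                              : {linear F R x -> H R x})) _) _ _ _.
Next Obligation. by []. Qed.
Next Obligation.
move=> X F G H [t ht] [s hs] R S x y a m /=.
by have /= -> := hs _ _ _ _ a m; have /= -> := ht _ _ _ _ a (s R x m).
Qed.
Next Obligation. by move=> *; apply: qhom_ext. Qed.
Next Obligation. by move=> *; apply: qhom_ext. Qed.
Next Obligation. by move=> *; apply: qhom_ext. Qed.

Section Pullback.
Variables (X Y : catAff) (f : catAff_map X Y).

Program Definition pullback_ob (F : qcoh Y) : qcoh X :=
  @Qcoh X (fun R x => F R (f R x)) (fun R S x y a => qres F (mhom f a)) _ _ _.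
Next Obligation. by move=> F R x m /=; rewrite mhom_id qres_id. Qed.
Next Obligation. by move=> F R S T x y z b a m /=; rewrite mhom_comp qres_comp. Qed.
Next Obligation.
move=> F R S x y a /=.
by have /funext <- := mring f a; exact: (qres_bc F).
Qed.

Program Definition pullback : functor (QCoh Y) (QCoh X) :=
  @Functor (QCoh Y) (QCoh X) pullback_ob
    (fun F G t => exist _ (fun R x => sval t R (f R x)) _) _ _.
Next Obligation. by move=> F G [t ht] R S x y a m /=; exact: ht. Qed.
Next Obligation. by move=> F; apply: qhom_ext. Qed.
Next Obligation. by move=> *; apply: qhom_ext. Qed.

End Pullback.

Definition Model (X : catAff) := model_structure (QCoh X).

(* [transfer f a b]: the partial function Model(f) is defined at [a], with
   value [b].  The direct image of f is the right adjoint of the pullback. *)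
Definition transfer (Y X : catAff) (f : catAff_map Y X)
    (a : Model X) (b : Model Y) : Prop :=
  exists G : functor (QCoh Y) (QCoh X),
    is_right_adjoint (pullback f) G /\ transferred G a b.

Definition separated_along (Y X : catAff) (f : catAff_map Y X) : Prop :=
  forall (a b : Model X) (c : Model Y),
    transfer f a c -> transfer f b c -> a = b.

(* With Model(f), Model(pr1) and Model(pr2) partial functions: Model(f) is
   injective with image the elements on which Model(pr1) and Model(pr2) are
   defined and agree. *)
Definition sheaf_along (Y X : catAff) (f : catAff_map Y X) : Prop :=
  [/\ separated_along f,
      forall (a : Model X) (c : Model Y), transfer f a c ->
        exists d, transfer (fibprod_pr1 f f) c d /\ transfer (fibprod_pr2 f f) c d
    & forall (c : Model Y) d,
        transfer (fibprod_pr1 f f) c d -> transfer (fibprod_pr2 f f) c d ->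
        exists a : Model X, transfer f a c].

Definition fppf_separated (X : catAff) : Prop :=
  forall (Y : catAff) (f : catAff_map Y X),
    fibered_in_groupoids Y -> affine_fppf_cover f -> separated_along f.

Definition fppf_sheaf (X : catAff) : Prop :=
  forall (Y : catAff) (f : catAff_map Y X),
    fibered_in_groupoids Y -> affine_fppf_cover f -> sheaf_along f.

Definition alpha2 (T : comNzRingType) := {a : T | a ^+ 2 = 0}.

Lemma alpha2_map_subproof (T T' : comNzRingType) (chi : {rmorphism T -> T'})
  (a : alpha2 T) : chi (sval a) ^+ 2 = 0.
Proof. by rewrite -rmorphXn (svalP a) rmorph0. Qed.

Definition alpha2_map (T T' : comNzRingType) (chi : {rmorphism T -> T'})
    (a : alpha2 T) : alpha2 T' :=
  exist _ (chi (sval a)) (alpha2_map_subproof chi a).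

(* An alpha_2-torsor Spec B -> Spec R, with alpha_2 acting on the functor of
   points Hom(B, -) of Spec B; as alpha_2 is affine, all its torsors are affine
   over the base.  R has characteristic 2, so a sum of square-zero elements
   (the group law of alpha_2) is again square-zero. *)
Record torsor (R : comNzRingType) := Torsor {
  tring : comNzRingType;
  tstr : {rmorphism R -> tring};
  tfppf : fppf tstr;
  tact : forall T : comNzRingType,
    alpha2 T -> {rmorphism tring -> T} -> {rmorphism tring -> T};
  tact_over : forall (T : comNzRingType) a (p : {rmorphism tring -> T}),
    tact a p \o tstr =1 p \o tstr;
  tact_nat : forall (T T' : comNzRingType) (chi : {rmorphism T -> T'}) a
    (p : {rmorphism tring -> T}),
    chi \o tact a p
      =1 tact (alpha2_map chi a) (chi \o p : {rmorphism tring -> T'});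
  tact_zero : forall (T : comNzRingType) (a : alpha2 T) (p : {rmorphism tring -> T}),
    sval a = 0 -> tact a p =1 p;
  tact_add : forall (T : comNzRingType) (a b c : alpha2 T)
    (p : {rmorphism tring -> T}),
    sval c = sval a + sval b -> tact c p =1 tact a (tact b p);
  tact_trans : forall (T : comNzRingType) (p q : {rmorphism tring -> T}),
    p \o tstr =1 q \o tstr -> exists! a : alpha2 T, tact a p =1 q
}.

Section ClassifyingStack.
Variable k : fieldType.

(* The first component is the structure map Spec R -> Spec k. *)
Definition B_ob (R : comNzRingType) := ({rmorphism k -> R} * torsor R)%type.

Record B_hom (R S : comNzRingType) (x : B_ob R) (y : B_ob S) := BHom {
  B_base : {rmorphism R -> S};
  B_total : {rmorphism tring x.2 -> tring y.2};
  B_base_k : B_base \o x.1 =1 y.1;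
  B_square : B_total \o tstr x.2 =1 tstr y.2 \o B_base;
  B_equiv : forall (T : comNzRingType) (a : alpha2 T)
    (p : {rmorphism tring y.2 -> T}),
    tact a p \o B_total =1 tact a (p \o B_total : {rmorphism tring x.2 -> T})
}.

Lemma B_hom_ext R S (x : B_ob R) (y : B_ob S) (a b : B_hom x y) :
  B_base a =1 B_base b -> B_total a =1 B_total b -> a = b.
Proof.
case: a b => [a1 a2 h1 h2 h3] [b1 b2 g1 g2 g3] /= /rmorph_ext e1 /rmorph_ext e2.
subst b1 b2; rewrite (Prop_irrelevance h1 g1) (Prop_irrelevance h2 g2).
by rewrite (Prop_irrelevance h3 g3).
Qed.

Program Definition B_id (R : comNzRingType) (x : B_ob R) : B_hom x x :=
  @BHom R R x x idfun idfun _ _ _.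
Next Obligation. by []. Qed.
Next Obligation. by []. Qed.
Next Obligation. by move=> R x T a p s /=; congr (tact a _ s); apply: rmorph_ext. Qed.

Program Definition B_comp (R S T : comNzRingType) (x : B_ob R) (y : B_ob S)
    (z : B_ob T) (b : B_hom y z) (a : B_hom x y) : B_hom x z :=
  @BHom R T x z (B_base b \o B_base a) (B_total b \o B_total a) _ _ _.
Next Obligation.
move=> R S T x y z b a r /=.
by have /= -> := B_base_k a r; have /= -> := B_base_k b r.
Qed.
Next Obligation.
move=> R S T x y z b a r /=.
by have /= -> := B_square a r; have /= -> := B_square b (B_base a r).
Qed.
Next Obligation.
move=> R S T x y z b a U c p s /=.
have /= -> := B_equiv b c p (B_total a s).
have /= -> := B_equiv a c (p \o B_total b : {rmorphism _ -> _}) s.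
by congr (tact c _ s); apply: rmorph_ext.
Qed.

Program Definition Balpha2 : catAff :=
  @CatAff B_ob B_hom B_base B_id B_comp _ _ _ _ _.
Next Obligation. by []. Qed.
Next Obligation. by []. Qed.
Next Obligation. by move=> *; apply: B_hom_ext. Qed.
Next Obligation. by move=> *; apply: B_hom_ext. Qed.
Next Obligation. by move=> *; apply: B_hom_ext. Qed.

End ClassifyingStack.

(* R[x]/(x^2), the pair (r, s) standing for r + s x. *)
Definition dual (R : comNzRingType) := (R * R)%type.

Section Dual.
Variable R : comNzRingType.

HB.instance Definition _ := GRing.Zmodule.copy (dual R) (R * R)%type.

Definition dual_one : dual R := (1, 0).
Definition dual_mul (u v : dual R) : dual R :=
  (u.1 * v.1, u.1 * v.2 + u.2 * v.1).

Fact dual_mulA : associative dual_mul.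
Proof. by move=> [a b] [c d] [e f]; congr pair => /=; ring. Qed.
Fact dual_mulC : commutative dual_mul.
Proof. by move=> [a b] [c d]; congr pair => /=; ring. Qed.
Fact dual_mul1 : left_id dual_one dual_mul.
Proof. by move=> [a b]; congr pair => /=; ring. Qed.
Fact dual_mulD : left_distributive dual_mul +%R.
Proof. by move=> [a b] [c d] [e f]; congr pair => /=; ring. Qed.
Fact dual_one_neq0 : dual_one != 0.
Proof. by apply/eqP => -[] /eqP; rewrite oner_eq0. Qed.

HB.instance Definition _ := GRing.Zmodule_isComNzRing.Build (dual R)
  dual_mulA dual_mulC dual_mul1 dual_mulD dual_one_neq0.

Definition dual_const (r : R) : dual R := (r, 0).

Fact dual_const_additive : zmod_morphism dual_const.
Proof. by move=> r s; congr pair => /=; ring. Qed.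
Fact dual_const_multiplicative : monoid_morphism dual_const.
Proof. by split=> // r s; congr pair => /=; ring. Qed.

HB.instance Definition _ :=
  GRing.isZmodMorphism.Build R (dual R) dual_const dual_const_additive.
HB.instance Definition _ :=
  GRing.isMonoidMorphism.Build R (dual R) dual_const dual_const_multiplicative.

Definition dual_x : dual R := (0, 1).

Lemma dualE (u : dual R) : u = dual_const u.1 + dual_const u.2 * dual_x.
Proof. by case: u => a b; congr pair => /=; ring. Qed.

Lemma dual_x2 : dual_x ^+ 2 = 0.
Proof. by congr pair => /=; ring. Qed.

End Dual.

Definition dual_ext (R T : comNzRingType) (phi : R -> T) (a : alpha2 T)
  (u : dual R) : T := phi u.1 + phi u.2 * sval a.

Section DualExt.
Variables (R T : comNzRingType) (phi : {rmorphism R -> T}) (a : alpha2 T).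

Fact dual_ext_additive : zmod_morphism (dual_ext phi a).
Proof. by move=> [r s] [r' s']; rewrite /dual_ext /= !rmorphB; ring. Qed.

Fact dual_ext_multiplicative : monoid_morphism (dual_ext phi a).
Proof.
split=> [|[r s] [r' s']]; first by rewrite /dual_ext /= rmorph1 rmorph0 mul0r addr0.
have a2 := svalP a; rewrite /dual_ext /= !rmorphD !rmorphM.
transitivity ((phi r + phi s * sval a) * (phi r' + phi s' * sval a)
              - phi s * phi s' * sval a ^+ 2); first by ring.
by rewrite a2 mulr0 subr0.
Qed.

HB.instance Definition _ :=
  GRing.isZmodMorphism.Build (dual R) T (dual_ext phi a) dual_ext_additive.
HB.instance Definition _ :=
  GRing.isMonoidMorphism.Build (dual R) T (dual_ext phi a)
    dual_ext_multiplicative.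
End DualExt.

Definition dual_map (R S : comNzRingType) (phi : R -> S) (u : dual R) : dual S :=
  (phi u.1, phi u.2).

Section DualMap.
Variables (R S : comNzRingType) (phi : {rmorphism R -> S}).

Fact dual_map_additive : zmod_morphism (dual_map phi).
Proof. by move=> [r s] [r' s']; congr pair; rewrite /= rmorphB. Qed.

Fact dual_map_multiplicative : monoid_morphism (dual_map phi).
Proof.
split=> [|[r s] [r' s']]; first by congr pair; rewrite /= ?rmorph1 ?rmorph0.
by congr pair; rewrite /= ?rmorphD ?rmorphM.
Qed.

HB.instance Definition _ :=
  GRing.isZmodMorphism.Build (dual R) (dual S) (dual_map phi) dual_map_additive.
HB.instance Definition _ :=
  GRing.isMonoidMorphism.Build (dual R) (dual S) (dual_map phi)
    dual_map_multiplicative.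
End DualMap.

Definition dualmod (R : comNzRingType) (M : lmodType R) := (M * M)%type.

Section DualMod.
Variables (R : comNzRingType) (M : lmodType R).

HB.instance Definition _ := GRing.Zmodule.copy (dualmod M) (M * M)%type.

Definition dual_scale (u : dual R) (m : dualmod M) : dualmod M :=
  (u.1 *: m.1, u.1 *: m.2 + u.2 *: m.1).

Fact dual_scaleA u v m :
  dual_scale u (dual_scale v m) = dual_scale (u * v) m.
Proof.
case: u v m => [a b] [c d] [m n]; congr pair => /=; first by rewrite scalerA.
by rewrite scalerDr scalerDl !scalerA addrA.
Qed.
Fact dual_scale1 : left_id 1 dual_scale.
Proof. by move=> [m n]; congr pair; rewrite /= !scale1r ?scale0r ?addr0. Qed.
Fact dual_scaleDr : right_distributive dual_scale +%R.
Proof.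
move=> [a b] [m n] [m' n']; congr pair; rewrite /= !scalerDr //.
by rewrite addrACA.
Qed.
Fact dual_scaleDl m : {morph dual_scale^~ m : u v / u + v}.
Proof.
move=> [a b] [c d]; case: m => m n; congr pair; rewrite /= !scalerDl //.
by rewrite addrACA.
Qed.

HB.instance Definition _ := GRing.Zmodule_isLmodule.Build (dual R) (dualmod M)
  dual_scaleA dual_scale1 dual_scaleDr dual_scaleDl.
End DualMod.

Section DualBaseChange.
Variables (R : comNzRingType) (M : lmodType R).

Let uM : M -> dualmod M := fun m => (m, 0).

Lemma dualmodE (m : dualmod M) : m = uM m.1 + dual_x R *: uM m.2.
Proof.
case: m => m n; congr pair => /=; first by rewrite scale0r addr0.
by rewrite scale0r scale1r !add0r.
Qed.

Lemma dual_base_change : is_base_change (@dual_const R) uM.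
Proof.
split=> [r m m'|L g gP].
  by congr pair; rewrite /= ?scale0r ?scaler0 ?addr0.
have gD m m' : g (m + m') = g m + g m'.
  by have := gP 1 m m'; rewrite scale1r rmorph1 scale1r.
have g0 : g 0 = 0 by apply: (@addrI _ (g 0)); rewrite -gD !addr0.
have gZ r m : g (r *: m) = dual_const r *: g m.
  by have := gP r m 0; rewrite g0 !addr0.
pose h (m : dualmod M) := g m.1 + dual_x R *: g m.2.
have hP : linear h.
  move=> u [m n] [m' n']; rewrite /h /= !gD !gZ.
  have -> : u *: (g m + dual_x R *: g n)
          = dual_const u.1 *: g m + dual_x R *: (dual_const u.1 *: g n)
            + dual_x R *: (dual_const u.2 *: g m).
    rewrite [in LHS](dualE u) scalerDl !scalerDr !scalerA -!addrA.
    congr (_ + _); rewrite [dual_const u.2 * dual_x R]mulrC.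
    rewrite [_ * dual_x R]mulrC -[X in _ *: g n + (_ + X *: _)]mulrA.
    rewrite [dual_const u.2 * dual_x R]mulrC mulrA -expr2 dual_x2 mul0r.
    by rewrite scale0r addr0.
  rewrite !scalerDr -!addrA; congr (_ + _).
  by rewrite [X in _ = _ + X]addrCA [RHS]addrCA.
pose hL := HB.pack_for {linear dualmod M -> L} h
  (GRing.isLinear.Build _ _ _ _ h hP).
exists hL; split=> [m|h' h'P]; first by rewrite /= /h /= g0 scaler0 addr0.
apply: linear_ext => m; rewrite [in RHS](dualmodE m) linearD linearZ /=.
by have /= -> := h'P m.1; have /= -> := h'P m.2.
Qed.
End DualBaseChange.

Lemma dual_base_change_inv (R : comNzRingType) (M : lmodType R)
    (N : lmodType (dual R)) (u : M -> N) :
  is_base_change (@dual_const R) u ->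
  exists (h : {linear N -> dualmod M}) (h' : {linear dualmod M -> N}),
    [/\ forall m, h (u m) = (m, 0), forall m, h' (m, 0) = u m & cancel h h'].
Proof.
move=> [uP uU]; have [vP vU] := dual_base_change M.
have [h [hP _]] := uU _ _ vP; have [h' [h'P _]] := vU _ _ uP.
exists h, h'; split=> [m|m|n]; [exact: hP|exact: h'P|].
have [g [_ gU]] := uU _ _ uP.
have e1 : g = (h' \o h : {linear N -> N}).
  by apply: gU => m /=; have /= -> := hP m; exact: h'P.
have e2 : g = (idfun : {linear N -> N}) by exact: gU.
exact: (congr1 (fun f : {linear N -> N} => f n) (etrans (esym e1) e2)).
Qed.

Lemma dual_faithfully_flat (R : comNzRingType) :
  faithfully_flat (@dual_const R).
Proof.
split=> [M M' N N' u u' i j bu bu' ji iI|M N u bu N0 m]; last first.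
  have [h [_ [hu _ _]]] := dual_base_change_inv bu.
  by have := hu m; rewrite (N0 (u m)) linear0 => -[].
have [h [v [hu vu hK]]] := dual_base_change_inv bu.
have [h' [_ [hu' _ _]]] := dual_base_change_inv bu'.
have key n : h' (j n) = (i (h n).1, i (h n).2).
  rewrite -{1}(hK n); move: (h n) => m.
  rewrite [in LHS](dualmodE m) !linearD !linearZ /= !vu.
  have /= -> := ji m.1; have /= -> := ji m.2; rewrite !hu'.
  by symmetry; exact: (dualmodE (i m.1, i m.2)).
move=> n n' /(congr1 h'); rewrite !key => -[/iI e1 /iI e2].
by apply: (can_inj hK); rewrite [LHS]surjective_pairing e1 e2 -surjective_pairing.
Qed.

Lemma dual_finitely_presented (R : comNzRingType) :
  finitely_presented (@dual_const R).
Proof.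
pose X : {mpoly R[1]} := 'X_ord0.
pose e : {rmorphism {mpoly R[1]} -> dual R} :=
  mmap (@dual_const R) (fun=> dual_x R).
have eC c : e c%:MP = dual_const c by rewrite /e /= mmapC.
have eX : e X = dual_x R by rewrite /e /= mmapX mmap1U.
have norm p : exists (q : {mpoly R[1]}) (a b : R),
    p = q * X ^+ 2 + a%:MP + b%:MP * X.
  elim/mpolyind: p => [|c m p _ _ [q [a [b ->]]]].
    by exists 0, 0, 0; rewrite !mpolyC0; ring.
  have -> : 'X_[m] = X ^+ (m ord0) :> {mpoly R[1]}.
    by rewrite mpolyXE_id big_ord1.
  rewrite -mul_mpolyC; case: (m ord0) => [|[|d]].
  - by exists q, (c + a), b; rewrite mpolyCD; ring.
  - by exists q, a, (c + b); rewrite mpolyCD; ring.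
  - by exists (c%:MP * X ^+ d + q), a, b; rewrite !exprS; ring.
exists 1%N, e, [:: X ^+ 2]; split=> //.
  move=> u; exists (u.1%:MP + u.2%:MP * X).
  by rewrite rmorphD rmorphM !eC eX -dualE.
move=> p; split=> [|[q ->]]; last first.
  by rewrite big_ord1 /= rmorphM rmorphXn eX dual_x2 mulr0.
have [q [a [b ->]]] := norm p.
have -> : e (q * X ^+ 2 + a%:MP + b%:MP * X) = (a, b) :> dual R.
  rewrite 2!rmorphD [e (q * _)]rmorphM rmorphXn eX dual_x2 mulr0 add0r.
  by rewrite rmorphM !eC eX [RHS]dualE.
move=> [-> ->]; exists (fun=> q).
by rewrite big_ord1 /= !mpolyC0 mul0r !addr0.
Qed.

Section Trivial.
Variables (R : comNzRingType) (R2 : 2%N \in [pchar R]).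

Lemma two_eq0 (T : comNzRingType) (p : {rmorphism R -> T}) : 2%:R = 0 :> T.
Proof. by rewrite -(rmorph_nat p) (pcharf0 R2) rmorph0. Qed.

Lemma trivial_act_subproof (T : comNzRingType) (a : alpha2 T)
  (p : {rmorphism dual R -> T}) : (p (dual_x R) + sval a) ^+ 2 = 0.
Proof.
have t0 := two_eq0 (p \o @dual_const R : {rmorphism R -> T}).
rewrite sqrrD (svalP a) -rmorphXn dual_x2 rmorph0 add0r addr0.
by rewrite -mulr_natl t0 mul0r.
Qed.

(* a in alpha_2(T) translates the point x |-> t of Spec R[x]/(x^2) to
   x |-> t + a. *)
Definition trivial_act (T : comNzRingType) (a : alpha2 T)
    (p : {rmorphism dual R -> T}) : {rmorphism dual R -> T} :=
  dual_ext (p \o @dual_const R)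
    (exist _ (p (dual_x R) + sval a) (trivial_act_subproof a p)).

Lemma trivial_actE (T : comNzRingType) (a : alpha2 T)
    (p : {rmorphism dual R -> T}) (u : dual R) :
  trivial_act a p u = p u + p (dual_const u.2) * sval a.
Proof.
by rewrite [in RHS](dualE u) rmorphD rmorphM /= /dual_ext /=; ring.
Qed.

Program Definition trivial_torsor : torsor R :=
  @Torsor R (dual R) (@dual_const R) _ trivial_act _ _ _ _ _.
Next Obligation.
by split; [exact: dual_faithfully_flat|exact: dual_finitely_presented].
Qed.
Next Obligation.
by move=> T a p r /=; rewrite trivial_actE /= (rmorph0 (@dual_const R)) rmorph0
  mul0r addr0.
Qed.
Next Obligation.
move=> T T' chi a p u.
by rewrite -[LHS]/(chi (trivial_act a p u)) !trivial_actE rmorphD rmorphM.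
Qed.
Next Obligation. by move=> T a p a0 u; rewrite trivial_actE a0 mulr0 addr0. Qed.
Next Obligation.
move=> T a b c p cE u; rewrite !trivial_actE cE /=.
by rewrite (rmorph0 (@dual_const R)) rmorph0 mul0r addr0; ring.
Qed.
Next Obligation.
move=> T p q pq.
have ha : (q (dual_x R) - p (dual_x R)) ^+ 2 = 0.
  have t0 := two_eq0 (p \o @dual_const R : {rmorphism R -> T}).
  by rewrite sqrrB -!rmorphXn dual_x2 !rmorph0 -mulr_natl t0; ring.
exists (exist (fun b : T => b ^+ 2 = 0) _ ha); split=> [u|a aP].
  have dec (g : {rmorphism dual R -> T}) :
      g u = g (dual_const u.1) + g (dual_const u.2) * g (dual_x R).
    by rewrite -rmorphM -rmorphD -dualE.
  have pq' r : p (dual_const r) = q (dual_const r) := pq r.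
  by rewrite trivial_actE (dec p) (dec q) !pq' /=; ring.
apply: sig_ext => /=; have := aP (dual_x R).
by rewrite trivial_actE rmorph1 mul1r => <-; ring.
Qed.
End Trivial.

Section Cover.
Variables (k : fieldType) (k2 : 2%N \in [pchar k]).

Lemma pchar_alg (R : comNzRingType) (x : {rmorphism k -> R}) :
  2%N \in [pchar R].
Proof. exact: (rmorph_pchar x). Qed.

(* Spec k -> B alpha_2, classifying the trivial torsor over Spec k. *)
Program Definition alpha2_cover : catAff_map (Spec k) (Balpha2 k) :=
  @CatAffMap (Spec k) (Balpha2 k)
    (fun R x => (x, trivial_torsor (pchar_alg x)))
    (fun R S x y a => @BHom k R S (x, trivial_torsor (pchar_alg x))
       (y, trivial_torsor (pchar_alg y)) (sval a) (dual_map (sval a)) _ _ _)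
    _ _ _.
Next Obligation. by move=> R S x y [a ha]. Qed.
Next Obligation. by move=> R S x y [a ha] r; congr pair; rewrite /= rmorph0. Qed.
Next Obligation.
move=> R S x y [a ha] T c p u.
rewrite -[LHS]/(trivial_act (pchar_alg y) c p (dual_map a u)).
by rewrite [RHS]trivial_actE trivial_actE /=; congr (_ + p _ * _);
   congr pair; rewrite /= rmorph0.
Qed.
Next Obligation. by []. Qed.
Next Obligation. by move=> R x; apply: B_hom_ext => //= -[]. Qed.
Next Obligation. by move=> R S T x y z b a; apply: B_hom_ext. Qed.

End Cover.

(* Main.v *)
From HB Require Import structures.
From mathcomp Require Import all_boot all_algebra.
From mathcomp Require Import boolp ring.
Require Import Defs.

Set Implicit Arguments.
Unset Strict Implicit.
Unset Printing Implicit Defensive.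

Import GRing.Theory.
Local Open Scope ring_scope.

(** Quasi-coherent modules on B alpha_2 are representations of alpha_2, that is,
    modules over the ring k[d] / (d^2) dual to the Hopf algebra of alpha_2
    ([fibre_equivalence]).  Pullback to Spec k forgets d, so representations that
    differ become alike there.

    For an object W of a bicomplete category, let every map be a weak equivalence
    and let the fibrations be the maps with respect to which W is projective.
    This is a model structure, cofibrantly generated by 0 -> W ([proj_model]).  A
    right adjoint transfers the structure of W to that of the image L W of W
    under the left adjoint ([proj_model_transferred]).  On B alpha_2, take the
    structures of the free module of rank one and of the one-dimensional trivial
    module.  They differ, since the surjection of the free module onto the trivial
    one is not split.  On Spec k both become free and nonzero, and then the
    fibrations are the surjections in both cases ([proj_fib_free]).  So the two
    transfers are equal, and they transfer further along both projections to the
    same structure, because both pullbacks have the same value at the initial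
    object of the fibre product ([two_models]).

    What takes work is to know the categories of modules.  Spec k and the fibre
    product have initial objects, so modules on them are determined by their
    values there ([sections_equivalence]).  For B alpha_2 every torsor over Spec R
    has to be understood.  Its universal translation is b |-> b + D(b) x with an
    R-linear derivation D of square zero; faithful flatness shows that the kernel
    of D is R ([torsor_ker]) and that D t = 1 for some t ([torsor_D1]).  Hence the
    total space is R[t] with t^2 in R, free on 1 and t ([torsor_coord]).  With such
    coordinates, descent along the torsor is an explicit computation
    ([torsor_descent]), which gives full faithfulness of the fibre functor, and the
    sheaf of a representation can be written down ([fibre_surj]).  Limits, colimits
    and direct images are obtained through these equivalences. *)

(** * Submodules, products, quotients and presentations *)

Definition mklin (A : comNzRingType) (M N : lmodType A) (f : M -> N)
    (fP : linear f) : {linear M -> N} :=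
  HB.pack_for {linear M -> N} f (GRing.isLinear.Build _ _ _ _ f fP).

Section Submodule.
Variables (A : comNzRingType) (M : lmodType A).

Definition submod_closed (P : M -> Prop) : Prop :=
  P 0 /\ forall (a : A) (m m' : M), P m -> P m' -> P (a *: m + m').

Variables (P : M -> Prop) (hP : submod_closed P).

Definition submod of submod_closed P := {m : M | P m}.
Local Notation U := (submod hP).

HB.instance Definition _ := gen_eqMixin U.
HB.instance Definition _ := gen_choiceMixin U.

Fact sub_addP (x y : U) : P (sval x + sval y).
Proof. by rewrite -[sval x]scale1r; apply: hP.2; exact: svalP. Qed.
Fact sub_scaleP (a : A) (x : U) : P (a *: sval x).
Proof. by rewrite -[_ *: _]addr0; apply: hP.2; [exact: svalP|exact: hP.1]. Qed.
Fact sub_oppP (x : U) : P (- sval x).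
Proof. by rewrite -scaleN1r; exact: sub_scaleP. Qed.

Definition sub_zero : U := exist _ 0 hP.1.
Definition sub_add (x y : U) : U := exist _ _ (sub_addP x y).
Definition sub_opp (x : U) : U := exist _ _ (sub_oppP x).
Definition sub_scale (a : A) (x : U) : U := exist _ _ (sub_scaleP a x).

Fact sub_addA : associative sub_add.
Proof. by move=> x y z; apply: sig_ext; exact: addrA. Qed.
Fact sub_addC : commutative sub_add.
Proof. by move=> x y; apply: sig_ext; exact: addrC. Qed.
Fact sub_add0 : left_id sub_zero sub_add.
Proof. by move=> x; apply: sig_ext; exact: add0r. Qed.
Fact sub_addN : left_inverse sub_zero sub_opp sub_add.
Proof. by move=> x; apply: sig_ext; exact: addNr. Qed.

HB.instance Definition _ := GRing.isZmodule.Build U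
  sub_addA sub_addC sub_add0 sub_addN.

Fact sub_scaleA a b (x : U) : sub_scale a (sub_scale b x) = sub_scale (a * b) x.
Proof. by apply: sig_ext; exact: scalerA. Qed.
Fact sub_scale1 : left_id 1 sub_scale.
Proof. by move=> x; apply: sig_ext; exact: scale1r. Qed.
Fact sub_scaleDr : right_distributive sub_scale +%R.
Proof. by move=> a x y; apply: sig_ext; exact: scalerDr. Qed.
Fact sub_scaleDl (x : U) : {morph sub_scale^~ x : a b / a + b}.
Proof. by move=> a b; apply: sig_ext; exact: scalerDl. Qed.

HB.instance Definition _ := GRing.Zmodule_isLmodule.Build A U
  sub_scaleA sub_scale1 sub_scaleDr sub_scaleDl.

Fact sub_val_linear : linear (fun x : U => sval x : M).
Proof. by []. Qed.
Definition sub_val : {linear U -> M} := mklin sub_val_linear.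

End Submodule.

Section Product.
Variables (A : comNzRingType) (V : Type) (M : V -> lmodType A).

Definition dprod := forall v, M v.

HB.instance Definition _ := gen_eqMixin dprod.
HB.instance Definition _ := gen_choiceMixin dprod.

Definition dprod_add (f g : dprod) : dprod := fun v => f v + g v.
Definition dprod_opp (f : dprod) : dprod := fun v => - f v.
Definition dprod_zero : dprod := fun v => 0.
Definition dprod_scale (a : A) (f : dprod) : dprod := fun v => a *: f v.

Fact dprod_addA : associative dprod_add.
Proof. by move=> f g h; apply: functional_extensionality_dep => v; exact: addrA. Qed.
Fact dprod_addC : commutative dprod_add.
Proof. by move=> f g; apply: functional_extensionality_dep => v; exact: addrC. Qed.
Fact dprod_add0 : left_id dprod_zero dprod_add.
Proof. by move=> f; apply: functional_extensionality_dep => v; exact: add0r. Qed.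
Fact dprod_addN : left_inverse dprod_zero dprod_opp dprod_add.
Proof. by move=> f; apply: functional_extensionality_dep => v; exact: addNr. Qed.

HB.instance Definition _ := GRing.isZmodule.Build dprod
  dprod_addA dprod_addC dprod_add0 dprod_addN.

Fact dprod_scaleA a b f : dprod_scale a (dprod_scale b f) = dprod_scale (a * b) f.
Proof. by apply: functional_extensionality_dep => v; exact: scalerA. Qed.
Fact dprod_scale1 : left_id 1 dprod_scale.
Proof. by move=> f; apply: functional_extensionality_dep => v; exact: scale1r. Qed.
Fact dprod_scaleDr : right_distributive dprod_scale +%R.
Proof. by move=> a f g; apply: functional_extensionality_dep => v; exact: scalerDr. Qed.
Fact dprod_scaleDl f : {morph dprod_scale^~ f : a b / a + b}.
Proof. by move=> a b; apply: functional_extensionality_dep => v; exact: scalerDl. Qed.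

HB.instance Definition _ := GRing.Zmodule_isLmodule.Build A dprod
  dprod_scaleA dprod_scale1 dprod_scaleDr dprod_scaleDl.

End Product.

(** A module up to an equivalence relation; [quotmod] below is the module of
    its classes.  Both quotients by submodules and modules given by generators
    and relations arise in this way. *)
Record premod (A : comNzRingType) := Premod {
  pcar : Type;
  pzero : pcar;
  padd : pcar -> pcar -> pcar;
  popp : pcar -> pcar;
  pscale : A -> pcar -> pcar;
  peq : pcar -> pcar -> Prop;
  peq_refl : forall x, peq x x;
  peq_sym : forall x y, peq x y -> peq y x;
  peq_trans : forall x y z, peq x y -> peq y z -> peq x z;
  peq_add : forall x x' y y', peq x x' -> peq y y' -> peq (padd x y) (padd x' y');
  peq_opp : forall x x', peq x x' -> peq (popp x) (popp x');
  peq_scale : forall a x x', peq x x' -> peq (pscale a x) (pscale a x');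
  peq_addA : forall x y z, peq (padd x (padd y z)) (padd (padd x y) z);
  peq_addC : forall x y, peq (padd x y) (padd y x);
  peq_add0 : forall x, peq (padd pzero x) x;
  peq_addN : forall x, peq (padd (popp x) x) pzero;
  peq_scaleA : forall a b x, peq (pscale a (pscale b x)) (pscale (a * b) x);
  peq_scale1 : forall x, peq (pscale 1 x) x;
  peq_scaleDr : forall a x y,
    peq (pscale a (padd x y)) (padd (pscale a x) (pscale a y));
  peq_scaleDl : forall a b x, peq (pscale (a + b) x) (padd (pscale a x) (pscale b x))
}.

Section Quotient.
Variables (A : comNzRingType) (X : premod A).

Definition quotmod := {S : pcar X -> Prop | exists x, S = peq x}.

HB.instance Definition _ := gen_eqMixin quotmod.
HB.instance Definition _ := gen_choiceMixin quotmod.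

Definition cls (x : pcar X) : quotmod := exist _ (peq x) (ex_intro _ x erefl).
Definition repr (q : quotmod) : pcar X := projT1 (cid (svalP q)).

Lemma clsK q : cls (repr q) = q.
Proof. by apply: sig_ext; rewrite /repr /=; case: cid => x /= ->. Qed.

Lemma cls_eq x y : cls x = cls y <-> peq x y.
Proof.
split=> [/(congr1 sval) /= e|xy]; first by rewrite e; exact: peq_refl.
apply: sig_ext => /=; apply/funext => z; apply/propext.
split; first by apply: peq_trans; exact: peq_sym.
exact: peq_trans.
Qed.

Lemma reprK x : peq (repr (cls x)) x.
Proof. by apply/cls_eq; exact: clsK. Qed.

Definition quot_add (p q : quotmod) := cls (padd (repr p) (repr q)).
Definition quot_opp (p : quotmod) := cls (popp (repr p)).
Definition quot_scale (a : A) (p : quotmod) := cls (pscale a (repr p)).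

Fact quot_addE x y : quot_add (cls x) (cls y) = cls (padd x y).
Proof. by apply/cls_eq; apply: peq_add; exact: reprK. Qed.
Fact quot_oppE x : quot_opp (cls x) = cls (popp x).
Proof. by apply/cls_eq; apply: peq_opp; exact: reprK. Qed.
Fact quot_scaleE a x : quot_scale a (cls x) = cls (pscale a x).
Proof. by apply/cls_eq; apply: peq_scale; exact: reprK. Qed.

Fact quot_addA : associative quot_add.
Proof.
move=> p q r; rewrite -(clsK p) -(clsK q) -(clsK r) !quot_addE.
by apply/cls_eq; exact: peq_addA.
Qed.
Fact quot_addC : commutative quot_add.
Proof.
move=> p q; rewrite -(clsK p) -(clsK q) !quot_addE.
by apply/cls_eq; exact: peq_addC.
Qed.
Fact quot_add0 : left_id (cls (pzero X)) quot_add.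
Proof.
by move=> p; rewrite -(clsK p) quot_addE; apply/cls_eq; exact: peq_add0.
Qed.
Fact quot_addN : left_inverse (cls (pzero X)) quot_opp quot_add.
Proof.
move=> p; rewrite -(clsK p) quot_oppE quot_addE.
by apply/cls_eq; exact: peq_addN.
Qed.

HB.instance Definition _ := GRing.isZmodule.Build quotmod
  quot_addA quot_addC quot_add0 quot_addN.

Fact quot_scaleA a b p : quot_scale a (quot_scale b p) = quot_scale (a * b) p.
Proof. by rewrite -(clsK p) !quot_scaleE; apply/cls_eq; exact: peq_scaleA. Qed.
Fact quot_scale1 : left_id 1 quot_scale.
Proof.
by move=> p; rewrite -(clsK p) quot_scaleE; apply/cls_eq; exact: peq_scale1.
Qed.
Fact quot_scaleDr : right_distributive quot_scale +%R.
Proof.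
move=> a p q; rewrite -(clsK p) -(clsK q) -[cls _ + cls _]/(quot_add _ _).
rewrite quot_addE !quot_scaleE -[RHS]/(quot_add _ _) quot_addE.
by apply/cls_eq; exact: peq_scaleDr.
Qed.
Fact quot_scaleDl p : {morph quot_scale^~ p : a b / a + b}.
Proof.
move=> a b; rewrite -(clsK p) !quot_scaleE -[RHS]/(quot_add _ _) quot_addE.
by apply/cls_eq; exact: peq_scaleDl.
Qed.

HB.instance Definition _ := GRing.Zmodule_isLmodule.Build A quotmod
  quot_scaleA quot_scale1 quot_scaleDr quot_scaleDl.

Lemma clsD x y : cls (padd x y) = cls x + cls y.
Proof. by rewrite -[RHS]/(quot_add _ _) quot_addE. Qed.
Lemma clsZ a x : cls (pscale a x) = a *: cls x.
Proof. by rewrite -[RHS]/(quot_scale _ _) quot_scaleE. Qed.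
Lemma clsN x : cls (popp x) = - cls x.
Proof. by rewrite -[RHS]/(quot_opp _) quot_oppE. Qed.

End Quotient.

Section QuotientBySubmodule.
Variables (A : comNzRingType) (M : lmodType A) (P : M -> Prop).
Hypothesis hP : submod_closed P.

#[local] Obligation Tactic := idtac.

Let PN m : P m -> P (- m).
Proof. by move=> Pm; rewrite -scaleN1r -[_ *: _]addr0; apply: hP.2 => //; exact: hP.1. Qed.
Let PD m n : P m -> P n -> P (m + n).
Proof. by move=> Pm Pn; rewrite -[m]scale1r; exact: hP.2. Qed.
Let PZ a m : P m -> P (a *: m).
Proof. by move=> Pm; rewrite -[_ *: _]addr0; apply: hP.2 => //; exact: hP.1. Qed.
Let P0 m n : m = n -> P (m - n).
Proof. by move=> ->; rewrite subrr; exact: hP.1. Qed.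

Program Definition modulo : premod A :=
  @Premod A M 0 +%R -%R *:%R (fun x y => P (x - y)) _ _ _ _ _ _ _ _ _ _ _ _ _ _.
Next Obligation. by move=> x; exact: P0. Qed.
Next Obligation. by move=> x y /PN; rewrite opprB. Qed.
Next Obligation. by move=> x y z Px Py; rewrite -[x](subrK y) -addrA; exact: PD. Qed.
Next Obligation. by move=> x x' y y' Px Py /=; rewrite opprD addrACA; exact: PD. Qed.
Next Obligation. by move=> x x' /PN; rewrite /= opprD. Qed.
Next Obligation. by move=> a x x' /(PZ a); rewrite /= scalerBr. Qed.
Next Obligation. by move=> x y z; apply: P0; exact: addrA. Qed.
Next Obligation. by move=> x y; apply: P0; exact: addrC. Qed.
Next Obligation. by move=> x; apply: P0; exact: add0r. Qed.
Next Obligation. by move=> x; apply: P0; exact: addNr. Qed.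
Next Obligation. by move=> a b x; apply: P0; exact: scalerA. Qed.
Next Obligation. by move=> x; apply: P0; exact: scale1r. Qed.
Next Obligation. by move=> a x y; apply: P0; exact: scalerDr. Qed.
Next Obligation. by move=> a b x; apply: P0; exact: scalerDl. Qed.

Fact proj_linear : linear (@cls A modulo : M -> quotmod modulo).
Proof. by move=> a m m'; rewrite -clsZ -clsD. Qed.
Definition proj : {linear M -> quotmod modulo} := mklin proj_linear.

Lemma proj_eq0 m : proj m = 0 <-> P m.
Proof. by rewrite -[m in P m]subr0; exact: (@cls_eq A modulo m 0). Qed.

Lemma proj_surj q : exists m, proj m = q.
Proof. by exists (repr q); exact: clsK. Qed.

End QuotientBySubmodule.

Section Presentation.
Variables (A : comNzRingType) (I : Type).

Inductive term :=
  Gen of I | Zero | Add of term & term | Opp of term | Scale of A & term.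

Fixpoint eval (L : lmodType A) (g : I -> L) (t : term) : L :=
  match t with
  | Gen i => g i
  | Zero => 0
  | Add t t' => eval g t + eval g t'
  | Opp t => - eval g t
  | Scale a t => a *: eval g t
  end.

Variable C : forall L : lmodType A, (I -> L) -> Prop.
#[local] Obligation Tactic := idtac.

(** The class [C] of interpretations of the generators plays the role of a set
    of relations: two terms are identified when every interpretation in [C]
    does so.  If [C] is given by equations, it contains the universal
    interpretation [gen]. *)
Program Definition terms : premod A :=
  @Premod A term Zero Add Opp Scale
    (fun t t' => forall (L : lmodType A) (g : I -> L), C g -> eval g t = eval g t')
    _ _ _ _ _ _ _ _ _ _ _ _ _ _.
Next Obligation. by []. Qed.
Next Obligation. by move=> x y e L g Cg; rewrite e. Qed.
Next Obligation. by move=> x y z e e' L g Cg; rewrite e ?e'. Qed.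
Next Obligation. by move=> x x' y y' e e' L g Cg /=; rewrite e ?e'. Qed.
Next Obligation. by move=> x x' e L g Cg /=; rewrite e. Qed.
Next Obligation. by move=> a x x' e L g Cg /=; rewrite e. Qed.
Next Obligation. by move=> x y z L g _ /=; exact: addrA. Qed.
Next Obligation. by move=> x y L g _ /=; exact: addrC. Qed.
Next Obligation. by move=> x L g _ /=; exact: add0r. Qed.
Next Obligation. by move=> x L g _ /=; exact: addNr. Qed.
Next Obligation. by move=> a b x L g _ /=; exact: scalerA. Qed.
Next Obligation. by move=> x L g _ /=; exact: scale1r. Qed.
Next Obligation. by move=> a x y L g _ /=; exact: scalerDr. Qed.
Next Obligation. by move=> a b x L g _ /=; exact: scalerDl. Qed.

Definition pres := quotmod terms.
HB.instance Definition _ := GRing.Lmodule.on pres.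
Definition gen (i : I) : pres := @cls A terms (Gen i).

Section Lift.
Variables (L : lmodType A) (g : I -> L) (Cg : C g).

Fact lift_linear : linear (fun x : pres => eval g (repr x)).
Proof.
move=> a x y; rewrite -{1}(clsK x) -{1}(clsK y) -clsZ -clsD.
exact: (@reprK A terms _ L g Cg).
Qed.
Definition lift : {linear pres -> L} := mklin lift_linear.

Lemma lift_gen i : lift (gen i) = g i.
Proof. exact: (@reprK A terms _ L g Cg). Qed.
End Lift.

Lemma pres_ext (x y : pres) :
  (forall (L : lmodType A) (g : I -> L) (Cg : C g), lift Cg x = lift Cg y) -> x = y.
Proof.
by move=> xy; rewrite -(clsK x) -(clsK y); apply/cls_eq => L g Cg; exact: xy.
Qed.

Lemma pres_hom_ext (L : lmodType A) (f h : {linear pres -> L}) :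
  (forall i, f (gen i) = h (gen i)) -> f = h.
Proof.
move=> fh; apply: linear_ext => x; rewrite -(clsK x).
elim: (repr x) => [i||t e t' e'|t e|a t e].
- exact: fh.
- by rewrite -[cls _]/(0 : pres) !linear0.
- by rewrite -[cls _]/(@cls A terms (padd (p := terms) t t')) clsD !linearD e e'.
- by rewrite -[cls _]/(@cls A terms (popp (p := terms) t)) clsN !linearN e.
- by rewrite -[cls _]/(@cls A terms (pscale (p := terms) a t)) clsZ !linearZ e.
Qed.
End Presentation.

(** * Base change of modules *)

Section Semilinear.
Variables (R S : comNzRingType) (phi : {rmorphism R -> S}).
Variables (M : lmodType R) (N : lmodType S) (u : M -> N).
Hypothesis uP : semilinear phi u.

Lemma semilinearD m m' : u (m + m') = u m + u m'.
Proof. by have := uP 1 m m'; rewrite scale1r rmorph1 scale1r. Qed.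
Lemma semilinear0 : u 0 = 0.
Proof. by apply: (@addrI _ (u 0)); rewrite -semilinearD !addr0. Qed.
Lemma semilinearZ r m : u (r *: m) = phi r *: u m.
Proof. by have := uP r m 0; rewrite semilinear0 !addr0. Qed.
Lemma semilinearB m m' : u (m - m') = u m - u m'.
Proof. by rewrite -!scaleN1r semilinearD semilinearZ rmorphN1. Qed.

End Semilinear.

Lemma semilinear_comp (R S T : comNzRingType) (phi : R -> S) (psi : S -> T)
    (M : lmodType R) (N : lmodType S) (L : lmodType T) (u : M -> N) (v : N -> L) :
  semilinear phi u -> semilinear psi v -> semilinear (psi \o phi) (v \o u).
Proof. by move=> uP vP r m m'; rewrite /= uP vP. Qed.

Lemma semilinear_linear_comp (R S : comNzRingType) (phi : R -> S)
    (M : lmodType R) (N L : lmodType S) (u : M -> N) (f : {linear N -> L}) :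
  semilinear phi u -> semilinear phi (f \o u).
Proof. by move=> uP r m m'; rewrite /= uP linearP. Qed.

Lemma linear_semilinear_comp (R S : comNzRingType) (phi : R -> S)
    (M M' : lmodType R) (N : lmodType S) (f : {linear M -> M'}) (u : M' -> N) :
  semilinear phi u -> semilinear phi (u \o f).
Proof. by move=> uP r m m'; rewrite /= linearP uP. Qed.

Lemma semilinear_add (R S : comNzRingType) (phi : R -> S)
    (M : lmodType R) (N : lmodType S) (u v : M -> N) :
  semilinear phi u -> semilinear phi v -> semilinear phi (fun m => u m + v m).
Proof. by move=> uP vP r m m'; rewrite uP vP scalerDr addrACA. Qed.

Lemma semilinear_scale (R S : comNzRingType) (phi : R -> S)
    (M : lmodType R) (N : lmodType S) (u : M -> N) (s : S) :
  semilinear phi u -> semilinear phi (fun m => s *: u m).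
Proof. by move=> uP r m m'; rewrite uP scalerDr !scalerA mulrC. Qed.

Definition restr (R S : comNzRingType) (phi : {rmorphism R -> S})
  (L : lmodType S) : Type := L.

Section Restriction.
Variables (R S : comNzRingType) (phi : {rmorphism R -> S}) (L : lmodType S).

HB.instance Definition _ := GRing.Zmodule.copy (restr phi L) L.

Definition restr_scale (r : R) (x : restr phi L) : restr phi L :=
  phi r *: (x : L).

Fact restr_scaleA a b x : restr_scale a (restr_scale b x) = restr_scale (a * b) x.
Proof. by rewrite /restr_scale scalerA rmorphM. Qed.
Fact restr_scale1 : left_id 1 restr_scale.
Proof. by move=> x; rewrite /restr_scale rmorph1 scale1r. Qed.
Fact restr_scaleDr : right_distributive restr_scale +%R.
Proof. by move=> a x y; rewrite /restr_scale scalerDr. Qed.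
Fact restr_scaleDl x : {morph restr_scale^~ x : a b / a + b}.
Proof. by move=> a b; rewrite /restr_scale rmorphD scalerDl. Qed.

HB.instance Definition _ := GRing.Zmodule_isLmodule.Build R (restr phi L)
  restr_scaleA restr_scale1 restr_scaleDr restr_scaleDl.
End Restriction.

(** The R-linear maps from S to M form the right adjoint of restriction of
    scalars, so functionals on S give maps out of a base change. *)
Section HomExtension.
Variables (R S : comNzRingType) (phi : {rmorphism R -> S}) (M : lmodType R).

Definition homext : Type := {f : S -> M | forall r s s',
  f (phi r * s + s') = r *: f s + f s'}.

HB.instance Definition _ := gen_eqMixin homext.
HB.instance Definition _ := gen_choiceMixin homext.

Fact homext_addP (f g : homext) r s s' :
  sval f (phi r * s + s') + sval g (phi r * s + s')
  = r *: (sval f s + sval g s) + (sval f s' + sval g s').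
Proof. by rewrite (svalP f) (svalP g) scalerDr addrACA. Qed.
Fact homext_oppP (f : homext) r s s' :
  - sval f (phi r * s + s') = r *: - sval f s + - sval f s'.
Proof. by rewrite (svalP f) opprD scalerN. Qed.
Fact homext_zeroP r (s s' : S) : 0 = r *: 0 + 0 :> M.
Proof. by rewrite scaler0 addr0. Qed.
Fact homext_scaleP c (f : homext) r s s' :
  sval f ((phi r * s + s') * c) = r *: sval f (s * c) + sval f (s' * c).
Proof. by rewrite mulrDl -mulrA (svalP f). Qed.

Definition homext_add (f g : homext) : homext :=
  exist _ (fun s => sval f s + sval g s) (homext_addP f g).
Definition homext_opp (f : homext) : homext :=
  exist _ (fun s => - sval f s) (homext_oppP f).
Definition homext_zero : homext := exist _ (fun=> 0) homext_zeroP.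
Definition homext_scale (c : S) (f : homext) : homext :=
  exist _ (fun s => sval f (s * c)) (homext_scaleP c f).

Lemma homext_ext (f g : homext) : sval f =1 sval g -> f = g.
Proof. by move=> fg; apply: sig_ext; exact/funext. Qed.

Fact homext_addA : associative homext_add.
Proof. by move=> f g h; apply: homext_ext => s; exact: addrA. Qed.
Fact homext_addC : commutative homext_add.
Proof. by move=> f g; apply: homext_ext => s; exact: addrC. Qed.
Fact homext_add0 : left_id homext_zero homext_add.
Proof. by move=> f; apply: homext_ext => s; exact: add0r. Qed.
Fact homext_addN : left_inverse homext_zero homext_opp homext_add.
Proof. by move=> f; apply: homext_ext => s; exact: addNr. Qed.

HB.instance Definition _ := GRing.isZmodule.Build homext
  homext_addA homext_addC homext_add0 homext_addN.

Fact homext_scaleA a b f : homext_scale a (homext_scale b f) = homext_scale (a * b) f.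
Proof. by apply: homext_ext => s; rewrite /= mulrA. Qed.
Fact homext_scale1 : left_id 1 homext_scale.
Proof. by move=> f; apply: homext_ext => s; rewrite /= mulr1. Qed.
Fact homext_scaleDr : right_distributive homext_scale +%R.
Proof. by move=> a f g; exact: homext_ext. Qed.
Fact homext_scaleDl f : {morph homext_scale^~ f : a b / a + b}.
Proof.
move=> a b; apply: homext_ext => s /=.
by have := svalP f 1 (s * a) (s * b); rewrite rmorph1 mul1r scale1r mulrDr.
Qed.

HB.instance Definition _ := GRing.Zmodule_isLmodule.Build S homext
  homext_scaleA homext_scale1 homext_scaleDr homext_scaleDl.
End HomExtension.

Section BaseChangeExists.
Variables (R S : comNzRingType) (phi : R -> S) (M : lmodType R).

Let C (L : lmodType S) (g : M -> L) : Prop := semilinear phi g.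

Definition base_change : lmodType S := pres C.
Definition base_change_map : M -> base_change := @gen S M C.

Lemma base_changeP : is_base_change phi base_change_map.
Proof.
split=> [r m m'|L g gP].
  by apply: pres_ext => L g gP; rewrite /base_change_map linearP !(lift_gen gP).
exists (lift (gP : C g)); split=> [m|h hP]; first exact: lift_gen.
by apply: pres_hom_ext => m; rewrite lift_gen; exact: esym (hP m).
Qed.
End BaseChangeExists.

Section BaseChange.
Variables (R S : comNzRingType) (phi : {rmorphism R -> S}).
Variables (M : lmodType R) (N : lmodType S) (u : M -> N).
Hypothesis ubc : is_base_change phi u.

(** The submodule generated by the image of u has the universal property of N
    as well, so it is N. *)
Lemma bc_ind (P : N -> Prop) :
  submod_closed P -> (forall m, P (u m)) -> forall n, P n.
Proof.
move=> hP Pu n; have [uP uU] := ubc.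
pose v m : submod hP := exist _ (u m) (Pu m).
have vP : semilinear phi v by move=> r m m'; apply: sig_ext; exact: uP.
have [h [hv _]] := uU _ _ vP.
have [w [_ wU]] := uU _ _ uP.
have e : w = (sub_val hP \o h : {linear N -> N}).
  by apply: wU => m /=; have /= -> := hv m.
have e' : w = (idfun : {linear N -> N}) by exact: wU.
have := svalP (h n); suff -> : sval (h n) = n by [].
exact: (congr1 (fun f : {linear N -> N} => f n) (etrans (esym e) e')).
Qed.

Lemma bc_semilinear_ext (T : comNzRingType) (psi : {rmorphism S -> T})
    (L : lmodType T) (f g : N -> L) :
  semilinear psi f -> semilinear psi g -> f \o u =1 g \o u -> f =1 g.
Proof.
move=> fP gP fg; apply: bc_ind => //; split.
  by rewrite (semilinear0 fP) (semilinear0 gP).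
by move=> a n n' e e'; rewrite fP gP e e'.
Qed.

Lemma bc_linear_ext (L : lmodType S) (f g : {linear N -> L}) :
  f \o u =1 g \o u -> f =1 g.
Proof.
by apply: (@bc_semilinear_ext S idfun) => r n n'; exact: linearP.
Qed.

Lemma bc_extend (T : comNzRingType) (psi : {rmorphism S -> T})
    (L : lmodType T) (g : M -> L) :
  semilinear (psi \o phi) g ->
  exists h : N -> L, semilinear psi h /\ h \o u =1 g.
Proof.
move=> gP; have gP' : semilinear phi (g : M -> restr psi L) by [].
have [h [hu _]] := ubc.2 _ _ gP'.
by exists h; split=> // s n n'; exact: (linearP h).
Qed.

Lemma bc_cancel (T : comNzRingType) (psi : {rmorphism S -> T})
    (L : lmodType T) (v : N -> L) :
  semilinear psi v -> is_base_change (psi \o phi) (v \o u) ->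
  is_base_change psi v.
Proof.
move=> vP [vuP vuU]; split=> // K g gP.
have [h [hP hU]] := vuU K (g \o u) (semilinear_comp ubc.1 gP).
exists h; split=> [|h' h'P]; last by apply: hU => m /=; exact: h'P.
apply: (bc_semilinear_ext (psi := psi)) => //.
exact: semilinear_linear_comp.
Qed.

(** The contraction S \otimes M -> M along a functional l on S, obtained as the
    adjoint of m |-> (s |-> l(s) m); it replaces a basis of S. *)
Lemma bc_contract (l : S -> R) :
  (forall r s s', l (phi r * s + s') = r * l s + l s') ->
  exists f : N -> M, [/\ forall n n', f (n + n') = f n + f n'
    & forall s m, f (s *: u m) = l s *: m].
Proof.
move=> lP.
have gP (m : M) r s s' : l (phi r * s + s') *: m = r *: (l s *: m) + l s' *: m.
  by rewrite lP scalerDl scalerA.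
pose g (m : M) : homext phi M := exist _ _ (gP m).
have gS : semilinear phi g.
  move=> r m m'; apply: homext_ext => s /=.
  rewrite scalerDr scalerA; congr (_ + _); have := lP r s 0.
  have l0 : l 0 = 0.
    have := lP 1 0 0; rewrite rmorph1 !mul1r !addr0 => e.
    by apply: (@addrI _ (l 0)); rewrite addr0.
  by rewrite addr0 l0 addr0 [s * _]mulrC [r * _]mulrC => ->; rewrite mulrC.
have [h [hu _]] := ubc.2 _ _ gS.
exists (fun n => sval (h n) 1); split=> [n n'|s m]; first by rewrite linearD.
by rewrite linearZ; have /= -> := hu m; rewrite /= mul1r.
Qed.

End BaseChange.

Lemma bc_id (R : comNzRingType) (phi : R -> R) (M N : lmodType R) (u : M -> N) :
  phi =1 id -> is_base_change phi u ->
  exists (f : {linear M -> N}) (g : {linear N -> M}),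
    [/\ f =1 u, cancel f g & cancel g f].
Proof.
move=> /funext -> ubc; have [uP uU] := ubc.
pose f := mklin (uP : linear u).
have [g [gu _]] := uU M idfun (fun r m m' => erefl).
exists f, g; split=> //.
apply: (@bc_linear_ext R R idfun M N u ubc N (f \o g) idfun) => m /=.
by have /= -> := gu m.
Qed.

Lemma bc_span (R S : comNzRingType) (phi : {rmorphism R -> S}) (M : lmodType R)
    (N : lmodType S) (u : M -> N) (P : N -> Prop) :
  is_base_change phi u -> (forall n n', P n -> P n' -> P (n + n')) ->
  (forall s m, P (s *: u m)) -> forall n, P n.
Proof.
move=> ubc PD Pu n; rewrite -[n]scale1r; move: n 1.
apply: (bc_ind ubc) => [|m a]; last exact: Pu.
split=> [a|c n n' Pn Pn' a]; first by rewrite scaler0 -(semilinear0 ubc.1) -[u 0]scale1r.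
by rewrite scalerDr scalerA; apply: PD.
Qed.

Lemma regular_base_change (R S : comNzRingType) (phi : {rmorphism R -> S}) :
  is_base_change phi (phi : R^o -> S^o).
Proof.
split=> [r m m'|L g gP].
  by rewrite rmorphD rmorphM.
have hP : linear (fun s : S^o => s *: g 1).
  by move=> a s s'; rewrite scalerDl -scalerA.
exists (mklin hP); split=> [m|h hE] /=.
  by rewrite -(semilinearZ gP) -[_ *: _]/(m * 1 : R) mulr1.
apply: linear_ext => s /=.
rewrite -(hE 1) /= -linearZ; congr (h _).
by rewrite rmorph1 -[_ *: _]/(s * 1 : S) mulr1.
Qed.

(** By flatness the base change of the submodule generated by an element of the
    kernel embeds in N, where its generators vanish; so the submodule is zero. *)
Lemma faithfully_flat_inj (R S : comNzRingType) (phi : {rmorphism R -> S})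
    (M : lmodType R) (N : lmodType S) (u : M -> N) :
  faithfully_flat phi -> is_base_change phi u -> forall m, u m = 0 -> m = 0.
Proof.
move=> [fl ff] ubc m um.
have hP : submod_closed (fun x : M => exists r : R, x = r *: m).
  split=> [|r x y [a ->] [b ->]]; first by exists 0; rewrite scale0r.
  by exists (r * a + b); rewrite scalerDl scalerA.
pose K : lmodType R := submod hP.
have := base_changeP phi K; set v := @base_change_map _ _ _ _ => vbc.
have [j [jE _]] := vbc.2 _ (u \o sub_val hP) (linear_semilinear_comp _ ubc.1).
have jI : injective j.
  apply: (fl K M _ _ v u (sub_val hP) j vbc ubc jE).
  by move=> x y /= xy; apply: sig_ext.
pose m0 : K := exist _ m (ex_intro _ 1 (esym (scale1r m))).
suff /(congr1 sval) : m0 = 0 by [].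
apply: (ff K _ v vbc) => n.
apply: (bc_ind vbc (P := fun n => n = 0)).
  by split=> // a x y -> ->; rewrite scaler0 addr0.
move=> [x [r xr]]; apply: jI; rewrite linear0; have /= -> := jE (exist _ x (ex_intro _ r xr)).
by rewrite /= xr (semilinearZ ubc.1) um scaler0.
Qed.

(** The new map is the old one followed by the automorphism 1 + a d, whose
    inverse is 1 - a d. *)
Lemma twist_base_change (R S : comNzRingType) (phi : {rmorphism R -> S})
    (V : lmodType R) (Q : lmodType S) (u : V -> Q) (d : {linear V -> V}) (a : S) :
  is_base_change phi u -> (forall v, d (d v) = 0) ->
  is_base_change phi (fun v => u v + a *: u (d v)).
Proof.
move=> [uP uU] d2.
have twistP (L : lmodType S) (g : V -> L) b : semilinear phi g ->
    semilinear phi (fun v => g v + b *: g (d v)).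
  move=> gP; apply: semilinear_add => //; apply: semilinear_scale.
  exact: (linear_semilinear_comp d gP).
split=> [|L g gP]; first exact: twistP.
have [f [fE fU]] := uU L _ (twistP L g (- a) gP).
have {}fE v : f (u v) = g v - a *: g (d v) by rewrite -scaleNr; exact: fE.
exists f; split=> [v|f' f'E] /=.
  by rewrite linearD linearZ /= !fE d2 (semilinear0 gP) scaler0 subr0 subrK.
apply: fU => v /=; have /= := f'E v; have /= := f'E (d v).
rewrite d2 (semilinear0 uP) scaler0 addr0 linearD linearZ /= => -> <-.
by rewrite scaleNr addrK.
Qed.

(** * Equivalences of categories and adjoint functors *)

Lemma dependent_choice (X : Type) (Y : X -> Type) (P : forall x, Y x -> Prop) :
  (forall x, exists y, P x y) -> exists f : forall x, Y x, forall x, P x (f x).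
Proof. by move=> H; exists (fun x => projT1 (cid (H x))) => x; case: cid. Qed.

Section Equivalence.
Variables (C D : category) (E : functor C D).

Definition equivalence : Prop :=
  (forall X Y : C, injective (@fmap _ _ E X Y)) /\
  (forall (X Y : C) (h : hom (E X) (E Y)), exists f, fmap E f = h) /\
  (forall d : D, exists (c : C) (f : hom (E c) d) (g : hom d (E c)),
     f ∘ g = idm d /\ g ∘ f = idm (E c)).

Definition image_diagram (X : diagram C) : diagram D :=
  @Diagram D (vertex X) (@edge C X) (fun v => E (X v))
    (fun v w e => fmap E (darr e)).

Lemma bicomplete_equivalence : equivalence -> bicomplete D -> bicomplete C.
Proof.
move=> [inj [full surj]] bD X; have [[L [p [pc pU]]] [M [q [qc qU]]]] := bD (image_diagram X).
split.
  have [c [f [g [fg gf]]]] := surj L.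
  have [p' p'E] : exists p', forall v, fmap E (p' v) = p v ∘ f.
    by apply: (dependent_choice (P := fun v h => fmap E h = p v ∘ f)) => v; exact: full.
  exists c, p'; split=> [v w e|Z z zc].
    by apply: inj; rewrite fmap_comp !p'E compA; congr (_ ∘ f); exact: (pc v w e).
  have [|u [uP uU]] := pU (E Z) (fun v => fmap E (z v)).
    by move=> v w e; rewrite -(zc v w e) fmap_comp.
  have [u' u'E] := full _ _ (g ∘ u).
  exists u'; split=> [v|t tP].
    by apply: inj; rewrite fmap_comp p'E u'E compA -(compA (p v)) fg compm1 uP.
  apply: inj; rewrite u'E; have -> : u = f ∘ fmap E t.
    by apply: uU => v; rewrite compA -p'E -fmap_comp tP.
  by rewrite compA gf comp1m.
have [c [f [g [fg gf]]]] := surj M.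
have [q' q'E] : exists q', forall v, fmap E (q' v) = g ∘ q v.
  by apply: (dependent_choice (P := fun v h => fmap E h = g ∘ q v)) => v; exact: full.
exists c, q'; split=> [v w e|Z z zc].
  by apply: inj; rewrite fmap_comp !q'E -compA; congr (g ∘ _); exact: (qc v w e).
have [|u [uP uU]] := qU (E Z) (fun v => fmap E (z v)).
  by move=> v w e; rewrite -(zc v w e) fmap_comp.
have [u' u'E] := full _ _ (u ∘ f).
exists u'; split=> [v|t tP].
  by apply: inj; rewrite fmap_comp q'E u'E compA -(compA u) fg compm1 uP.
apply: inj; rewrite u'E; have -> : u = fmap E t ∘ g.
  by apply: uU => v; rewrite -compA -q'E -fmap_comp tP.
by rewrite -compA gf compm1.
Qed.

End Equivalence.

Definition universal_to (C D : category) (L : functor C D) (d : D) (c : C)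
    (eps : hom (L c) d) : Prop :=
  forall (c' : C) (h : hom (L c') d), exists! u : hom c' c, eps ∘ fmap L u = h.

Lemma right_adjoint_of_universal (C D : category) (L : functor C D) :
  (forall d : D, exists (c : C) (eps : hom (L c) d), universal_to eps) ->
  exists G : functor D C, is_right_adjoint L G.
Proof.
move=> H.
pose G d := projT1 (cid (H d)).
pose eps d : hom (L (G d)) d := projT1 (cid (projT2 (cid (H d)))).
have epsU d : universal_to (eps d) := projT2 (cid (projT2 (cid (H d)))).
pose phi c d (h : hom (L c) d) : hom c (G d) := projT1 (cid (epsU d c h)).
have phiE c d h : eps d ∘ fmap L (phi c d h) = h.
  by rewrite /phi; case: cid => u [].
have phiU c d h u : eps d ∘ fmap L u = h -> phi c d h = u.
  by move=> uE; rewrite /phi; case: cid => u' [_ u'U] /=; exact: u'U.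
have Gid d : phi _ _ (idm d ∘ eps d) = idm (G d).
  by apply: phiU; rewrite fmap_id compm1 comp1m.
have Gcomp X Y Z (g : hom Y Z) (f : hom X Y) :
    phi _ _ (g ∘ f ∘ eps X) = phi _ _ (g ∘ eps Y) ∘ phi _ _ (f ∘ eps X).
  by apply: phiU; rewrite fmap_comp compA phiE -compA phiE compA.
exists (@Functor D C G (fun X Y f => phi _ _ (f ∘ eps X)) Gid Gcomp), phi.
split=> [c d|c d d' g h|c c' d f h].
- exists (fun u => eps d ∘ fmap L u) => [h|u]; first exact: phiE.
  exact: phiU.
- by apply: phiU; rewrite fmap_comp compA phiE -compA phiE.
- by apply: phiU; rewrite fmap_comp compA phiE.
Qed.

(** * Model structures in which every map is a weak equivalence *)

Section ProjectiveModel.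
Variables (C : category) (W : C).

(** When all maps are weak equivalences, a model structure is a single weak
    factorization system; this is the one generated by 0 -> W. *)
Definition proj_fib : morclass C := fun X Y g =>
  forall h : hom W Y, exists h' : hom W X, g ∘ h' = h.

Definition proj_data : model_data C :=
  @ModelData C (fun _ _ _ => True) proj_fib
    (fun A B i => forall X Y (p : hom X Y), proj_fib p -> lifts i p).

Definition small_homs : Prop :=
  forall Y : C, exists (H : small) (e : H -> hom W Y), forall h, exists i, e i = h.

Lemma proj_fib_retract : retract_closed proj_fib.
Proof.
move=> X Y X' Y' f g [i [r [j [s [_ sj _ fr]]]]] gP h.
have [h' h'E] := gP (j ∘ h).
by exists (r ∘ h'); rewrite compA fr -compA h'E compA sj comp1m.
Qed.

Lemma llp_retract (P : morclass C) :
  retract_closed (fun A B (i : hom A B) =>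
    forall X Y (p : hom X Y), P X Y p -> lifts i p).
Proof.
move=> X Y X' Y' f g [i [r [j [s [ri sj gi fr]]]]] gP A B p pP u v pu.
have [|h [hu hv]] := gP A B p pP (u ∘ r) (v ∘ s).
  by rewrite compA pu -!compA fr.
exists (h ∘ j); split; first by rewrite -compA -gi compA hu -compA ri compm1.
by rewrite compA hv -compA sj compm1.
Qed.

Hypotheses (bC : bicomplete C) (sW : small_homs).

(** The intermediate object is the sum of X and of one copy of W for each map
    from W to Y, so no transfinite construction is needed. *)
Lemma proj_factor (X Y : C) (f : hom X Y) :
  exists (Z : C) (i : hom X Z) (p : hom Z Y),
    [/\ cof proj_data i, fib proj_data p & p ∘ i = f].
Proof.
have [H [e eP]] := sW Y.
pose D : diagram C := @Diagram C (option H) (fun _ _ => Empty_set)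
  (fun o => if o is Some _ then W else X) (fun v w e => match e with end).
have [_ [Z [q [_ qU]]]] := bC D.
have [|p [pq _]] := qU Y (fun o => match o return hom (D o) Y with
                                   | Some h => e h | None => f end).
  by move=> v w [].
exists Z, (q None), p; split; last exact: pq None.
  move=> A B g gP u v guv.
  have [h hE] : exists h : H -> hom W A, forall t, g ∘ h t = v ∘ q (Some t).
    by apply: (dependent_choice (P := fun t k => g ∘ k = v ∘ q (Some t))) => t; exact: gP.
  have [|w [wq _]] := qU A (fun o => match o return hom (D o) A with
                                     | Some t => h t | None => u end).
    by move=> ? ? [].
  exists w; split; first exact: (wq None).
  have [|t [_ tU]] := qU B (fun o => v ∘ q o); first by move=> ? ? [].
  rewrite -(tU v) //; symmetry; apply: tU => -[t'|]; rewrite -compA wq //.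
move=> h; have [t <-] := eP h; exists (q (Some t)); exact: (pq (Some t)).
Qed.

Lemma proj_closed_model : closed_model_structure proj_data.
Proof.
split=> //.
- split=> //; [exact: proj_fib_retract|exact: llp_retract].
- by move=> A B X Y i p iP pP _; apply: iP pP.
- by move=> X Y f; have [Z [i [p [iP pP pi]]]] := proj_factor f;
     split; exists Z, i, p.
Qed.

Lemma initial_exists : exists O : C, forall Z, exists! u : hom O Z, True.
Proof.
pose D : diagram C := @Diagram C Empty_set (fun _ _ => Empty_set)
  (fun v => match v with end) (fun v w e => match v with end).
have [_ [O [q [_ qU]]]] := bC D; exists O => Z.
have [|u [_ uU]] := qU Z (fun v => match v with end); first by case.
by exists u; split=> // u' _; apply: uU; case.
Qed.

(** All maps out of an initial object agree, so it is small with respect to any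
    class of maps; this is the only source of a generating map here. *)
Lemma initial_small (O : C) (P : morclass C) :
  (forall Z, exists! u : hom O Z, True) -> small_relative O P.
Proof.
move=> OI; have Ou Z (f g : hom O Z) : f = g.
  by have [u [_ uU]] := OI Z; rewrite -(uU f) // -(uU g).
exists unit => L [[a _] _ _] X _ _ Z q _; split=> [f|b c g g' _].
  by have [u _] := OI (X a); exists a, u; exact: Ou.
case: (wo_total b c) => [bc|bc|cb].
- by exists c, (or_intror bc), (or_introl erefl); exact: Ou.
- by exists c, (or_introl bc), (or_introl erefl); exact: Ou.
- by exists b, (or_introl erefl), (or_intror cb); exact: Ou.
Qed.

Lemma proj_cofibrantly_generated : cofibrantly_generated proj_data.
Proof.
have [O OI] := initial_exists; have [w _] := OI W.
have Ou Z (f g : hom O Z) : f = g.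
  by have [u [_ uU]] := OI Z; rewrite -(uU f) // -(uU g).
pose I : mapset C := @MapSet C unit (fun=> O) (fun=> W) (fun=> w).
have fibI X Y (f : hom X Y) : proj_fib f <-> injectives I f.
  split=> [fP t u v _|fP h].
    by have [h hE] := fP v; exists h; split=> //; exact: Ou.
  have [u _] := OI X.
  by have [|h' [_ h'E]] := fP tt u h; [exact: Ou|exists h'].
exists I, I; split=> [t|t||X Y f]; [exact: initial_small|exact: initial_small|
  exact: fibI|by split=> [[/fibI]|/fibI]].
Qed.

Definition proj_model : model_structure C :=
  exist _ proj_data (conj proj_closed_model proj_cofibrantly_generated).

End ProjectiveModel.

Lemma proj_model_eq (C : category) (W W' : C) bC (sW : small_homs W) bC'
    (sW' : small_homs W') :
  (forall X Y (g : hom X Y), proj_fib W g <-> proj_fib W' g) ->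
  proj_model bC sW = proj_model bC' sW'.
Proof.
move=> WW'; apply: sig_ext => /=; rewrite /proj_data.
suff -> : @proj_fib C W = @proj_fib C W' by [].
apply: functional_extensionality_dep => X.
apply: functional_extensionality_dep => Y.
by apply/funext => g; apply/propext; exact: WW'.
Qed.

(** The adjoint transpose turns lifting problems of L W into lifting problems
    of W. *)
Lemma proj_model_transferred (C D : category) (L : functor C D)
    (G : functor D C) (W : C) bC (sW : small_homs W) bD (sLW : small_homs (L W)) :
  is_right_adjoint L G ->
  transferred G (proj_model bC sW) (proj_model bD sLW).
Proof.
move=> [phi [phiB phiN _]] M N g; split=> //=; split=> gP h.
  have [psi phiK psiK] := phiB W N; have [h' h'E] := gP (psi h).
  by exists (phi _ _ h'); rewrite -phiN h'E psiK.
have [h' h'E] := gP (phi _ _ h); have [psi phiK psiK] := phiB W M.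
exists (psi h'); apply: (bij_inj (phiB W N)).
by rewrite phiN psiK.
Qed.

(** * The category of modules *)

#[local] Obligation Tactic := idtac.

Program Definition Mod (A : comNzRingType) : category :=
  @Category (lmodType A) (fun M N => {linear M -> N})
    (fun M => idfun) (fun M N L g f => (g \o f : {linear M -> L})) _ _ _.
Next Obligation. by move=> *; exact: linear_ext. Qed.
Next Obligation. by move=> *; exact: linear_ext. Qed.
Next Obligation. by move=> *; exact: linear_ext. Qed.

Section ModuleLimits.
Variables (A : comNzRingType) (D : diagram (Mod A)).

Let ob (v : vertex D) : lmodType A := D v.
Let ar v w (e : edge v w) : {linear ob v -> ob w} := darr e.

Fact compatible_closed : submod_closed (fun f : dprod ob =>
  forall v w (e : edge v w), ar e (f v) = f w).
Proof.
split=> [v w e|a f g fP gP v w e]; first exact: linear0.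
by rewrite -[LHS]/(ar e (a *: f v + g v)) linearP fP gP.
Qed.

Lemma module_limit : exists (L : Mod A) (p : forall v, hom L (D v)), is_limit p.
Proof.
pose L : lmodType A := submod compatible_closed.
have pP v : linear (fun f : L => sval f v : ob v) by [].
exists L, (fun v => mklin (pP v)); split=> [v w e|Z z zc].
  by apply: linear_ext => f /=; exact: (svalP f v w e).
have zP v w (e : edge v w) (x : (Z : lmodType A)) :
    ar e ((z v : {linear _ -> _}) x) = (z w : {linear _ -> _}) x.
  exact: (congr1 (fun f : {linear (Z : lmodType A) -> ob w} => f x) (zc v w e)).
pose u (x : (Z : lmodType A)) : L :=
  exist (fun f : dprod ob => forall v w (e : edge v w), ar e (f v) = f w)
    (fun v => (z v : {linear _ -> _}) x) (fun v w e => zP v w e x).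
have uP : linear u.
  move=> a x y; apply: sig_ext; apply: functional_extensionality_dep => v.
  exact: linearP.
exists (mklin uP); split=> [v|t tP]; first by apply: linear_ext => x.
apply: linear_ext => x; apply: sig_ext; apply: functional_extensionality_dep => v.
by rewrite -[LHS]/((z v : {linear _ -> _}) x) -tP.
Qed.

Let I := {v & ob v}.
Let C (L : lmodType A) (g : I -> L) : Prop :=
  (forall v, linear (fun m : ob v => g (existT _ v m))) /\
  (forall v w (e : edge v w) m, g (existT _ w (ar e m)) = g (existT _ v m)).

Lemma module_colimit : exists (L : Mod A) (q : forall v, hom (D v) L), is_colimit q.
Proof.
pose L : lmodType A := pres C.
have qP v : linear (fun m : ob v => @gen A I C (existT _ v m) : L).
  move=> a m m'; apply: pres_ext => K g gP.
  by rewrite linearP !(lift_gen gP); exact: gP.1.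
exists L, (fun v => mklin (qP v)); split=> [v w e|Z z zc].
  apply: linear_ext => m /=; apply: pres_ext => K g gP.
  by rewrite !(lift_gen gP); exact: gP.2.
pose g (i : I) : (Z : lmodType A) := (z (tag i) : {linear _ -> _}) (tagged i).
have gP : C g.
  split=> [v a m m'|v w e m]; first exact: linearP.
  exact: (congr1 (fun f : {linear ob v -> (Z : lmodType A)} => f m) (zc v w e)).
exists (lift gP : {linear _ -> _}); split=> [v|t tP].
  by apply: linear_ext => m; exact: (lift_gen gP).
apply: (@pres_hom_ext A I C) => -[v m]; rewrite lift_gen.
by rewrite /g /= -tP.
Qed.
End ModuleLimits.

Lemma module_bicomplete (A : comNzRingType) : bicomplete (Mod A).
Proof. by move=> D; split; [exact: module_limit|exact: module_colimit]. Qed.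

(** Under an equivalence with modules the maps W -> Y form a set, since linear
    maps do. *)
Lemma small_homs_equivalence (C : category) (A : comNzRingType)
    (E : functor C (Mod A)) : equivalence E -> forall W : C, small_homs W.
Proof.
move=> [inj [full _]] W Y.
pose H : small := {linear (E W : lmodType A) -> (E Y : lmodType A)}.
exists H, (fun h => projT1 (cid (full W Y h))) => h.
by exists (fmap E h); apply: inj; case: cid.
Qed.

(** * Quasi-coherent modules on a category with an initial object *)

Definition sections (X : catAff) (A : comNzRingType) (x : X A)
    : functor (QCoh X) (Mod A) :=
  @Functor (QCoh X) (Mod A) (fun F => F A x) (fun F G t => sval t A x)
    (fun F => erefl) (fun F G H t s => erefl).

Lemma qhom_natural (X : catAff) (F G : qcoh X) (t : qhom F G)
    (R S : comNzRingType) (x : X R) (y : X S) (a : phom x y) (m : F R x) :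
  sval t S y (qres F a m) = qres G a (sval t R x m).
Proof. exact: (svalP t R S x y a m). Qed.

Lemma qres_semilinear (X : catAff) (F : qcoh X) (R S : comNzRingType)
    (x : X R) (y : X S) (a : phom x y) : semilinear (pring a) (qres F a).
Proof. exact: (qres_bc F a).1. Qed.

Definition initial_object (X : catAff) (A : comNzRingType) (x0 : X A) : Prop :=
  forall (R : comNzRingType) (x : X R), exists! a : phom x0 x, True.

Section Initial.
Variables (X : catAff) (A : comNzRingType) (x0 : X A).
Hypothesis x0I : initial_object x0.

Let from R (x : X R) : phom x0 x := projT1 (cid (x0I x)).

Let from_uniq R (x : X R) (a : phom x0 x) : a = from x.
Proof. by rewrite /from; case: cid => b [_ bU] /=; rewrite (bU a). Qed.

Let from_comp R S (x : X R) (y : X S) (a : phom x y) :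
  pcomp a (from x) = from y.
Proof. exact: from_uniq. Qed.

Let pring_from R S (x : X R) (y : X S) (a : phom x y) :
  pring (from y) =1 pring a \o pring (from x).
Proof. by move=> r; rewrite -(from_comp a) pring_comp. Qed.

Let sections_faithful (F G : QCoh X) :
  injective (@fmap _ _ (sections x0) F G).
Proof.
move=> s t st; apply: qhom_ext => R x.
apply: (bc_linear_ext (qres_bc F (from x))) => m /=.
by rewrite !qhom_natural; congr (qres G _ _);
  exact: (congr1 (fun f : {linear _ -> _} => f m) st).
Qed.

(* A map at the initial object extends by base change along the unique arrows. *)
Let sections_full (F G : QCoh X) (h : hom (sections x0 F) (sections x0 G)) :
  exists t, fmap (sections x0) t = h.
Proof.
have hP R (x : X R) : exists f : {linear (F : qcoh X) R x -> (G : qcoh X) R x},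
    f \o qres F (from x) =1 qres G (from x) \o (h : {linear _ -> _}).
  have gP : semilinear (pring (from x)) (qres G (from x) \o (h : {linear _ -> _})).
    by apply: linear_semilinear_comp; exact: qres_semilinear.
  by have [f [fP _]] := (qres_bc F (from x)).2 _ _ gP; exists f.
pose f R x := projT1 (cid (hP R x)).
have fE R x : f R x \o qres F (from x) =1 qres G (from x) \o (h : {linear _ -> _}).
  exact: projT2 (cid (hP R x)).
have fN R S (x : X R) (y : X S) (a : phom x y) :
    f S y \o qres F a =1 qres G a \o f R x.
  apply: (bc_semilinear_ext (qres_bc F (from x)) (psi := pring a)).
  - by apply: semilinear_linear_comp; exact: qres_semilinear.
  - by apply: linear_semilinear_comp; exact: qres_semilinear.
  move=> m /=; have /= := fE S y m; rewrite -(from_comp a) !qres_comp /= => ->.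
  by have /= -> := fE R x m.
exists (exist _ f fN); apply: linear_ext => m /=.
have := fE A x0 m; rewrite -(from_uniq (pid x0)) /=.
by rewrite !qres_id.
Qed.

Section Extend.
Variable M : lmodType A.

Let N R (x : X R) : lmodType R := base_change (pring (from x)) M.
Let u R (x : X R) : M -> N x := @base_change_map _ _ (pring (from x)) M.
Let ubc R (x : X R) : is_base_change (pring (from x)) (u x).
Proof. exact: base_changeP. Qed.

Let res_ex R S (x : X R) (y : X S) (a : phom x y) :
  exists h : N x -> N y, semilinear (pring a) h /\ h \o u x =1 u y.
Proof.
apply: bc_extend; first exact: ubc.
by have /funext <- := pring_from a; exact: (ubc y).1.
Qed.

Let res R S (x : X R) (y : X S) (a : phom x y) := projT1 (cid (res_ex a)).
Let resP R S (x : X R) (y : X S) (a : phom x y) : semilinear (pring a) (res a).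
Proof. exact: (projT2 (cid (res_ex a))).1. Qed.
Let resE R S (x : X R) (y : X S) (a : phom x y) : res a \o u x =1 u y.
Proof. exact: (projT2 (cid (res_ex a))).2. Qed.

Let res_id R (x : X R) : res (pid x) =1 id.
Proof.
apply: (bc_semilinear_ext (@ubc R x) (psi := idfun)).
- have /funext <- : pring (pid x) =1 (idfun : {rmorphism R -> R}) := pring_id x.
  exact: resP.
- by [].
- exact: resE.
Qed.

Let res_comp R S T (x : X R) (y : X S) (z : X T) (b : phom y z) (a : phom x y) :
  res (pcomp b a) =1 res b \o res a.
Proof.
apply: (bc_semilinear_ext (@ubc R x) (psi := (pring b \o pring a : {rmorphism _ -> _}))).
- have /funext <- : pring (pcomp b a) =1
      (pring b \o pring a : {rmorphism R -> T}) := pring_comp b a.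
  exact: resP.
- exact: semilinear_comp (resP a) (resP b).
- move=> m; rewrite resE /=.
  by have /= -> := resE a m; have /= -> := resE b m.
Qed.

Let res_bc R S (x : X R) (y : X S) (a : phom x y) :
  is_base_change (pring a) (res a).
Proof.
apply: (bc_cancel (@ubc R x)); first exact: resP.
by have /funext -> := resE a; have /funext <- := pring_from a; exact: ubc.
Qed.

Let extend : qcoh X := @Qcoh X N res res_id res_comp res_bc.

Lemma sections_surj : exists (F : QCoh X)
    (f : hom (sections x0 F) (M : Mod A)) (g : hom (M : Mod A) (sections x0 F)),
  f ∘ g = idm (M : Mod A) /\ g ∘ f = idm (sections x0 F).
Proof.
have [|f [g [_ fK gK]]] := @bc_id A (pring (from x0)) M (N x0) (u x0) _ (@ubc A x0).
  by rewrite -(from_uniq (pid x0)); exact: pring_id.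
exists extend, (g : {linear _ -> _}), (f : {linear _ -> _}).
by split; apply: linear_ext.
Qed.
End Extend.

(** An initial object makes X affine: a quasi-coherent module is the base change
    of its value there. *)
Lemma sections_equivalence : equivalence (sections x0).
Proof.
by split; [exact: sections_faithful|split; [exact: sections_full|exact: sections_surj]].
Qed.
End Initial.

(** Between categories with initial objects, direct image is restriction of
    scalars along the ring map of the arrow from x0 to f y0. *)
Lemma pullback_universal (X Y : catAff) (f : catAff_map Y X)
    (A B : comNzRingType) (x0 : X A) (y0 : Y B) :
  initial_object x0 -> initial_object y0 ->
  forall G : QCoh Y, exists (H : QCoh X) (eps : hom (pullback f H) G),
    universal_to eps.
Proof.
move=> x0I y0I G; have [c _] := x0I B (f B y0).
have [inX [fullX surjX]] := sections_equivalence x0I.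
have [inY [fullY _]] := sections_equivalence y0I.
pose K : lmodType A := restr (pring c) ((G : qcoh Y) B y0).
have [H [i [j [ij ji]]]] := surjX K.
have ijK (m : K) : (i : {linear _ -> _}) ((j : {linear _ -> _}) m) = m.
  exact: (congr1 (fun f : {linear K -> K} => f m) ij).
have jiK (m : (H : qcoh X) A x0) : (j : {linear _ -> _}) ((i : {linear _ -> _}) m) = m.
  exact: (congr1 (fun f : {linear _ -> _} => f m) ji).
pose s : (H : qcoh X) A x0 -> (G : qcoh Y) B y0 := (i : {linear _ -> K}).
have sP : semilinear (pring c) s by move=> r m m'; exact: (linearP (i : {linear _ -> K})).
have [e [es _]] := (qres_bc (H : qcoh X) c).2 _ _ sP.
have [eps epsE] := fullY (pullback f H) G e.
have epsP (n : (H : qcoh X) B (f B y0)) : sval eps B y0 n = e n.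
  exact: (congr1 (fun f : {linear _ -> _} => f n) epsE).
exists H, eps => F h.
pose w (m : (F : qcoh X) A x0) : K := sval h B y0 (qres (F : qcoh X) c m).
have wP : linear w.
  by move=> r m m'; rewrite /w (qres_semilinear (F := (F : qcoh X)) c) linearP.
have [u uE] := fullX F H (j ∘ (mklin wP : hom (_ : Mod A) (_ : Mod A))).
have uP (m : (F : qcoh X) A x0) : sval u A x0 m = (j : {linear _ -> _}) (w m).
  exact: (congr1 (fun f : {linear _ -> _} => f m) uE).
exists u; split=> [|v vE].
  apply: inY; apply: linear_ext.
  apply: (bc_linear_ext (qres_bc (F : qcoh X) c)) => m /=.
  by rewrite qhom_natural epsP; have /= -> := es (sval u A x0 m); rewrite uP; exact: ijK.
apply: inX; apply: linear_ext => m /=.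
rewrite uP -[RHS]jiK; congr ((j : {linear _ -> _}) _).
rewrite /w -vE /= qhom_natural epsP; have /= -> := es (sval v A x0 m).
by [].
Qed.

(** * Commuting endomorphisms *)

(** The action of a torsor is tested on points with values in commutative rings.
    To learn about a module H from it, one needs a commutative ring that acts
    on H: the bicommutant of a commuting family of endomorphisms. *)
Section Bicommutant.
Variables (H : zmodType) (S : (H -> H) -> Prop).

Definition commuting (f g : H -> H) : Prop := forall x, f (g x) = g (f x).
Definition commutant (g : H -> H) : Prop :=
  zmod_morphism g /\ forall f, S f -> commuting f g.
Definition bicommutant (F : H -> H) : Prop :=
  zmod_morphism F /\ forall g, commutant g -> commuting F g.

Hypothesis Sadd : forall f, S f -> zmod_morphism f.
Hypothesis Scomm : forall f g, S f -> S g -> commuting f g.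
Hypothesis Hneq0 : exists h : H, h != 0.

Definition bicomm of (forall f, S f -> zmod_morphism f)
  & (forall f g, S f -> S g -> commuting f g) & (exists h : H, h != 0) : Type :=
  {F : H -> H | bicommutant F}.
Local Notation E := (bicomm Sadd Scomm Hneq0).

HB.instance Definition _ := gen_eqMixin E.
HB.instance Definition _ := gen_choiceMixin E.

Lemma bicomm_ext (F G : E) : sval F =1 sval G -> F = G.
Proof. by move=> FG; apply: sig_ext; exact/funext. Qed.

Lemma bicommB (F : E) : zmod_morphism (sval F).
Proof. exact: (svalP F).1. Qed.

Let add0 (f : H -> H) : zmod_morphism f -> f 0 = 0.
Proof. by move=> fB; rewrite -[in LHS](subrr 0) fB subrr. Qed.
Let addN (f : H -> H) (fB : zmod_morphism f) x : f (- x) = - f x.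
Proof. by rewrite -sub0r fB (add0 fB) sub0r. Qed.
Let addD (f : H -> H) (fB : zmod_morphism f) x y : f (x + y) = f x + f y.
Proof. by rewrite -[y in LHS]opprK fB (addN fB) opprK. Qed.

Fact bicomm_addP (F G : E) : bicommutant (fun x => sval F x + sval G x).
Proof.
split=> [x y|g [gB gS] x].
  by rewrite !bicommB opprD addrACA.
rewrite (addD gB); congr (_ + _).
  exact: (svalP F).2.
exact: (svalP G).2.
Qed.
Fact bicomm_oppP (F : E) : bicommutant (fun x => - sval F x).
Proof.
split=> [x y|g [gB gS] x]; first by rewrite /= bicommB opprB opprK addrC.
by rewrite (addN gB); congr (- _); exact: (svalP F).2.
Qed.
Fact bicomm_zeroP : bicommutant (fun=> 0).
Proof. by split=> [x y|g [gB gS] x]; rewrite /= ?subrr ?(add0 gB). Qed.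
Fact bicomm_oneP : bicommutant id.
Proof. by []. Qed.
Fact bicomm_mulP (F G : E) : bicommutant (sval F \o sval G).
Proof.
split=> [x y|g gP x] /=; first by rewrite !bicommB.
by rewrite ((svalP G).2 g gP) ((svalP F).2 g gP).
Qed.

Definition bicomm_add (F G : E) : E := exist _ _ (bicomm_addP F G).
Definition bicomm_opp (F : E) : E := exist _ _ (bicomm_oppP F).
Definition bicomm_zero : E := exist _ _ bicomm_zeroP.
Definition bicomm_one : E := exist _ _ bicomm_oneP.
Definition bicomm_mul (F G : E) : E := exist _ _ (bicomm_mulP F G).

Fact bicomm_addA : associative bicomm_add.
Proof. by move=> F G K; apply: bicomm_ext => x; exact: addrA. Qed.
Fact bicomm_addC : commutative bicomm_add.
Proof. by move=> F G; apply: bicomm_ext => x; exact: addrC. Qed.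
Fact bicomm_add0 : left_id bicomm_zero bicomm_add.
Proof. by move=> F; apply: bicomm_ext => x; exact: add0r. Qed.
Fact bicomm_addN : left_inverse bicomm_zero bicomm_opp bicomm_add.
Proof. by move=> F; apply: bicomm_ext => x; exact: addNr. Qed.

HB.instance Definition _ := GRing.isZmodule.Build E
  bicomm_addA bicomm_addC bicomm_add0 bicomm_addN.

Lemma bicommutant_mem (f : H -> H) : S f -> bicommutant f.
Proof. by move=> Sf; split=> [|g [_ gS] x]; [exact: Sadd|exact: gS]. Qed.

Fact bicomm_mulA : associative bicomm_mul.
Proof. by move=> F G K; exact: bicomm_ext. Qed.
Fact bicomm_mulC : commutative bicomm_mul.
Proof.
move=> F G; apply: bicomm_ext => x; suff GP : commutant (sval G).
  exact: ((svalP F).2 _ GP x).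
split=> [|f Sf y]; first exact: bicommB.
suff fP : commutant f by exact: esym ((svalP G).2 _ fP y).
by split=> [|g Sg]; [exact: Sadd|exact: Scomm Sg Sf].
Qed.
Fact bicomm_mul1 : left_id bicomm_one bicomm_mul.
Proof. by move=> F; exact: bicomm_ext. Qed.
Fact bicomm_mulD : left_distributive bicomm_mul bicomm_add.
Proof. by move=> F G K; exact: bicomm_ext. Qed.
Fact bicomm_one_neq0 : bicomm_one != 0.
Proof.
have [h h0] := Hneq0; apply: contra_neq h0.
by move=> /(congr1 (fun F : E => sval F h)).
Qed.

HB.instance Definition _ := GRing.Zmodule_isComNzRing.Build E
  bicomm_mulA bicomm_mulC bicomm_mul1 bicomm_mulD bicomm_one_neq0.

Lemma bicomm_rmorph (B : comNzRingType) (act : B -> H -> H) :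
  (forall b, S (act b)) ->
  (forall b c x, act (b - c) x = act b x - act c x) ->
  (forall b c x, act (b * c) x = act b (act c x)) -> (forall x, act 1 x = x) ->
  exists p : {rmorphism B -> E}, forall b, sval (p b) = act b.
Proof.
move=> actS actB actM act1.
pose p b : E := exist _ _ (bicommutant_mem (actS b)).
have pB : zmod_morphism p by move=> b c; apply: bicomm_ext => x; exact: actB.
have pM : monoid_morphism p.
  split; first by apply: bicomm_ext => x; exact: act1.
  by move=> b c; apply: bicomm_ext => x; exact: actM.
exists (HB.pack_for {rmorphism B -> E} p
  (GRing.isZmodMorphism.Build _ _ p pB) (GRing.isMonoidMorphism.Build _ _ p pM)).
by [].
Qed.

End Bicommutant.

(** * The structure of alpha_2-torsors *)

Section TorsorStructure.
Variables (R : comNzRingType) (T : torsor R).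
Let B := tring T.
Let s : {rmorphism R -> B} := tstr T.

Definition dual_eps (C : comNzRingType) : alpha2 (dual C) :=
  exist (fun a : dual C => a ^+ 2 = 0) (dual_x C) (dual_x2 C).

(** The action of the universal point: b |-> b + D(b) x. *)
Definition torsor_univ : {rmorphism B -> dual B} :=
  tact (dual_eps B) (@dual_const B : {rmorphism B -> dual B}).
Definition torsor_D (b : B) : B := (torsor_univ b).2.
Local Notation D := torsor_D.

Lemma torsor_univ1 b : (torsor_univ b).1 = b.
Proof.
have z0 : (0 : B) ^+ 2 = 0 by rewrite expr2 mulr0.
pose z : alpha2 B := exist (fun a : B => a ^+ 2 = 0) 0 z0.
pose e : {rmorphism dual B -> B} := dual_ext (idfun : {rmorphism B -> B}) z.
have := tact_nat e (dual_eps B) (@dual_const B : {rmorphism B -> dual B}) b.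
rewrite [RHS](tact_zero (t := T)); last by rewrite /= /dual_ext /= mulr0 addr0.
by rewrite -[LHS]/((torsor_univ b).1 + (torsor_univ b).2 * 0)
  -[RHS]/(b + 0 * 0) !mulr0 !addr0.
Qed.

Lemma torsor_univE b : torsor_univ b = (b, D b).
Proof. by rewrite [LHS]surjective_pairing torsor_univ1. Qed.

(** By naturality the action of an arbitrary point is a specialization of that
    of the universal one. *)
Lemma tactE (C : comNzRingType) (a : alpha2 C) (p : {rmorphism B -> C}) b :
  tact a p b = p b + p (D b) * sval a.
Proof.
have /= := tact_nat (dual_ext p a : {rmorphism dual B -> C}) (dual_eps B)
  (@dual_const B : {rmorphism B -> dual B}) b.
rewrite -[tact _ _ b]/(torsor_univ b) torsor_univE /dual_ext /= => ->.
have -> : alpha2_map (dual_ext p a : {rmorphism dual B -> C}) (dual_eps B) = a.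
  by apply: sig_ext; rewrite /= /dual_ext /= rmorph0 rmorph1 mul1r add0r.
congr (tact a _ b); apply: rmorph_ext => c /=.
by rewrite /dual_ext /= rmorph0 mul0r addr0.
Qed.

Lemma torsor_DB b c : D (b - c) = D b - D c.
Proof. by rewrite /D rmorphB. Qed.
Lemma torsor_DD b c : D (b + c) = D b + D c.
Proof. by rewrite /D rmorphD. Qed.
Lemma torsor_DM b c : D (b * c) = b * D c + D b * c.
Proof. by rewrite {1}/D rmorphM !torsor_univE. Qed.
Lemma torsor_Ds r : D (s r) = 0.
Proof.
by rewrite /D -[torsor_univ _]/((torsor_univ \o tstr T) r) tact_over.
Qed.
Lemma torsor_DsM r b : D (s r * b) = s r * D b.
Proof. by rewrite torsor_DM torsor_Ds mul0r addr0. Qed.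

Hypothesis R2 : 2%N \in [pchar R].

(** Over B[x, y] / (x^2, y^2), translation by y and then by x is translation by
    x + y; the two sides differ by D(D b) x y. *)
Lemma torsor_DDb b : D (D b) = 0.
Proof.
pose p : {rmorphism B -> dual (dual B)} := (@dual_const (dual B) \o @dual_const B).
pose x : alpha2 (dual (dual B)) := alpha2_map (@dual_const (dual B)) (dual_eps B).
pose y : alpha2 (dual (dual B)) := dual_eps (dual B).
have xy : (sval x + sval y) ^+ 2 = 0.
  by rewrite sqrrD (svalP x) (svalP y) add0r addr0 -mulr_natl
    (two_eq0 R2 (p \o s : {rmorphism R -> _})) mul0r.
have := @tact_add _ T _ x y (exist (fun a => a ^+ 2 = 0) _ xy) p erefl b.
rewrite !tactE /= => /eqP; rewrite -subr_eq0 => /eqP.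
move=> /(congr1 (fun u : dual (dual B) => u.2.2)) /=.
set d := D (D b); set e := D b.
have -> : d = - - d by rewrite opprK.
by move=> E; apply/eqP; rewrite oppr_eq0; apply/eqP; rewrite -[RHS]E; ring.
Qed.

End TorsorStructure.

Section TorsorDescent.
Variables (R : comNzRingType) (T : torsor R).
Let B := tring T.
Let s : {rmorphism R -> B} := tstr T.
Local Notation D := (@torsor_D R T).

(** Two points of a torsor over the same point of the base differ by a
    translation, hence agree on the kernel of D. *)
Lemma torsor_points (C : comNzRingType) (p q : {rmorphism B -> C}) b :
  p \o s =1 q \o s -> D b = 0 -> p b = q b.
Proof.
move=> pq Db; have [a [aE _]] := tact_trans pq.
by rewrite -aE tactE Db rmorph0 mul0r addr0.
Qed.

Section OnHom.
Variable L : lmodType B.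
Let H := homext s (restr s L).

Let actP (b : B) (f : H) r c c' :
  b *: (sval f (s r * c + c') : L) = s r *: (b *: (sval f c : L)) + b *: (sval f c' : L).
Proof.
have -> : sval f (s r * c + c') = s r *: (sval f c : L) + (sval f c' : L) :> L.
  exact: (svalP f).
by rewrite scalerDr !scalerA mulrC.
Qed.
Let act (b : B) (f : H) : H :=
  exist (fun f : B -> restr s L => forall r c c',
    f (s r * c + c') = r *: f c + f c') (fun c => b *: (sval f c : L)) (actP b f).
Let S (f : H -> H) : Prop := (exists b, f = act b) \/ (exists b, f = *:%R b).

Let Sadd f : S f -> zmod_morphism f.
Proof.
move=> [] [b ->] x y; last exact: scalerBr.
by apply: homext_ext => c; exact: (scalerBr b (sval x c : L) (sval y c : L)).
Qed.

Let Scomm f g : S f -> S g -> commuting f g.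
Proof.
move=> [] [b ->] [] [c ->] x; try by apply: homext_ext.
  by apply: homext_ext => d /=; rewrite !scalerA mulrC.
by rewrite !scalerA mulrC.
Qed.

(** The tensor square of B over R acts on the R-linear maps from B to L through
    source and target.  Its two B-points agree on the kernel of D, so an element
    c of the kernel can be moved from the source to the target of g.  The image
    of the tensor square in the endomorphisms of these maps suffices. *)
Lemma torsor_ker_linear (g : B -> L) (c : B) :
  (forall r b b', g (s r * b + b') = s r *: g b + g b') ->
  D c = 0 -> g c = c *: g 1.
Proof.
move=> gP Dc; pose f : H := exist (fun f : B -> restr s L => forall r c c',
    f (s r * c + c') = r *: f c + f c') g gP.
have [f0|f0] := eqVneq f 0.
  have g0 b : g b = 0 by exact: (congr1 (fun h : H => sval h b) f0).
  by rewrite !g0 scaler0.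
have H0 : exists h : H, h != 0 by exists f.
have actB b b' (x : H) : act (b - b') x = act b x - act b' x.
  by apply: homext_ext => d; exact: (scalerBl b b' (sval x d : L)).
have actM b b' (x : H) : act (b * b') x = act b (act b' x).
  by apply: homext_ext => d; exact: (esym (scalerA b b' (sval x d : L))).
have act1 (x : H) : act 1 x = x.
  by apply: homext_ext => d; exact: (scale1r (sval x d : L)).
have [p pE] := @bicomm_rmorph H S Sadd Scomm H0 B act
  (fun b => or_introl (ex_intro _ b erefl)) actB actM act1.
have [q qE] := @bicomm_rmorph H S Sadd Scomm H0 B *:%R
  (fun b => or_intror (ex_intro _ b erefl))
  (fun b c x => scalerBl _ _ _) (fun b c x => esym (scalerA _ _ _)) (@scale1r _ _).
have pq : p \o s =1 q \o s.
  move=> r; apply: bicomm_ext => h; rewrite /= pE qE; apply: homext_ext => d /=.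
  have := svalP h r d 0; have h0 : sval h 0 = 0.
    have := svalP h 1 0 0; rewrite rmorph1 !mul1r scale1r !addr0 => e.
    by apply: (@addrI _ (sval h 0)); rewrite -e addr0.
  by rewrite h0 !addr0 mulrC => ->.
have /(congr1 (fun F => sval (sval F f) 1)) := torsor_points pq Dc.
by rewrite pE qE /= mul1r.
Qed.
End OnHom.

Lemma torsor_str_bc : is_base_change s (s : R^o -> B^o).
Proof. exact: regular_base_change. Qed.

Lemma torsor_str_inj : injective s.
Proof.
move=> r r' e; apply/eqP; rewrite -subr_eq0; apply/eqP.
apply: (faithfully_flat_inj (tfppf T).1 torsor_str_bc).
by rewrite rmorphB -/s e subrr.
Qed.

(** Descent: an element of the kernel of D dies in (B / R) \otimes B, hence in
    B / R. *)
Lemma torsor_ker c : D c = 0 -> exists r, c = s r.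
Proof.
move=> Dc; pose BR : lmodType R := restr s B^o.
have hP : submod_closed (fun b : BR => exists r, b = s r).
  split=> [|r x y [a ->] [b ->]]; first by exists 0; rewrite rmorph0.
  by exists (r * a + b); rewrite rmorphD rmorphM.
apply/(proj_eq0 hP c).
pose v := @base_change_map _ _ s (quotmod (modulo hP)).
have ubc : is_base_change s v by exact: base_changeP.
apply: (faithfully_flat_inj (tfppf T).1 ubc).
rewrite -[LHS]/((v \o proj hP) c).
have gP := linear_semilinear_comp (proj hP) ubc.1.
rewrite (torsor_ker_linear (g := v \o proj hP)) //.
have /= -> : proj hP 1 = 0 by apply/(proj_eq0 hP); exists 1; rewrite rmorph1.
by rewrite (semilinear0 ubc.1) scaler0.
Qed.

(** If D(B) kills a nonzero N, the point of the torsor given by the action of B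
    on N is fixed by every translation, against freeness of the action. *)
Lemma torsor_D_unit (N : lmodType B) :
  (forall b (n : N), D b *: n = 0) -> forall n : N, n = 0.
Proof.
move=> DN n; have [//|n0] := eqVneq n 0.
pose S (f : N -> N) := exists b : B, f = *:%R b.
have Sadd f : S f -> zmod_morphism f by move=> [b ->] x y; exact: scalerBr.
have Scomm f g : S f -> S g -> commuting f g.
  by move=> [b ->] [c ->] x; rewrite !scalerA mulrC.
have [p pE] := @bicomm_rmorph N S Sadd Scomm (ex_intro _ n n0) B *:%R
  (fun b => ex_intro _ b erefl)
  (fun b c x => scalerBl _ _ _) (fun b c x => esym (scalerA _ _ _)) (@scale1r _ _).
set C := bicomm _ _ _ in p pE *.
pose q : {rmorphism B -> dual C} := (@dual_const C \o p).
have pD b : p (D b) = 0 by apply: bicomm_ext => m; rewrite pE DN.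
have qa (a : alpha2 (dual C)) : tact a q =1 q.
  by move=> b; rewrite tactE /= pD rmorph0 mul0r addr0.
have [a [_ aU]] := tact_trans (p := q) (q := q) (fun=> erefl).
have z0 : (0 : dual C) ^+ 2 = 0 by rewrite expr2 mulr0.
have := etrans (esym (aU _ (qa (dual_eps C))))
  (aU _ (qa (exist (fun a : dual C => a ^+ 2 = 0) 0 z0))).
by move=> /(congr1 sval) /= /(congr1 snd) /= /eqP; rewrite oner_eq0.
Qed.

Hypothesis R2 : 2%N \in [pchar R].

(** The image of D is an ideal of R that generates the unit ideal in B, so it is
    the unit ideal by faithful flatness. *)
Lemma torsor_D1 : exists t, D t = 1.
Proof.
have hP : submod_closed (fun r : R^o => exists b, s r = D b).
  split=> [|r x y [b xb] [c yc]].
    by exists 0; rewrite /torsor_D !rmorph0.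
  by exists (s r * b + c); rewrite torsor_DD torsor_DsM -xb -yc rmorphD rmorphM.
have ubc := base_changeP s (quotmod (modulo hP)).
suff /(proj_eq0 hP) [t tE] : proj hP (1 : R^o) = 0.
  by exists t; rewrite -tE rmorph1.
apply: (faithfully_flat_inj (tfppf T).1 ubc).
apply: torsor_D_unit => b; apply: (bc_ind ubc (P := fun n => D b *: n = 0)).
  split=> [|a x y xE yE]; first exact: scaler0.
  by rewrite scalerDr yE addr0 scalerA mulrC -scalerA xE scaler0.
move=> m; have [r rE] := torsor_ker (torsor_DDb R2 b).
have [x <-] := proj_surj m.
rewrite rE -[s r]/(tstr T r) -(semilinearZ ubc.1) -linearZ.
have /= -> : proj hP (r *: x) = 0.
  apply/(proj_eq0 hP); exists (b * s x).
  by rewrite mulrC torsor_DsM rE mulrC -rmorphM.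
exact: (semilinear0 ubc.1).
Qed.

(** So a torsor is R[t] with t^2 in R: B is free over R on 1 and t. *)
Lemma torsor_coord (t : B) : D t = 1 ->
  exists c0 c1 : B -> R,
  [/\ forall b, b = s (c0 b) + s (c1 b) * t, forall b, D b = s (c1 b),
      forall r b b', c0 (s r * b + b') = r * c0 b + c0 b',
      forall r b b', c1 (s r * b + b') = r * c1 b + c1 b' & c0 1 = 1 /\ c1 t = 1].
Proof.
move=> tD.
have H1 b : exists r, D b = s r by apply: torsor_ker; exact: torsor_DDb.
pose c1 b := projT1 (cid (H1 b)).
have c1E b : D b = s (c1 b) := projT2 (cid (H1 b)).
have H0 b : exists r, b - s (c1 b) * t = s r.
  by apply: torsor_ker; rewrite torsor_DB torsor_DsM tD mulr1 c1E subrr.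
pose c0 b := projT1 (cid (H0 b)).
have c0E b : b - s (c1 b) * t = s (c0 b) := projT2 (cid (H0 b)).
have c1P r b b' : c1 (s r * b + b') = r * c1 b + c1 b'.
  apply: torsor_str_inj.
  by rewrite -c1E rmorphD rmorphM torsor_DD torsor_DsM !c1E.
have c1s : c1 1 = 0.
  by apply: torsor_str_inj; rewrite -c1E -(rmorph1 s) torsor_Ds rmorph0.
exists c0, c1; split=> //.
- by move=> b; rewrite -c0E subrK.
- move=> r b b'; apply: torsor_str_inj.
  by rewrite -c0E c1P !rmorphD !rmorphM -!c0E; ring.
split; apply: torsor_str_inj.
  by rewrite -c0E c1s rmorph0 mul0r subr0 rmorph1.
by rewrite -c1E tD rmorph1.
Qed.

End TorsorDescent.

(** * Arrows to trivial torsors *)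

Definition dual_ev0 (R : comNzRingType) : {rmorphism dual R -> R} :=
  dual_ext (idfun : {rmorphism R -> R})
    (exist (fun a : R => a ^+ 2 = 0) 0 (expr0n R 2)).

Lemma dual_ev0E (R : comNzRingType) (u : dual R) : dual_ev0 R u = u.1.
Proof. by rewrite /= /dual_ext /= mulr0 addr0. Qed.

Lemma trivial_torsor_D (R : comNzRingType) (R2 : 2%N \in [pchar R]) (u : dual R) :
  @torsor_D R (trivial_torsor R2) u = dual_const u.2.
Proof.
rewrite -[LHS]/(trivial_act R2 (dual_eps (dual R))
  (@dual_const (dual R) : {rmorphism dual R -> dual (dual R)}) u).2.
by rewrite trivial_actE /=; ring.
Qed.

Section Arrows.
Variables (k : fieldType) (k2 : 2%N \in [pchar k]).
Local Notation X := (Balpha2 k).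

Lemma B_total_D (R S : comNzRingType) (x : X R) (y : X S) (c : phom x y)
    (b : tring x.2) : B_total c (torsor_D b) = torsor_D (B_total c b).
Proof.
have := B_equiv c (dual_eps _)
  (@dual_const (tring y.2) : {rmorphism tring y.2 -> dual (tring y.2)}) b.
rewrite /= !tactE => /(congr1 snd) /=.
by rewrite !mul0r !mulr1 !addr0 !add0r.
Qed.

Definition triv (S : comNzRingType) (sigma : {rmorphism k -> S}) : X S :=
  alpha2_cover k2 S sigma.

(** By equivariance an arrow to a trivial torsor is determined by its part of
    degree zero in x, a point of the source torsor. *)
Lemma to_triv_total (R S : comNzRingType) (x : X R) (sigma : {rmorphism k -> S})
    (c : phom x (triv sigma)) b :
  B_total c b = ((B_total c b).1, (B_total c (torsor_D b)).1).
Proof.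
by rewrite B_total_D [torsor_D _]trivial_torsor_D [LHS]surjective_pairing.
Qed.

Lemma to_triv_ext (R S : comNzRingType) (x : X R) (sigma : {rmorphism k -> S})
    (c c' : phom x (triv sigma)) :
  (forall b, (B_total c b).1 = (B_total c' b).1) -> c = c'.
Proof.
move=> cc'; have e : B_total c =1 B_total c'.
  by move=> b; rewrite to_triv_total [RHS]to_triv_total !cc'.
apply: B_hom_ext => // r.
have e1 := B_square c r; have e2 := B_square c' r.
have := etrans (esym e1) (etrans (e _) e2).
by move=> /(congr1 fst).
Qed.

Section ToTriv.
Variables (R S : comNzRingType) (x : X R) (sigma : {rmorphism k -> S}).
Variables (p : {rmorphism tring x.2 -> S}).
Hypothesis pk : forall c, p (tstr x.2 (x.1 c)) = sigma c.

Let total : {rmorphism tring x.2 -> dual S} :=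
  tact (dual_eps S) (@dual_const S \o p : {rmorphism tring x.2 -> dual S}).

Let totalE b : total b = (p b, p (torsor_D b)).
Proof. by rewrite /total tactE; congr pair => /=; ring. Qed.

Let base_k : (p \o tstr x.2 : {rmorphism R -> S}) \o x.1 =1 (triv sigma).1.
Proof. exact: pk. Qed.

Let square : total \o tstr x.2 =1
  tstr (triv sigma).2 \o (p \o tstr x.2 : {rmorphism R -> S}).
Proof. by move=> r; rewrite /total tact_over. Qed.

Let equiv (C : comNzRingType) (a : alpha2 C)
    (q : {rmorphism tring (triv sigma).2 -> C}) :
  tact a q \o total =1 tact a (q \o total : {rmorphism tring x.2 -> C}).
Proof.
move=> b; have DDb : torsor_D (torsor_D b) = 0.
  exact: torsor_DDb (pchar_alg k2 x.1) b.
rewrite -[LHS]/(tact a q (total b)) [LHS]tactE [RHS]tactE.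
congr (_ + _ * _) => //.
rewrite -[RHS]/(q (total (torsor_D b))); congr (q _).
by rewrite [LHS]trivial_torsor_D !totalE DDb rmorph0.
Qed.

(** A point of a torsor over Spec S trivializes it there. *)
Definition to_triv : phom x (triv sigma) :=
  @BHom k R S x (triv sigma) (p \o tstr x.2) total base_k square equiv.

Lemma to_trivE b : (B_total to_triv b).1 = p b.
Proof. by rewrite -[B_total _ _]/(total b) totalE. Qed.

End ToTriv.

Definition kid : {rmorphism k -> k} := idfun.
Local Notation tk := (triv kid).

Definition zero_pt (S : comNzRingType) : alpha2 S :=
  exist (fun a : S => a ^+ 2 = 0) 0 (expr0n S 2).

Lemma translate_subproof (S : comNzRingType) (sigma : {rmorphism k -> S})
    (a : alpha2 S) c :
  dual_ext sigma a (tstr tk.2 (tk.1 c)) = sigma c.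
Proof. by rewrite /dual_ext /= rmorph0 mul0r addr0. Qed.

(** The trivialization of the trivial torsor at x = a. *)
Definition translate (S : comNzRingType) (sigma : {rmorphism k -> S})
    (a : alpha2 S) : phom tk (triv sigma) :=
  to_triv (x := tk) (p := dual_ext sigma a) (translate_subproof sigma a).

Lemma translateE (S : comNzRingType) (sigma : {rmorphism k -> S}) (a : alpha2 S) u :
  (B_total (translate sigma a) u).1 = sigma u.1 + sigma u.2 * sval a.
Proof. by rewrite to_trivE. Qed.

Lemma pring_translate (S : comNzRingType) (sigma : {rmorphism k -> S}) (a : alpha2 S) :
  pring (translate sigma a) =1 sigma.
Proof. by move=> c; exact: translate_subproof. Qed.

Lemma shift_subproof (S : comNzRingType) (sigma : {rmorphism k -> S})
    (a : alpha2 S) c :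
  dual_ext (idfun : {rmorphism S -> S}) a (tstr (triv sigma).2 ((triv sigma).1 c))
  = sigma c.
Proof. by rewrite /dual_ext /= mul0r addr0. Qed.

Definition shift (S : comNzRingType) (sigma : {rmorphism k -> S}) (a : alpha2 S) :
    phom (triv sigma) (triv sigma) :=
  to_triv (x := triv sigma) (p := dual_ext (idfun : {rmorphism S -> S}) a)
    (shift_subproof sigma a).

Lemma pring_shift (S : comNzRingType) (sigma : {rmorphism k -> S}) (a : alpha2 S) :
  pring (shift sigma a) =1 (idfun : {rmorphism S -> S}).
Proof.
by move=> c; rewrite -[LHS]/(c + 0 * sval a) mul0r addr0.
Qed.

Lemma shift_translate (S : comNzRingType) (sigma : {rmorphism k -> S})
    (a b c : alpha2 S) : sval c = sval a + sval b ->
  pcomp (shift sigma b) (translate sigma a) = translate sigma c.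
Proof.
move=> abc; apply: to_triv_ext => u; rewrite translateE.
transitivity (dual_ext (idfun : {rmorphism S -> S}) b (B_total (translate sigma a) u)).
  exact: to_trivE.
rewrite (to_triv_total (translate sigma a) u).
rewrite -[LHS]/((B_total (translate sigma a) u).1
  + (B_total (translate sigma a) (torsor_D u)).1 * sval b).
rewrite !translateE [torsor_D u]trivial_torsor_D abc.
by rewrite -[(dual_const _).2]/0 rmorph0 mul0r addr0 mulrDr addrA.
Qed.

Definition triv_map (R S : comNzRingType) (rho : {rmorphism k -> R})
    (phi : {rmorphism R -> S}) (sigma : {rmorphism k -> S})
    (e : phi \o rho =1 sigma) : phom (triv rho) (triv sigma) :=
  mhom (alpha2_cover k2) (exist (fun phi : {rmorphism R -> S} => phi \o rho =1 sigma)
                            phi e : @phom (Spec k) _ _ rho sigma).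

Lemma triv_map_translate (R S : comNzRingType) (rho : {rmorphism k -> R})
    (phi : {rmorphism R -> S}) (sigma : {rmorphism k -> S})
    (e : phi \o rho =1 sigma) (a : alpha2 R) :
  pcomp (triv_map e) (translate rho a) = translate sigma (alpha2_map phi a).
Proof.
apply: to_triv_ext => u; rewrite translateE /=.
rewrite -[LHS]/(phi (B_total (translate rho a) u).1) translateE rmorphD rmorphM /=.
by have /= -> := e u.1; have /= -> := e u.2.
Qed.

(** * The differential on the fibre at the trivial torsor over k *)

Section Differential.
Variable F : qcoh X.
Local Notation V := (F k tk).

Let ke : {rmorphism k -> dual k} := @dual_const k.
Let eta := translate ke (dual_eps k).
Let eta0 := translate ke (zero_pt (dual k)).

Lemma translate_bc (S : comNzRingType) (sigma : {rmorphism k -> S}) a :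
  is_base_change sigma (qres F (translate sigma a)).
Proof. by have /funext <- := pring_translate sigma a; exact: qres_bc. Qed.

Lemma translate_semilinear (S : comNzRingType) (sigma : {rmorphism k -> S}) a :
  semilinear sigma (qres F (translate sigma a)).
Proof. exact: (translate_bc sigma a).1. Qed.

(** Over k[eps] / (eps^2) the translation by eps reduces to the identity modulo
    eps, so its coefficient of eps is an endomorphism of the fibre. *)
Lemma differential_exists : exists d : {linear V -> V},
  forall v, qres F eta v = qres F eta0 v + dual_x k *: qres F eta0 (d v).
Proof.
have bc0 := translate_bc ke (zero_pt _).
have [h [h' [hE _ hK]]] := dual_base_change_inv bc0.
have etaP := translate_semilinear ke (dual_eps k).
have dP : linear (fun v => (h (qres F eta v)).2 : V).
  move=> r v v'; rewrite etaP linearP /=.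
  by rewrite scale0r addr0.
have ev_ke : dual_ev0 k \o ke =1 kid by move=> c; rewrite /= dual_ev0E.
pose z := triv_map ev_ke.
have zK a : sval a = 0 \/ sval a = dual_x k -> pcomp z (translate ke a) = pid tk.
  move=> az; rewrite triv_map_translate; apply: to_triv_ext => u.
  by rewrite translateE /= dual_ev0E; case: az => -> /=; rewrite mulr0 addr0.
have h1 v : (h (qres F eta v)).1 = v.
  have zh : (fun n => (h n).1 : V) =1 qres F z.
    apply: (bc_semilinear_ext (psi := dual_ev0 k) bc0) => [a n n'||w /=].
    - by rewrite linearP dual_ev0E.
    - exact: qres_semilinear.
    rewrite -[_ (qres F _ w)]/(h (qres F eta0 w)) hE -[RHS]/((qres F z \o qres F eta0) w).
    by rewrite -qres_comp zK ?qres_id; [|left].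
  by rewrite zh -[LHS]/((qres F z \o qres F eta) v) -qres_comp zK ?qres_id; [|right].
exists (mklin dP) => v; apply: (can_inj hK); rewrite linearD linearZ.
rewrite (hE v) (hE ((h (qres F eta v)).2)).
apply: injective_projections; first by rewrite h1 /= scale0r addr0.
by rewrite /= scale0r scale1r !add0r.
Qed.

Definition differential : {linear V -> V} := projT1 (cid differential_exists).
Local Notation d := differential.

(** A point a of alpha_2 acts on the fibre by v |-> v + a d(v): specialize the
    case of eps along eps |-> a. *)
Lemma translate_res (S : comNzRingType) (sigma : {rmorphism k -> S}) a v :
  qres F (translate sigma a) v
  = qres F (translate sigma (zero_pt S)) v
    + sval a *: qres F (translate sigma (zero_pt S)) (d v).
Proof.
have e : dual_ext sigma a \o ke =1 sigma.
  by move=> c; rewrite /= /dual_ext /= rmorph0 mul0r addr0.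
have ma : pcomp (triv_map e) eta = translate sigma a.
  rewrite triv_map_translate; congr translate; apply: sig_ext => /=.
  by rewrite /dual_ext /= rmorph0 rmorph1 mul1r add0r.
have m0 : pcomp (triv_map e) eta0 = translate sigma (zero_pt S).
  by rewrite triv_map_translate; congr translate; apply: sig_ext; rewrite /= rmorph0.
have mP : semilinear (dual_ext sigma a) (qres F (triv_map e)).
  exact: (@qres_semilinear _ F _ _ _ _ (triv_map e)).
rewrite -ma -m0 !qres_comp /= (projT2 (cid differential_exists) v).
rewrite (semilinearD mP) (semilinearZ mP); congr (_ + _ *: _).
by rewrite /= /dual_ext /= rmorph0 rmorph1 mul1r add0r.
Qed.

Lemma dual_x_inj (v w : V) :
  dual_x k *: qres F eta0 v = dual_x k *: qres F eta0 w -> v = w.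
Proof.
have [//|f [_ fE]] := bc_contract (translate_bc ke (zero_pt _)) (l := snd).
  by move=> r s s'; rewrite /= mul0r addr0.
by move=> /(congr1 f); rewrite !fE !scale1r.
Qed.

(** The translation by a + b is that by a followed by that by b. *)
Lemma translate_res_sq (S : comNzRingType) (sigma : {rmorphism k -> S})
    (a b c : alpha2 S) (v : V) : sval c = sval a + sval b ->
  (sval a * sval b) *: qres F (translate sigma (zero_pt S)) (d (d v)) = 0.
Proof.
move=> abc; pose s w := qres F (translate sigma (zero_pt S)) w.
have mP : semilinear (idfun : {rmorphism S -> S}) (qres F (shift sigma b)).
  have /funext <- := pring_shift sigma b; exact: qres_semilinear.
have sm w : qres F (shift sigma b) (s w) = s w + sval b *: s (d w).
  rewrite -[LHS]/((qres F (shift sigma b) \o qres F (translate sigma (zero_pt S))) w).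
  rewrite -qres_comp (@shift_translate _ _ _ _ b) ?add0r //.
  exact: translate_res.
have E : qres F (translate sigma c) v
    = qres F (shift sigma b) (qres F (translate sigma a) v).
  by rewrite -(shift_translate sigma abc) qres_comp.
move: E; rewrite (translate_res sigma c) (translate_res sigma a).
rewrite -/(s v) -/(s (d v)) (semilinearD mP) (semilinearZ mP) !sm.
rewrite abc scalerDl scalerDr scalerA -!addrA => /addrI.
move=> {}E; apply: (@addrI _ (sval a *: s (d v))).
by apply: (@addrI _ (sval b *: s (d v))); rewrite addr0 -[LHS]E addrC.
Qed.

(** Apply the previous lemma to x and y over k[x, y] / (x^2, y^2), where x y is
    part of a basis over k. *)
Lemma differential_sq v : d (d v) = 0.
Proof.
pose S : comNzRingType := dual (dual k).
pose sg : {rmorphism k -> S} := (@dual_const (dual k) \o ke).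
pose x : alpha2 S := alpha2_map (@dual_const (dual k)) (dual_eps k).
pose y : alpha2 S := dual_eps (dual k).
have xyP : (sval x + sval y) ^+ 2 = 0.
  by rewrite sqrrD (svalP x) (svalP y) add0r addr0 -mulr_natl (two_eq0 k2 sg) mul0r.
have E := translate_res_sq sg (a := x) (b := y)
  (c := exist (fun a : S => a ^+ 2 = 0) _ xyP) v erefl.
pose l (u : S) : k := u.2.2.
have lP r u u' : l (sg r * u + u') = r * l u + l u'.
  by rewrite /l /= !mul0r !addr0.
have lxy : l (sval x * sval y) = 1 by rewrite /l /=; ring.
have [f [fD fE]] := bc_contract (translate_bc sg (zero_pt S)) lP.
have f0 : f 0 = 0 by apply: (@addrI _ (f 0)); rewrite -fD !addr0.
by rewrite -[LHS]scale1r -lxy -fE E f0.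
Qed.
End Differential.

Lemma qhom_differential (F G : qcoh X) (t : qhom F G) (v : F k tk) :
  sval t k tk (differential F v) = differential G (sval t k tk v).
Proof.
have := translate_res (F := F) (@dual_const k) (dual_eps k) v.
move=> /(congr1 (sval t _ _)); rewrite linearD linearZ /= !qhom_natural.
by rewrite translate_res => /addrI /dual_x_inj.
Qed.

End Arrows.

(** * The fibre functor from B alpha_2 to modules over the dual numbers *)

(** The ring k[d] / (d^2), dual to the Hopf algebra of alpha_2, is written as
    [dual k], with [dual_x k] in the role of d. *)
Definition dmod (k : fieldType) (V : lmodType k) (d : {linear V -> V})
  (d2 : forall v, d (d v) = 0) : Type := V.

Section SquareZero.
Variables (k : fieldType) (V : lmodType k) (d : {linear V -> V}).
Variable (d2 : forall v, d (d v) = 0).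

HB.instance Definition _ := GRing.Zmodule.copy (dmod d2) V.

Definition dmod_scale (u : dual k) (v : dmod d2) : dmod d2 :=
  u.1 *: (v : V) + u.2 *: d v.

Fact dmod_scaleA a b v : dmod_scale a (dmod_scale b v) = dmod_scale (a * b) v.
Proof.
have e (c c' : k) (w : V) : d (c *: w + c' *: d w) = c *: d w.
  by rewrite linearD !linearZ /= d2 scaler0 addr0.
rewrite /dmod_scale e scalerDr !scalerA -addrA -scalerDl.
by [].
Qed.
Fact dmod_scale1 : left_id 1 dmod_scale.
Proof. by move=> v; rewrite /dmod_scale scale1r scale0r addr0. Qed.
Fact dmod_scaleDr : right_distributive dmod_scale +%R.
Proof. move=> a v w; have e : d (v + w) = d v + d w by exact: linearD.
by rewrite /dmod_scale e !scalerDr addrACA. Qed.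
Fact dmod_scaleDl v : {morph dmod_scale^~ v : a b / a + b}.
Proof. by move=> a b; rewrite /dmod_scale !scalerDl addrACA. Qed.

HB.instance Definition _ := GRing.Zmodule_isLmodule.Build (dual k) (dmod d2)
  dmod_scaleA dmod_scale1 dmod_scaleDr dmod_scaleDl.

Lemma dmod_scaleE (u : dual k) (v : dmod d2) :
  u *: v = u.1 *: (v : V) + u.2 *: d v :> V.
Proof. by []. Qed.

Lemma dmod_const (a : k) (v : dmod d2) : dual_const a *: v = a *: (v : V) :> V.
Proof. by rewrite dmod_scaleE scale0r addr0. Qed.

Lemma dmod_x (v : dmod d2) : dual_x k *: v = d v :> V.
Proof. by rewrite dmod_scaleE scale0r scale1r add0r. Qed.

End SquareZero.

Section FibreFunctor.
Variables (k : fieldType) (k2 : 2%N \in [pchar k]).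
Local Notation X := (Balpha2 k).
Local Notation tk := (triv k2 (kid k)).

Definition fibre (F : qcoh X) : lmodType (dual k) := dmod (@differential_sq k k2 F).

Fact fibre_map_linear (F G : qcoh X) (t : qhom F G) :
  linear (sval t k tk : fibre F -> fibre G).
Proof.
move=> a v w; rewrite [LHS]linearD; congr (_ + _).
rewrite -[LHS]/(sval t k tk (a.1 *: (v : F k tk) + a.2 *: @differential k k2 F v)).
by rewrite linearD !linearZ /= qhom_differential.
Qed.

#[local] Obligation Tactic := idtac.
Program Definition fibre_functor : functor (QCoh X) (Mod (dual k)) :=
  @Functor (QCoh X) (Mod (dual k)) fibre
    (fun F G t => mklin (@fibre_map_linear F G t)) _ _.
Next Obligation. by move=> F; exact: linear_ext. Qed.
Next Obligation. by move=> F G H t s; exact: linear_ext. Qed.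

(** ** Descent along a torsor *)
Section Torsor.
Variables (R : comNzRingType) (x : X R).
Let B : comNzRingType := tring x.2.
Let s : {rmorphism R -> B} := tstr x.2.

Definition total_k : {rmorphism k -> B} := s \o x.1.

Lemma to_total_subproof c : (idfun : {rmorphism B -> B}) (s (x.1 c)) = total_k c.
Proof. by []. Qed.

(** Over its own total space, a torsor is trivialized by the diagonal. *)
Definition to_total : phom x (triv k2 total_k) :=
  to_triv k2 (p := (idfun : {rmorphism tring x.2 -> B})) to_total_subproof.

Lemma to_totalE b : (B_total to_total b).1 = b.
Proof. exact: to_trivE. Qed.

Lemma to_total_bc (F : qcoh X) : is_base_change s (qres F to_total).
Proof. by have /funext <- : pring to_total =1 s by []; exact: qres_bc. Qed.

Lemma to_total_inj (F : qcoh X) : injective (qres F to_total).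
Proof.
move=> m m' e; apply/eqP; rewrite -subr_eq0; apply/eqP.
apply: (faithfully_flat_inj (tfppf x.2).1 (to_total_bc F)).
by rewrite (semilinearB (to_total_bc F).1) e subrr.
Qed.

Let square_k : {rmorphism k -> dual B} := (@dual_const B \o total_k).

Fact const_square : (@dual_const B : {rmorphism B -> dual B}) \o total_k =1 square_k.
Proof. by []. Qed.
Fact univ_square : torsor_univ x.2 \o total_k =1 square_k.
Proof. by move=> c; exact: (tact_over (t := x.2)). Qed.

Fact neg_eps_subproof : (- dual_x B) ^+ 2 = 0.
Proof. by rewrite sqrrN dual_x2. Qed.
(* The second projection moves the diagonal trivialization by x; translating
   back by - x makes both projections agree on it. *)
Let neg_eps : alpha2 (dual B) := exist (fun a : dual B => a ^+ 2 = 0) _ neg_eps_subproof.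

(** The two projections of the torsor times itself, with the trivializations
    that come from the first factor. *)
Definition pr1_total : phom (triv k2 total_k) (triv k2 square_k) :=
  triv_map k2 const_square.
Definition pr2_total : phom (triv k2 total_k) (triv k2 square_k) :=
  pcomp (shift k2 square_k neg_eps) (triv_map k2 univ_square).

Lemma pring_pr2 : pring pr2_total =1 torsor_univ x.2.
Proof. by move=> b; rewrite pring_comp; exact: pring_shift. Qed.

Lemma pr_total : pcomp pr2_total to_total = pcomp pr1_total to_total.
Proof.
apply: to_triv_ext => b; rewrite /pr2_total -pcompA.
transitivity (dual_ext (idfun : {rmorphism dual B -> dual B}) neg_eps
    (B_total (pcomp (triv_map k2 univ_square) to_total) b)).
  exact: to_trivE.
rewrite -[B_total _ b]/(dual_map (torsor_univ x.2) (B_total to_total b)).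
rewrite -[RHS]/(dual_map (@dual_const B) (B_total to_total b)).1.
rewrite (to_triv_total to_total b) !to_totalE /dual_ext /dual_map.
have DDb : torsor_D (torsor_D b) = 0 by exact: torsor_DDb (pchar_alg k2 x.1) b.
rewrite -[LHS]/(torsor_univ x.2 b + torsor_univ x.2 (torsor_D b) * sval neg_eps).
rewrite !torsor_univE DDb; apply: injective_projections => /=; ring.
Qed.

Lemma pr1_translate :
  pcomp pr1_total (translate k2 total_k (zero_pt B)) =
  translate k2 square_k (zero_pt (dual B)).
Proof.
by rewrite [LHS]triv_map_translate; congr translate; apply: sig_ext; exact: rmorph0.
Qed.

Lemma pr2_translate :
  pcomp pr2_total (translate k2 total_k (zero_pt B)) = translate k2 square_k neg_eps.
Proof.
rewrite /pr2_total -pcompA triv_map_translate; apply: shift_translate.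
by rewrite -[sval (alpha2_map _ _)]/(torsor_univ x.2 0) rmorph0 add0r.
Qed.

(** B is free on 1 and t over R; the two pullbacks of u m0 + t (u m1) differ by
    x times the pullback of m1. *)
Lemma torsor_descent (F : qcoh X) (n : F B (triv k2 total_k)) :
  qres F pr1_total n = qres F pr2_total n -> exists m, n = qres F to_total m.
Proof.
have R2 := pchar_alg k2 x.1; have [t tD] := torsor_D1 x.2 R2.
have [c0 [c1 [bE _ c0P c1P [c01 _]]]] := torsor_coord R2 tD.
pose u := qres F to_total; have ubc : is_base_change s u := to_total_bc F.
have [f0 [f0D f0E]] := bc_contract ubc c0P.
have [f1 [f1D f1E]] := bc_contract ubc c1P.
have {}nE : n = u (f0 n) + t *: u (f1 n).
  apply: (bc_span (P := fun n => n = u (f0 n) + t *: u (f1 n)) ubc).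
    move=> n1 n2 e1 e2; rewrite f0D f1D !(semilinearD ubc.1) scalerDr.
    by rewrite addrACA -e1 -e2.
  move=> b m; rewrite f0E f1E !(semilinearZ ubc.1) scalerA [t * _]mulrC -scalerDl.
  by rewrite -[_ + _]bE.
move: (f0 n) (f1 n) nE => m0 m1 ->.
pose c := pcomp pr1_total to_total.
have cbc : is_base_change (@dual_const B \o s : {rmorphism R -> dual B}) (qres F c).
  by have /funext <- : pring c =1 (@dual_const B \o s) by []; exact: qres_bc.
have p1 m : qres F pr1_total (u m) = qres F c m.
  by rewrite /c qres_comp.
have p2 m : qres F pr2_total (u m) = qres F c m.
  by rewrite /c -pr_total qres_comp.
have s1 : semilinear (@dual_const B : {rmorphism B -> dual B}) (qres F pr1_total).
  exact: (@qres_semilinear _ F _ _ _ _ pr1_total).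
have s2 : semilinear (torsor_univ x.2) (qres F pr2_total).
  have /funext <- := pring_pr2; exact: qres_semilinear.
rewrite (semilinearD s1) (semilinearZ s1) (semilinearD s2) (semilinearZ s2) !p1 !p2.
have -> : torsor_univ x.2 t = dual_const t + dual_x B.
  by rewrite torsor_univE tD; apply: injective_projections; rewrite /= ?addr0 ?add0r.
rewrite scalerDl => /addrI; rewrite -[LHS]addr0 => /addrI E.
have [r w w'|f [fD fE]] := bc_contract cbc (l := fun w => c0 w.2).
  by rewrite -c0P; congr c0; rewrite /= mul0r addr0.
have f00 : f 0 = 0 by apply: (@addrI _ (f 0)); rewrite -fD !addr0.
have := fE (dual_x B) m1; rewrite -E f00 -[(dual_x B).2]/1 c01 scale1r => <-.
by exists m0; rewrite (semilinear0 ubc.1) scaler0 addr0.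
Qed.

End Torsor.
End FibreFunctor.

Section FullyFaithful.
Variables (k : fieldType) (k2 : 2%N \in [pchar k]).
Local Notation X := (Balpha2 k).
Local Notation tk := (triv k2 (kid k)).
Local Notation base S sigma := (translate k2 sigma (zero_pt S)).

(** Sections inject into sections over the total space of the torsor, where they
    come from the fibre at the trivial torsor over k. *)
Lemma qhom_total (F G : qcoh X) (s t : qhom F G) :
  sval s k tk =1 sval t k tk -> s = t.
Proof.
move=> st; apply: qhom_ext => R x m; apply: (@to_total_inj _ k2).
rewrite -!qhom_natural.
suff e : sval s _ (triv k2 (total_k x)) =1 sval t _ (triv k2 (total_k x)) by exact: e.
apply: (bc_linear_ext (@translate_bc k k2 F _ (total_k x) (zero_pt _))) => v /=.
by rewrite !qhom_natural st.
Qed.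

Section Full.
Variables (F G : qcoh X) (h : {linear fibre k2 F -> fibre k2 G}).

Let hk : F k tk -> G k tk := h.

Let hk_linear : linear hk.
Proof.
move=> a v w.
have e := linearP h (dual_const a) (v : fibre k2 F) (w : fibre k2 F).
have e1 := @dmod_const _ _ _ (@differential_sq k k2 F) a v.
have e2 := @dmod_const _ _ _ (@differential_sq k k2 G) a (h v).
apply: etrans (congr1 (fun z : F k tk => hk (z + w)) (esym e1)) _.
exact: etrans e (congr1 (fun z : G k tk => z + hk w) e2).
Qed.

Let hk_diff v : hk (differential k2 F v) = differential k2 G (hk v).
Proof.
have e : h (dual_x k *: (v : fibre k2 F)) = dual_x k *: h v by rewrite linearZ.
have e1 := @dmod_x _ _ _ (@differential_sq k k2 F) v.
have e2 := @dmod_x _ _ _ (@differential_sq k k2 G) (h v).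
exact: etrans (congr1 hk (esym e1)) (etrans e e2).
Qed.

(* On trivial torsors h extends by base change, compatibly with translations
   because it commutes with the differentials; descent along each torsor then
   carries the extension down to all of B alpha_2. *)
Let ext_ex (S : comNzRingType) (sigma : {rmorphism k -> S}) :
  exists b : {linear F S (triv k2 sigma) -> G S (triv k2 sigma)},
    forall v, b (qres F (base S sigma) v) = qres G (base S sigma) (hk v).
Proof.
have gP : semilinear sigma (qres G (base S sigma) \o mklin hk_linear).
  by apply: linear_semilinear_comp; exact: translate_semilinear.
by have [b [bE _]] := (translate_bc k2 F sigma (zero_pt S)).2 _ _ gP; exists b.
Qed.
Let ext S sigma := projT1 (cid (@ext_ex S sigma)).

Let ext_translate (S : comNzRingType) (sigma : {rmorphism k -> S}) a v :
  ext sigma (qres F (translate k2 sigma a) v) = qres G (translate k2 sigma a) (hk v).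
Proof.
have e w : ext sigma (qres F (base S sigma) w) = qres G (base S sigma) (hk w).
  exact: (projT2 (cid (@ext_ex S sigma))).
rewrite (translate_res sigma a v) (translate_res sigma a (hk v)).
by rewrite linearD linearZ /= !e hk_diff.
Qed.

Let ext_natural (S S' : comNzRingType) (sigma : {rmorphism k -> S})
    (sigma' : {rmorphism k -> S'}) (c : phom (triv k2 sigma) (triv k2 sigma')) a :
  pcomp c (base S sigma) = translate k2 sigma' a ->
  ext sigma' \o qres F c =1 qres G c \o ext sigma.
Proof.
move=> ca; apply: (bc_semilinear_ext (psi := pring c) (translate_bc k2 F sigma (zero_pt S))).
- by apply: semilinear_linear_comp; exact: qres_semilinear.
- by apply: linear_semilinear_comp; exact: qres_semilinear.
move=> v.
rewrite -[LHS]/(ext sigma' ((qres F c \o qres F (base S sigma)) v)) -qres_comp ca.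
rewrite -[RHS]/(qres G c (ext sigma (qres F (base S sigma) v))) !ext_translate.
by rewrite -[RHS]/((qres G c \o qres G (base S sigma)) (hk v)) -qres_comp ca.
Qed.

Let full_ex (R : comNzRingType) (x : X R) (m : F R x) :
  exists m' : G R x,
    ext (total_k x) (qres F (to_total k2 x) m) = qres G (to_total k2 x) m'.
Proof.
apply: torsor_descent.
have n1 := ext_natural (pr1_translate k2 x) (qres F (to_total k2 x) m).
have n2 := ext_natural (pr2_translate k2 x) (qres F (to_total k2 x) m).
apply: (etrans (esym n1)); apply: (etrans _ n2); congr (ext _ _).
rewrite -[LHS]/((qres F (pr1_total k2 x) \o qres F (to_total k2 x)) m) -qres_comp.
by rewrite -pr_total qres_comp.
Qed.

Let full R (x : X R) (m : F R x) : G R x := projT1 (cid (full_ex m)).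
Let fullE R (x : X R) (m : F R x) :
  qres G (to_total k2 x) (full m) = ext (total_k x) (qres F (to_total k2 x) m).
Proof. exact: esym (projT2 (cid (full_ex m))). Qed.

Let full_linear R (x : X R) : linear (@full R x).
Proof.
move=> r m m'; apply: (@to_total_inj _ k2); rewrite fullE.
rewrite (to_total_bc k2 x F).1 (to_total_bc k2 x G).1 linearP !fullE.
by [].
Qed.

Let total_natural R S (x : X R) (y : X S) (c : phom x y) :
  B_total c \o total_k x =1 total_k y.
Proof.
move=> a; have /= -> := B_square c (x.1 a); congr (tstr y.2 _).
exact: B_base_k.
Qed.

Let to_total_natural R S (x : X R) (y : X S) (c : phom x y) :
  pcomp (to_total k2 y) c = pcomp (triv_map k2 (total_natural c)) (to_total k2 x).
Proof.
apply: to_triv_ext => b.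
rewrite -[LHS]/(B_total (to_total k2 y) (B_total c b)).1 to_totalE.
rewrite -[RHS]/(B_total c (B_total (to_total k2 x) b).1).
by rewrite to_totalE.
Qed.

Let full_natural R S (x : X R) (y : X S) (c : phom x y) :
  mklin (@full_linear S y) \o qres F c =1 qres G c \o mklin (@full_linear R x).
Proof.
move=> m; apply: (@to_total_inj _ k2).
rewrite -[LHS]/(qres G (to_total k2 y) (full (qres F c m))) fullE.
have tn := triv_map_translate k2 (total_natural c) (zero_pt _).
have n1 := ext_natural tn (qres F (to_total k2 x) m).
rewrite -[qres F _ (qres F c m)]/((qres F (to_total k2 y) \o qres F c) m).
rewrite -qres_comp to_total_natural qres_comp; apply: (etrans n1).
rewrite -[LHS]/(qres G (triv_map k2 (total_natural c))
  (ext (total_k x) (qres F (to_total k2 x) m))) -fullE.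
rewrite -[LHS]/((qres G (triv_map k2 (total_natural c)) \o qres G (to_total k2 x)) (full m)).
by rewrite -qres_comp -to_total_natural qres_comp.
Qed.

Let to_total_triv :
  to_total k2 tk = translate k2 (total_k tk) (dual_eps k).
Proof.
apply: to_triv_ext => u.
have e1 := to_totalE k2 (x := tk) u.
have e2 := @translateE _ k2 _ (total_k tk) (dual_eps k) u.
exact: etrans e1 (etrans (dualE u) (esym e2)).
Qed.

Lemma fibre_full : exists t : qhom F G, sval t k tk =1 hk.
Proof.
exists (exist _ (fun R x => mklin (@full_linear R x)) full_natural) => v.
apply: (@to_total_inj _ k2).
rewrite -[LHS]/(qres G (to_total k2 tk) (full v)) fullE to_total_triv.
exact: ext_translate.
Qed.
End Full.
End FullyFaithful.

(** A coordinate t with D t = 1 is chosen on every torsor.  The sheaf of a vector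
    space V with a differential d has value R \otimes V over Spec R; along an
    arrow that sends t to t + s, the restriction map is twisted by 1 + s d. *)
Section EssentiallySurjective.
Variables (k : fieldType) (k2 : 2%N \in [pchar k]).
Local Notation X := (Balpha2 k).
Local Notation tk := (triv k2 (kid k)).

Let coord_ex R (x : X R) : exists t : tring x.2, torsor_D t = 1.
Proof. exact: torsor_D1 (pchar_alg k2 x.1). Qed.
Let coord R (x : X R) := projT1 (cid (coord_ex x)).
Let coordE R (x : X R) : torsor_D (coord x) = 1.
Proof. exact: projT2 (cid (coord_ex x)). Qed.

Let offset_ex R S (x : X R) (y : X S) (c : phom x y) :
  exists s, B_total c (coord x) = coord y + tstr y.2 s.
Proof.
have [|s sE] := @torsor_ker S y.2 (B_total c (coord x) - coord y).
  by rewrite torsor_DB coordE -B_total_D coordE rmorph1 subrr.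
by exists s; rewrite -sE addrC subrK.
Qed.
Let offset R S (x : X R) (y : X S) (c : phom x y) := projT1 (cid (offset_ex c)).
Let offsetE R S (x : X R) (y : X S) (c : phom x y) :
  B_total c (coord x) = coord y + tstr y.2 (offset c).
Proof. exact: projT2 (cid (offset_ex c)). Qed.

Let offset_id R (x : X R) : offset (pid x) = 0.
Proof.
apply: (@torsor_str_inj R x.2); rewrite rmorph0.
apply: (@addrI _ (coord x)); rewrite addr0; symmetry.
exact: (offsetE (pid x)).
Qed.

Let offset_comp R S T (x : X R) (y : X S) (z : X T) (b : phom y z) (a : phom x y) :
  offset (pcomp b a) = offset b + pring b (offset a).
Proof.
apply: (@torsor_str_inj T z.2); apply: (@addrI _ (coord z)).
have e := offsetE (pcomp b a).
rewrite -[LHS]e -[LHS]/(B_total b (B_total a (coord x))) (offsetE a).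
rewrite [LHS]rmorphD (offsetE b) rmorphD -addrA; congr (_ + (_ + _)).
exact: (B_square b).
Qed.

Let offset_translate (S : comNzRingType) (sigma : {rmorphism k -> S}) a :
  offset (translate k2 sigma a) = offset (translate k2 sigma (zero_pt S)) + sval a.
Proof.
apply: (@torsor_str_inj S (triv k2 sigma).2); apply: (@addrI _ (coord (triv k2 sigma))).
rewrite rmorphD addrA -(offsetE (translate k2 sigma a)).
rewrite -(offsetE (translate k2 sigma (zero_pt S))).
have := coordE tk; rewrite [LHS]trivial_torsor_D => /(congr1 fst) t2.
have {}t2 : (coord tk).2 = 1 by exact: t2.
rewrite (to_triv_total (translate k2 sigma a)).
rewrite (to_triv_total (translate k2 sigma (zero_pt S))).
rewrite coordE !rmorph1 !translateE t2.
apply: injective_projections.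
  by rewrite -[RHS]/(sigma (coord tk).1 + sigma 1 * 0 + sval a)
    -[LHS]/(sigma (coord tk).1 + sigma 1 * sval a) rmorph1 mul1r mulr0 addr0.
by rewrite -[RHS]/(1 + 0) addr0.
Qed.

Variable W : lmodType (dual k).

Let V : lmodType k := restr (@dual_const k : {rmorphism k -> dual k}) W.

Let d_linear : linear (fun v : V => (dual_x k *: (v : W) : V)).
Proof.
move=> a v w; rewrite -[LHS]/(dual_x k *: (dual_const a *: (v : W) + (w : W)) : W).
by rewrite scalerDr scalerA mulrC -scalerA.
Qed.
Let d : {linear V -> V} := mklin d_linear.
Let d2 v : d (d v) = 0.
Proof.
by rewrite -[LHS]/(dual_x k *: (dual_x k *: (v : W)) : W) scalerA -expr2 dual_x2 scale0r.
Qed.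

Let Q R (x : X R) : lmodType R := base_change x.1 V.
Let u R (x : X R) : V -> Q x := @base_change_map _ _ x.1 V.
Let ubc R (x : X R) : is_base_change x.1 (u x).
Proof. exact: base_changeP. Qed.
Let uP R (x : X R) : semilinear x.1 (u x) := (ubc x).1.

Let w R S (x : X R) (y : X S) (c : phom x y) (v : V) : Q y :=
  u y v + offset c *: u y (d v).

Let wbc R S (x : X R) (y : X S) (c : phom x y) :
  is_base_change (pring c \o x.1 : {rmorphism k -> S}) (w c).
Proof.
have /funext -> : (pring c \o x.1 : {rmorphism k -> S}) =1 y.1 by exact: B_base_k.
exact: (twist_base_change _ (ubc y)).
Qed.

Let res_ex R S (x : X R) (y : X S) (c : phom x y) :
  exists h : Q x -> Q y, semilinear (pring c) h /\ h \o u x =1 w c.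
Proof. by apply: (bc_extend (ubc x)); exact: (wbc c).1. Qed.
Let res R S (x : X R) (y : X S) (c : phom x y) := projT1 (cid (res_ex c)).
Let resP R S (x : X R) (y : X S) (c : phom x y) : semilinear (pring c) (res c).
Proof. exact: (projT2 (cid (res_ex c))).1. Qed.
Let resE R S (x : X R) (y : X S) (c : phom x y) v : res c (u x v) = w c v.
Proof. exact: (projT2 (cid (res_ex c))).2. Qed.

Let res_id R (x : X R) : res (pid x) =1 id.
Proof.
apply: (bc_semilinear_ext (@ubc R x) (psi := idfun)).
- exact: resP.
- by [].
by move=> v; rewrite /= resE /w offset_id scale0r addr0.
Qed.

Let res_comp R S T (x : X R) (y : X S) (z : X T) (b : phom y z) (a : phom x y) :
  res (pcomp b a) =1 res b \o res a.
Proof.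
apply: (bc_semilinear_ext (@ubc R x) (psi := (pring b \o pring a : {rmorphism _ -> _}))).
- exact: resP.
- exact: semilinear_comp (resP a) (resP b).
move=> v; rewrite /= !resE /w (semilinearD (resP b)) (semilinearZ (resP b)) !resE.
rewrite /w d2 (semilinear0 (@uP T z)) scaler0 addr0 offset_comp.
by rewrite scalerDl addrA.
Qed.

Let res_bc R S (x : X R) (y : X S) (c : phom x y) : is_base_change (pring c) (res c).
Proof.
apply: (bc_cancel (@ubc R x)); first exact: resP.
by have /funext -> : res c \o u x =1 w c by [move=> v; exact: resE]; exact: wbc.
Qed.

Let F : qcoh X := @Qcoh X Q res res_id res_comp res_bc.

Let F_differential v : differential k2 F (u tk v) = u tk (d v).
Proof.
pose ke : {rmorphism k -> dual k} := @dual_const k.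
apply: (@dual_x_inj k k2 F); set z := translate k2 ke (zero_pt _).
have e := translate_res ke (dual_eps k) (u tk v : F k tk).
have e1 : qres F (translate k2 ke (dual_eps k)) (u tk v : F k tk)
    = w (translate k2 ke (dual_eps k)) v by exact: resE.
have e2 v' : qres F z (u tk v' : F k tk) = w z v' by exact: resE.
rewrite e1 e2 /w offset_translate scalerDl addrA in e.
move/addrI: e => <-.
by rewrite e2 /w d2 (semilinear0 (@uP _ _)) scaler0 addr0.
Qed.

Lemma fibre_surj : exists (F : QCoh X)
    (f : hom (fibre_functor k2 F) (W : Mod (dual k)))
    (g : hom (W : Mod (dual k)) (fibre_functor k2 F)),
  f ∘ g = idm (W : Mod (dual k)) /\ g ∘ f = idm (fibre_functor k2 F).
Proof.
have [//|f [g [fu fK gK]]] := @bc_id k (kid k) V (Q tk) (u tk) _ (ubc tk).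
pose g' : fibre k2 F -> W := g.
have gP : linear g'.
  move=> a q q';
  rewrite -[LHS]/(g (a.1 *: (q : Q tk)
    + a.2 *: (differential k2 F q : Q tk) + (q' : Q tk))).
  have -> : differential k2 F q = f (d (g q)).
    by rewrite -{1}(gK q) !fu; exact: F_differential.
  rewrite !linearD !linearZ /= fK [a in RHS]dualE scalerDl -scalerA.
  by [].
have f'P : linear (f : W -> fibre k2 F).
  by move=> a v v'; apply: (can_inj gK : injective g'); rewrite gP /g' !fK.
exists F, (mklin gP), (mklin f'P).
by split; apply: linear_ext => v; [exact: fK|exact: gK].
Qed.

End EssentiallySurjective.

(** Quasi-coherent modules on B alpha_2 are vector spaces with an endomorphism
    of square zero: modules over the dual of the Hopf algebra of alpha_2. *)
Lemma fibre_equivalence (k : fieldType) (k2 : 2%N \in [pchar k]) :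
  equivalence (fibre_functor k2).
Proof.
split=> [F G s t st|].
  by apply: (@qhom_total _ k2) => v;
    exact: (congr1 (fun f : {linear fibre k2 F -> fibre k2 G} => f v) st).
split=> [F G h|W]; last exact: fibre_surj.
have [t tE] := fibre_full (h : {linear fibre k2 F -> fibre k2 G}).
by exists t; apply: linear_ext => v; exact: tE.
Qed.

(** * The cover of B alpha_2 *)

Section Cover.
Variables (k : fieldType) (k2 : 2%N \in [pchar k]).
Local Notation X := (Balpha2 k).
Local Notation tk := (triv k2 (kid k)).
Local Notation f := (alpha2_cover k2).

Lemma Spec_initial : @initial_object (Spec k) k (kid k).
Proof.
move=> R x; exists (exist (fun p : {rmorphism k -> R} => p \o kid k =1 x) x (fun=> erefl)).
split=> // -[p pE] _; apply: sig_ext; apply: rmorph_ext => c /=.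
by rewrite -pE.
Qed.

Lemma Spec_fibered : fibered_in_groupoids (Spec k).
Proof.
split=> [R S phi x|R S T x y z [a aE] [b bE] c /= cab].
  by exists (phi \o x : {rmorphism k -> S}),
    (exist (fun p : {rmorphism R -> S} => p \o x =1 phi \o x) phi (fun=> erefl)).
have cE : c \o y =1 z.
  by move=> m; rewrite /= -aE -bE; exact: cab.
exists (exist (fun p : {rmorphism S -> T} => p \o y =1 z) c cE); split.
  by split=> //; apply: sig_ext; apply: rmorph_ext.
by move=> [c' c'E] /= [cc' _]; apply: sig_ext; apply: rmorph_ext.
Qed.

(** The pullback of the cover along a torsor is the total space of the torsor. *)
Lemma alpha2_cover_fppf : affine_fppf_cover f.
Proof.
move=> R x; exists (tring x.2), (total_k x), (to_total k2 x).
split; first by have /funext -> : pring (to_total k2 x) =1 tstr x.2 by []; exact: tfppf.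
move=> T y b.
pose p : {rmorphism tring x.2 -> T} := (dual_ev0 T \o B_total b).
have pE m : p m = (B_total b m).1 by exact: dual_ev0E.
have pk : p \o total_k x =1 y.
  move=> c; rewrite -[LHS]/(p (tstr x.2 (x.1 c))) pE.
  have /= -> := B_square b (x.1 c).
  exact: (B_base_k b).
exists (exist (fun p : {rmorphism tring x.2 -> T} => p \o total_k x =1 y) p pk).
split=> [|[q qk] qE].
  apply: (@to_triv_ext k k2) => m.
  by rewrite -[LHS]/(p (B_total (to_total k2 x) m).1) to_totalE pE.
apply: sig_ext; apply: rmorph_ext => m; rewrite -[LHS]/(p m) pE -qE.
have e := to_totalE k2 m.
exact: (congr1 (fun z => q z) e).
Qed.

(** Direct image along the cover is coinduction V |-> V \otimes k[x]/(x^2). *)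
Lemma cover_universal (G : QCoh (Spec k)) :
  exists (H : QCoh X) (eps : hom (pullback f H) G), universal_to eps.
Proof.
have [inS [fullS _]] := sections_equivalence Spec_initial.
have [inX [fullX surjX]] := fibre_equivalence k2.
pose N : lmodType k := (G : qcoh (Spec k)) k (kid k).
have [H [i [j [ij ji]]]] := surjX (dualmod N).
pose i' : {linear fibre k2 H -> dualmod N} := i.
pose j' : {linear dualmod N -> fibre k2 H} := j.
have ijK m : i' (j' m) = m.
  exact: (congr1 (fun g : {linear dualmod N -> dualmod N} => g m) ij).
have jiK m : j' (i' m) = m.
  exact: (congr1 (fun g : {linear fibre k2 H -> fibre k2 H} => g m) ji).
have eP : linear (fun q : (H : qcoh X) k tk => (i' q).2 : N).
  move=> a q q'.
  have -> : i' (a *: q + q') = dual_const a *: i' q + i' q'.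
    rewrite -linearP; congr (i' (_ + _)).
    exact: esym (@dmod_const _ _ _ (@differential_sq k k2 H) a q).
  by rewrite /= scale0r addr0.
have [eps epsE] := fullS (pullback f H) G (mklin eP).
have epsP (q : (H : qcoh X) k tk) : sval eps k (kid k) q = (i' q).2.
  exact: (congr1 (fun g : {linear (H : qcoh X) k tk -> N} => g q) epsE).
exists H, eps => F h.
pose hV : {linear (F : qcoh X) k tk -> N} := sval h k (kid k).
pose w (v : fibre k2 F) : dualmod N := (hV (differential k2 F v), hV v).
have wP : linear w.
  move=> a v v'.
  have dd z : differential k2 F (differential k2 F z) = 0 := differential_sq z.
  have e : a *: v + v' = (a.1 *: (v : (F : qcoh X) k tk)
      + a.2 *: differential k2 F v) + v' :> (F : qcoh X) k tk by [].
  apply: injective_projections; rewrite /w e.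
    by rewrite /= !linearD !linearZ /= dd ?linear0 ?scaler0 addr0.
  by rewrite /= !linearD !linearZ.
have [u uE] := fullX F H (j' \o mklin wP : {linear fibre k2 F -> fibre k2 H}).
have uP (v : (F : qcoh X) k tk) : sval u k tk v = j' (w v).
  exact: (congr1 (fun g : {linear fibre k2 F -> fibre k2 H} => g v) uE).
exists u; split=> [|v vE].
  apply: inS; apply: linear_ext => q.
  by rewrite -[LHS]/(sval eps k (kid k) (sval u k tk q)) epsP uP ijK.
have vP q : (i' (sval v k tk q)).2 = hV q.
  by rewrite -epsP /hV -vE.
apply: inX; apply: linear_ext => q.
rewrite -[LHS]/(sval u k tk q) -[RHS]/(sval v k tk q) uP -[RHS]jiK; congr (j' _).
apply: injective_projections; last by rewrite vP.
rewrite /w -[LHS]/(hV (differential k2 F q)) -vP qhom_differential.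
have -> : differential k2 H (sval v k tk q) = dual_x k *: (sval v k tk q : fibre k2 H).
  exact: esym (@dmod_x _ _ _ (@differential_sq k k2 H) _).
by rewrite linearZ /= scale0r scale1r add0r.
Qed.

(** A point of the product of the cover with itself over B alpha_2 is a point
    of Spec k with a translation of the trivial torsor, i.e. a point of alpha_2. *)
Definition square_ob : fibprod f f (dual k) :=
  @FibprodOb (Spec k) (Spec k) X f f (dual k) (@dual_const k) (@dual_const k)
    (shift k2 (@dual_const k) (dual_eps k)) (@pring_shift k k2 _ _ _).

Lemma square_initial : initial_object square_ob.
Proof.
move=> R [x y gl glR].
pose p : {rmorphism dual R -> R} := (dual_ev0 R \o B_total gl).
have pE u : p u = (B_total gl u).1 by exact: dual_ev0E.
have pc r : p (dual_const r) = r.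
  by rewrite pE; have /= -> := B_square gl r; exact: glR.
have a2 : p (dual_x R) ^+ 2 = 0 by rewrite -rmorphXn dual_x2 rmorph0.
pose al : {rmorphism dual k -> R} := dual_ext x (exist (fun a : R => a ^+ 2 = 0) _ a2).
have alE u : al u = x u.1 + x u.2 * p (dual_x R) by [].
have xy : x =1 y.
  by move=> c; have := B_base_k gl c; rewrite -[LHS]/(pring gl (x c)) glR.
have alx : al \o @dual_const k =1 x.
  by move=> c; rewrite -[LHS]/(al (dual_const c)) alE /= rmorph0 mul0r addr0.
have aly : al \o @dual_const k =1 y by move=> c; rewrite alx xy.
have pdec (u : dual R) : p u = u.1 + u.2 * p (dual_x R).
  by rewrite [in LHS](dualE u) rmorphD rmorphM !pc.
pose a1 : @phom (Spec k) _ _ (@dual_const k : {rmorphism k -> dual k}) x :=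
  exist (fun q : {rmorphism dual k -> R} => q \o @dual_const k =1 x) al alx.
pose a1' : @phom (Spec k) _ _ (@dual_const k : {rmorphism k -> dual k}) y :=
  exist (fun q : {rmorphism dual k -> R} => q \o @dual_const k =1 y) al aly.
have shE (u : dual (dual k)) :
    (B_total (shift k2 (@dual_const k) (dual_eps k)) u).1 = u.1 + u.2 * dual_x k.
  exact: to_trivE.
have glueE : pcomp gl (mhom f a1) = pcomp (mhom f a1') (shift k2 (@dual_const k) (dual_eps k)).
  apply: (@to_triv_ext k k2) => u.
  rewrite -[LHS]/(B_total gl (dual_map al u)).1 -pE pdec.
  rewrite -[RHS]/(al (B_total (shift k2 (@dual_const k) (dual_eps k)) u).1) shE.
  rewrite rmorphD rmorphM; congr (_ + _ * _).
  by rewrite alE rmorph0 rmorph1 add0r mul1r.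
exists (exist _ (a1, a1') (conj (fun=> erefl) glueE)); split=> //.
move=> -[[[b1 b1P] [b2 b2P]] /= [bb bg]] _.
have bx : b1 (dual_x k) = p (dual_x R).
  have e : (B_total gl (dual_map b1 (dual_x (dual k)))).1
      = b2 (B_total (shift k2 (@dual_const k) (dual_eps k)) (dual_x (dual k))).1.
    exact: (congr1 (fun c : B_hom (triv k2 (@dual_const k)) (triv k2 y) =>
      (B_total c (dual_x (dual k)) : dual R).1) bg).
  move: e; rewrite -pE pdec shE.
  rewrite -[(dual_map _ _).1]/(b1 0) -[(dual_map _ _).2]/(b1 1) rmorph0 rmorph1 add0r mul1r => ->.
  by rewrite -bb /= add0r mul1r.
have b1E : b1 = al.
  apply: rmorph_ext => u; rewrite alE [in LHS](dualE u) rmorphD rmorphM bx.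
  by have /= -> := b1P u.1; have /= -> := b1P u.2.
have b2E : b2 = al by apply: rmorph_ext => u; rewrite -b1E; exact: esym (bb u).
by apply: sig_ext; congr pair; apply: sig_ext.
Qed.

End Cover.

(** * Two model structures on B alpha_2 with the same transfer *)

Definition free_on (A : comNzRingType) (M : lmodType A) (I : Type) (e : I -> M) :
    Prop :=
  forall (N : lmodType A) (n : I -> N),
    exists! h : {linear M -> N}, forall i, h (e i) = n i.

Lemma regular_free (A : comNzRingType) : @free_on A A^o unit (fun=> 1).
Proof.
move=> N n; have hP : linear (fun u : A^o => u *: n tt).
  by move=> a u v; rewrite scalerDl scalerA.
exists (mklin hP); split=> [[]|h hE]; first exact: scale1r.
apply: linear_ext => u; rewrite -[LHS]/(u *: n tt) -(hE tt) -linearZ; congr (h _).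
exact: mulr1.
Qed.

Lemma free_iso (A : comNzRingType) (M M' : lmodType A) (I : Type) (e : I -> M)
    (i : {linear M' -> M}) (j : {linear M -> M'}) :
  cancel i j -> cancel j i -> free_on e -> free_on (j \o e).
Proof.
move=> iK jK eF N n; have [h [hE hU]] := eF N n.
exists (h \o i : {linear M' -> N}); split=> [x|g gE]; first by rewrite /= jK.
apply: linear_ext => m /=.
have -> : h = (g \o j : {linear M -> N}) by apply: hU => x; exact: gE.
by rewrite /= iK.
Qed.

Section EquivalenceModel.
Variables (C : category) (A : comNzRingType) (E : functor C (Mod A)).
Hypothesis EP : equivalence E.

Definition equivalence_model (W : C) : model_structure C :=
  proj_model (bicomplete_equivalence EP (@module_bicomplete A))
    (small_homs_equivalence EP W).

Lemma proj_fib_iso (W W' : C) (a : hom (E W) (E W')) (b : hom (E W') (E W)) :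
  a ∘ b = idm (E W') -> forall X Y (g : hom X Y), proj_fib W g -> proj_fib W' g.
Proof.
move=> ab X Y g gP h; have [inj [full _]] := EP.
have [a' a'E] := full _ _ a; have [b' b'E] := full _ _ b.
have [h' h'E] := gP (h ∘ a'); exists (h' ∘ b').
rewrite compA h'E -compA; suff -> : a' ∘ b' = idm W' by rewrite compm1.
by apply: inj; rewrite fmap_comp a'E b'E ab fmap_id.
Qed.

(** Maps out of a free module are given by the images of the basis, so all
    nonzero free modules define the same fibrations. *)
Lemma proj_fib_free (W : C) (I : Type) (i0 : I)
    (e : I -> (E W : lmodType A)) : free_on e ->
  forall X Y (g : hom X Y), proj_fib W g <->
    (forall y : (E Y : lmodType A), exists x : (E X : lmodType A),
       (fmap E g : {linear (E X : lmodType A) -> (E Y : lmodType A)}) x = y).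
Proof.
move=> eF X Y g; have [inj [full _]] := EP.
pose g' : {linear (E X : lmodType A) -> (E Y : lmodType A)} := fmap E g.
split=> [gP y|gS h].
  have [h [hE _]] := eF (E Y) (fun=> y).
  have [k kE] := full _ _ (h : hom (E W) (E Y)); have [l lE] := gP k.
  pose l' : {linear (E W : lmodType A) -> (E X : lmodType A)} := fmap E l.
  exists (l' (e i0)); rewrite -(hE i0) -[h]kE -lE.
  by rewrite fmap_comp.
pose h' : {linear (E W : lmodType A) -> (E Y : lmodType A)} := fmap E h.
have [x xE] : exists x : I -> (E X : lmodType A), forall i, g' (x i) = h' (e i).
  by apply: (dependent_choice (P := fun i x => g' x = h' (e i))) => i; exact: gS.
have [l [lE _]] := eF (E X) x.
have [m mE] := full _ _ (l : hom (E W) (E X)).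
exists m; apply: inj; rewrite fmap_comp mE.
have [z [_ zU]] := eF (E Y) (fun i => h' (e i)).
rewrite -[RHS]/(h' : hom (E W) (E Y)) -[h'](zU h') //.
by symmetry; apply: zU => i /=; rewrite lE; exact: xE.
Qed.
End EquivalenceModel.

Lemma equivalence_model_transfer (X Y : catAff) (f : catAff_map Y X)
    (A B : comNzRingType) (E : functor (QCoh X) (Mod A))
    (E' : functor (QCoh Y) (Mod B)) (EP : equivalence E) (EP' : equivalence E')
    (W : QCoh X) :
  (forall G : QCoh Y, exists (H : QCoh X) (eps : hom (pullback f H) G),
     universal_to eps) ->
  transfer f (equivalence_model EP W) (equivalence_model EP' (pullback f W)).
Proof.
move=> /right_adjoint_of_universal [G GP]; exists G; split=> //.
exact: proj_model_transferred.
Qed.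

Section TwoModels.
Variables (k : fieldType) (k2 : 2%N \in [pchar k]).
Local Notation X := (Balpha2 k).
Local Notation f := (alpha2_cover k2).
Local Notation tk := (triv k2 (kid k)).

Let EX := fibre_equivalence k2.
Let ES := sections_equivalence (@Spec_initial k).
Let EQ := sections_equivalence (@square_initial k k2).

Let z_linear : linear (fun _ : k^o => 0 : k^o).
Proof. by move=> a v w; rewrite scaler0 addr0. Qed.

Let trivial_rep : lmodType (dual k) :=
  dmod (d := mklin z_linear) (fun _ => erefl : 0 = 0 :> k^o).

Lemma free_trivial_fibre (W : QCoh X) (i : {linear fibre k2 W -> trivial_rep})
    (j : {linear trivial_rep -> fibre k2 W}) : cancel i j -> cancel j i ->
  @free_on k ((W : qcoh X) k tk) unit (fun=> j (1 : k^o)).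
Proof.
move=> iK jK N n; pose h (q : (W : qcoh X) k tk) : N := (i q : k) *: n tt.
have iC a q : i (a *: (q : (W : qcoh X) k tk)) = (a * (i q : k)) :> k.
  have e := @dmod_const _ _ _ (@differential_sq k k2 W) a q.
  by rewrite -[LHS]/(i (a *: (q : (W : qcoh X) k tk)) : k) -e linearZ;
    exact: (@dmod_const k k^o (mklin z_linear) (fun=> erefl) a (i q)).
have hP : linear h.
  move=> a q q'; rewrite /h scalerA -iC -scalerDl; congr (_ *: _).
  exact: linearD.
exists (mklin hP); split=> [[]|h' h'E]; first by rewrite /= /h jK scale1r.
apply: linear_ext => q; rewrite -[LHS]/((i q : k) *: n tt) -(h'E tt) -linearZ.
congr (h' _).
apply: (can_inj iK); rewrite iC jK; exact: mulr1.
Qed.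

Lemma free_regular_fibre (W : QCoh X) (i : {linear fibre k2 W -> (dual k)^o})
    (j : {linear (dual k)^o -> fibre k2 W}) : cancel i j -> cancel j i ->
  @free_on k ((W : qcoh X) k tk) bool
    (fun b => j (if b then 1 else dual_x k)).
Proof.
move=> iK jK N n.
pose h (q : (W : qcoh X) k tk) : N := (i q).1 *: n true + (i q).2 *: n false.
have iC a q : i (a *: (q : (W : qcoh X) k tk)) = (dual_const a * i q) :> dual k.
  have e := @dmod_const _ _ _ (@differential_sq k k2 W) a q.
  by rewrite -e linearZ.
have iD (q q' : (W : qcoh X) k tk) : i (q + q') = i q + i q' by exact: linearD.
have hP : linear h.
  move=> a q q'; rewrite /h iD iC /= mul0r addr0 scalerDr !scalerA !scalerDl.
  by rewrite addrACA.
exists (mklin hP); split=> [[]|h' h'E].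
- by rewrite /= /h jK /= scale1r scale0r addr0.
- by rewrite /= /h jK /= scale1r scale0r add0r.
apply: linear_ext => q; rewrite -[LHS]/(h q) /h -(h'E true) -(h'E false) -!linearZ -linearD.
congr (h' _); apply: (can_inj iK); rewrite iD !iC !jK mulr1 -dualE.
by [].
Qed.

Let fst_linear : linear (fun u : (dual k)^o => u.1 : trivial_rep).
Proof.
move=> a u v; rewrite -[RHS]/((a.1 *: (u.1 : k^o) + a.2 *: (0 : k^o)) + v.1).
by rewrite scaler0 addr0.
Qed.

(** The free module of rank one and the trivial module of dimension one are
    both free after restriction to k, but the surjection of the first onto the
    second is not split. *)
Lemma two_models : exists a b : Model X, a <> b /\
  exists (c : Model (Spec k)) (d : Model (fibprod f f)),
    [/\ transfer f a c, transfer f b c,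
        transfer (fibprod_pr1 f f) c d & transfer (fibprod_pr2 f f) c d].
Proof.
have [Wa [ia [ja [ija jia]]]] := fibre_surj k2 (dual k)^o.
have [Wb [ib [jb [ijb jib]]]] := fibre_surj k2 trivial_rep.
pose ia' : {linear fibre k2 Wa -> (dual k)^o} := ia.
pose ja' : {linear (dual k)^o -> fibre k2 Wa} := ja.
pose ib' : {linear fibre k2 Wb -> trivial_rep} := ib.
pose jb' : {linear trivial_rep -> fibre k2 Wb} := jb.
have iaK : cancel ia' ja'.
  by move=> q; exact: (congr1 (fun g : {linear fibre k2 Wa -> fibre k2 Wa} => g q) jia).
have jaK : cancel ja' ia'.
  by move=> q; exact: (congr1 (fun g : {linear (dual k)^o -> (dual k)^o} => g q) ija).
have ibK : cancel ib' jb'.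
  by move=> q; exact: (congr1 (fun g : {linear fibre k2 Wb -> fibre k2 Wb} => g q) jib).
have jbK : cancel jb' ib'.
  by move=> q; exact: (congr1 (fun g : {linear trivial_rep -> trivial_rep} => g q) ijb).
exists (equivalence_model EX Wa), (equivalence_model EX Wb); split.
  move=> /(congr1 (fun m : Model X => @fib _ (sval m))) /= ab.
  have [g gE] := EX.2.1 Wa Wb
    (jb' \o mklin fst_linear \o ia' : {linear fibre k2 Wa -> fibre k2 Wb}).
  have gP q : sval g k tk q = jb' ((ia' q).1 : k).
    exact: (congr1 (fun g : {linear fibre k2 Wa -> fibre k2 Wb} => g q) gE).
  have ga : proj_fib Wa g.
    apply/(proj_fib_free EX tt (free_iso iaK jaK (@regular_free (dual k)))) => y.
    exists (ja' (dual_const (ib' y : k))).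
    by rewrite -[LHS]/(sval g k tk _) gP jaK; exact: ibK.
  have gb : proj_fib Wb g.
    have e : proj_fib Wa g = proj_fib Wb g by rewrite -[LHS]/(@proj_fib _ Wa _ _ g) ab.
    by rewrite -e.
  have [s sE] := gb (idm Wb).
  pose s' : {linear fibre k2 Wb -> fibre k2 Wa} := fmap (fibre_functor k2) s.
  pose y := ia' (s' (jb' (1 : k^o))).
  have y1 : y.1 = 1.
    have : sval g k tk (sval s k tk (jb' (1 : k^o))) = jb' (1 : k^o).
      exact: (congr1 (fun t : qhom Wb Wb => sval t k tk (jb' (1 : k^o))) sE).
    by rewrite gP => /(congr1 ib'); rewrite !jbK.
  have /(congr1 snd) : dual_x k * y = 0.
    rewrite -[LHS]/(dual_x k *: (y : (dual k)^o)) -!linearZ.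
    have -> : dual_x k *: (1 : trivial_rep) = 0 by rewrite dmod_x.
    by rewrite !linear0.
  by rewrite /= y1 mul0r mul1r add0r => /eqP; rewrite oner_eq0.
have same : equivalence_model ES (pullback f Wa) = equivalence_model ES (pullback f Wb).
  apply: proj_model_eq => U V g.
  have ea := proj_fib_free ES (W := pullback f Wa) true (free_regular_fibre iaK jaK) g.
  have eb := proj_fib_free ES (W := pullback f Wb) tt (free_trivial_fibre ibK jbK) g.
  by rewrite ea eb.
exists (equivalence_model ES (pullback f Wa)).
exists (equivalence_model EQ (pullback (fibprod_pr1 f f) (pullback f Wa))).
split.
- by apply: equivalence_model_transfer; exact: cover_universal.
- by rewrite same; apply: equivalence_model_transfer; exact: cover_universal.
- apply: equivalence_model_transfer; apply: pullback_universal.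
    exact: Spec_initial.
  exact: square_initial.
pose W1 := pullback (fibprod_pr1 f f) (pullback f Wa).
pose W2 := pullback (fibprod_pr2 f f) (pullback f Wa).
(* Both projections send the initial object to the same k-algebra *)
pose M : Mod (dual k) := sections (square_ob k2) W1.
have W12 : equivalence_model EQ W1 = equivalence_model EQ W2.
  apply: proj_model_eq => U V g; split.
    exact: (@proj_fib_iso _ _ _ EQ W1 W2 (idm M) (idm M) (compm1 _)).
  exact: (@proj_fib_iso _ _ _ EQ W2 W1 (idm M) (idm M) (compm1 _)).
rewrite -/W1 W12.
apply: equivalence_model_transfer; apply: pullback_universal.
  exact: Spec_initial.
exact: square_initial.
Qed.

End TwoModels.

Theorem theorem3p2 (k : fieldType) (k2 : 2%N \in [pchar k]%R) :
  (exists a b : Model (Balpha2 k),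
     a <> b /\
     exists ia ib : Model (Spec k),
       [/\ transfer (alpha2_cover k2) a ia,
           transfer (alpha2_cover k2) b ib,
           ia = ib
         & exists j1 j2 : Model (fibprod (alpha2_cover k2) (alpha2_cover k2)),
             [/\ transfer (fibprod_pr1 (alpha2_cover k2) (alpha2_cover k2)) ia j1,
                 transfer (fibprod_pr2 (alpha2_cover k2) (alpha2_cover k2)) ia j2
               & j1 = j2]]) /\
  ~ fppf_separated (Balpha2 k) /\
  ~ fppf_sheaf (Balpha2 k).
Proof.
have [a [b [ab [c [d [ac bc cd cd']]]]]] := two_models k2.
have nsep : ~ separated_along (alpha2_cover k2) by move=> /(_ a b c ac bc).
split; first by exists a, b; split=> //; exists c, c; split=> //; exists d, d.
by split=> [sep|sheaf]; apply: nsep;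
  [exact: (sep _ _ (@Spec_fibered k) (alpha2_cover_fppf k2))|
   have [] := sheaf _ _ (@Spec_fibered k) (alpha2_cover_fppf k2)].
Qed.
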